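(* For each positive integer $N$ let $W^{(N)}$ be a uniformly distributed $N$-by-$N$ random signed permutation matrix, let $H^{(N)}$ be an $N$-by-$N$ deterministic complex Hadamard matrix, and let $$U^{(N)}=\frac{1}{\sqrt N}W^{(N)*}H^{(N)}W^{(N)}.$$ Let $A^{(N)}$ and $B^{(N)}$ be deterministic $N$-by-$N$ hermitian matrices such that $$\sup_{N\ge1}[\![A^{(N)}]\!]<\infty,\qquad \sup_{N\ge1}[\![B^{(N)}]\!]<\infty,$$ and, for all integers $k>0$, $$\lim_{N\to\infty}\frac1N\mathrm{tr}\,(A^{(N)})^k=\mathbf{E}A^k\quad\text{and}\quad \lim_{N\to\infty}\frac1N\mathrm{tr}\,(B^{(N)})^k=\mathbf{E}B^k,$$ where $A$ and $B$ are bounded real random variables with laws $\mu_A$ and $\mu_B$, respectively. Then the noncommutative random variables $$A^{(N)}\quad\text{and}\quad U^{(N)}B^{(N)}U^{(N)*}$$ are asymptotically free. In particular, the law of $A^{(N)}+U^{(N)}B^{(N)}U^{(N)*}$ converges in moments to $\mu_A\boxplus\mu_B$, and (supposing $A^{(N)}$ is nonnegative definite for every $N$) the law of $(A^{(N)})^{1/2}U^{(N)}B^{(N)}U^{(N)*}(A^{(N)})^{1/2}$ converges in moments to $\mu_A\boxtimes\mu_B$.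
   Context: $[\![A]\!]$ is the largest singular value of a matrix $A$ and $\mathrm{tr}$ is the unnormalized trace. A signed permutation matrix is an $N$-by-$N$ matrix with entries $W(i,j)=\epsilon_i\delta_{i,\sigma(j)}$ for some signs $\epsilon_1,\dots,\epsilon_N\in\{\pm1\}$ and some permutation $\sigma\in S_N$. An $N$-by-$N$ complex matrix $H$ is a complex Hadamard matrix if $H/\sqrt N$ is unitary and $|H(i,j)|=1$ for all $i,j$. Random matrices are regarded as noncommutative random variables in the noncommutative probability space consisting of (i) the algebra of $N$-by-$N$ random matrices with essentially bounded complex entries defined on the probability space where $W^{(N)}$ is defined and (ii) the tracial state $Z\mapsto\frac1N\mathbf{E}\,\mathrm{tr}\,Z$. A noncommutative probability space is a pair $(\mathcal{A},\phi)$ with $\mathcal{A}$ a unital complex algebra and $\phi:\mathcal{A}\to\mathbb{C}$ linear with $\phi(1_{\mathcal{A}})=1$ (a state). The joint law of a family $\{a_i\}_{i\in I}$ in $\mathcal{A}$ is the state $f\mapsto\phi(f(\{a_i\}_{i\in I}))$ on the noncommutative polynomial algebra $\mathbb{C}\langle\{\mathbf{X}_i\}_{i\in I}\rangle$. Unital subalgebras $\{\mathcal{A}_i\}_{i\in I}$ of $\mathcal{A}$ are free with respect to $\phi$ if $\phi(a_1\cdots a_\ell)=0$ whenever $\ell\ge2$, $i_1\ne i_2,\dots,i_{\ell-1}\ne i_\ell$, $a_j\in\mathcal{A}_{i_j}$ and $\phi(a_j)=0$ for all $j$; elements are free if the unital subalgebras they generate are. A sequence of families $\{a_i^{(N)}\}_{i\in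 I}$ (each in its own noncommutative probability space) is asymptotically free if the joint laws converge pointwise on $\mathbb{C}\langle\{\mathbf{X}_i\}_{i\in I}\rangle$ (convergence in moments) and $\{\mathbf{X}_i\}_{i\in I}$ is free with respect to the limit state. The law of a single noncommutative variable $a^{(N)}$ converges in moments to a compactly supported probability measure $\mu$ on $\mathbb{R}$ if its $k$-th moment $\phi^{(N)}((a^{(N)})^k)$ converges to $\int x^k\,d\mu$ for every integer $k\ge 0$. $\boxplus$ and $\boxtimes$ denote additive and multiplicative free convolution: if $a,b$ are free self-adjoint variables with laws $\mu,\nu$, then $\mu\boxplus\nu$ is the law of $a+b$, and, when $a\ge0$, $\mu\boxtimes\nu$ is the law of $a^{1/2}ba^{1/2}$. *)

(* Defs.v *)
From HB Require Import structures.
From mathcomp Require Import all_boot all_order all_algebra all_fingroup.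
From mathcomp.multinomials Require monalg.
From mathcomp Require Import finmap.
From mathcomp Require Import complex spectral sesquilinear.
From mathcomp Require Import all_classical all_reals all_analysis.
From mathcomp Require Import measurable_realfun.
Import (canonicals) monalg.

Set Implicit Arguments.
Unset Strict Implicit.
Unset Printing Implicit Defensive.

Import Order.TTheory GRing.Theory Num.Theory numFieldNormedType.Exports.
Local Open Scope classical_set_scope.
Local Open Scope ring_scope.
Local Open Scope complex_scope.
Local Open Scope sesquilinear_scope.

(* [R[i]] carries its usual topology only under the alias [R[i]^o]. *)
Definition ccvg (R : realType) (u : nat -> R[i]) (l : R[i]) : Prop :=
  (u : nat -> R[i]^o) @ \oo --> (l : R[i]^o).

(* The free algebra on [I], as the monoid algebra over [R[i]] of the free
   monoid of words in [I]. *)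
Definition ncpoly (R : realType) (I : choiceType) : Type :=
  monalg.malg (monalg.fmonom I) R[i].

Section NCPolyAlgebra.
Variables (R : realType) (I : choiceType).
HB.instance Definition _ := GRing.Lalgebra.copy (ncpoly R I)
  (monalg.malg (monalg.fmonom I) R[i]).

Lemma ncpoly_scalerAr (c : R[i]) (p q : ncpoly R I) :
  c *: (p * q) = p * (c *: q).
Proof.
apply/monalg.malgP => k; rewrite monalg.mcoeffZ monalg.mcoeffMl.
rewrite (monalg.mcoeffMlw k (fsubset_refl _) (monalg.msuppZ_le c q)) mulr_sumr.
apply: eq_bigr => i _; rewrite mulr_sumr; apply: eq_bigr => j _.
by rewrite mulrnAr monalg.mcoeffZ mulrCA.
Qed.

HB.instance Definition _ :=
  GRing.Lalgebra_isAlgebra.Build R[i] (ncpoly R I) ncpoly_scalerAr.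
End NCPolyAlgebra.

Definition ncX (R : realType) (I : choiceType) (i : I) : ncpoly R I :=
  monalg.mkmalgU (monalg.fmu i) 1.

Definition nceval (R : realType) (I : choiceType) (A : algType R[i])
    (a : I -> A) (f : ncpoly R I) : A :=
  monalg.mmap (fun c : R[i] => c%:A)
    (fun m => \prod_(i <- monalg.fmonom_val m) a i) f.

(* A state is a unital linear functional; no positivity is required here. *)
Record ncps (R : realType) := NCPS {
  nc_alg :> algType R[i];
  nc_state : {scalar nc_alg};
  nc_state1 : nc_state 1 = 1 }.

Section Laws.
Variable R : realType.

Definition joint_law (S : ncps R) (I : choiceType) (a : I -> S)
  (f : ncpoly R I) : R[i] := nc_state S (nceval a f).

Definition generated_subalg (A : algType R[i]) (X : set A) : set A :=
  smallest (fun B : set A => GRing.subalg_closed (fun x => x \in B)) X.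

Definition free_subalgs (S : ncps R) (I : Type) (B : I -> set S) : Prop :=
  forall (l : nat) (i : nat -> I) (x : nat -> S),
    (2 <= l)%N ->
    (forall j, (j.+1 < l)%N -> i j <> i j.+1) ->
    (forall j, (j < l)%N -> B (i j) (x j) /\ nc_state S (x j) = 0) ->
    nc_state S (\prod_(0 <= j < l) x j) = 0.

Definition free_family (S : ncps R) (I : Type) (a : I -> S) : Prop :=
  free_subalgs (fun i => generated_subalg [set a i]).

Definition asymptotically_free (I : choiceType) (S : nat -> ncps R)
    (a : forall n, I -> S n) : Prop :=
  exists (tau : {scalar ncpoly R I}) (tau1 : tau 1 = 1),
    (forall f, ccvg (fun n => joint_law (a n) f) (tau f)) /\
    free_family (S := NCPS tau1) (@ncX R I).

Definition moment (mu : probability R R) (k : nat) : R :=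
  \int[mu]_x (x ^+ k).

Definition compactly_supported (mu : probability R R) : Prop :=
  exists M : R, mu `[- M, M]%classic = 1%E.

Definition cvg_in_moments (S : nat -> ncps R) (x : forall n, S n)
    (mu : probability R R) : Prop :=
  forall k, ccvg (fun n => nc_state (S n) (x n ^+ k)) (moment mu k)%:C.
End Laws.

(* Laws that are measures on the real line need self-adjoint variables, hence an
   involution for which the state is positive. *)
Record star_ncps (R : realType) := StarNCPS {
  star_space :> ncps R;
  nc_star : star_space -> star_space;
  nc_starK : involutive nc_star;
  nc_star_semilinear : forall (c : R[i]) (x y : star_space),
    nc_star (c *: x + y) = c^* *: nc_star x + nc_star y;
  nc_starM : forall x y : star_space, nc_star (x * y) = nc_star y * nc_star x;
  nc_state_ge0 : forall x : star_space, 0 <= nc_state star_space (nc_star x * x) }.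

Section FreeConvolution.
Variable R : realType.

Definition has_law (S : star_ncps R) (x : S) (mu : probability R R) : Prop :=
  [/\ nc_star x = x, compactly_supported mu
    & forall k, nc_state S (x ^+ k) = (moment mu k)%:C].

Definition free_pair (S : ncps R) (x y : S) : Prop :=
  free_family (fun i : bool => if i then y else x).

(* [rho] is the free convolution of [mu] and [nu]. A relation suffices: by
   freeness the moments of [a + b], resp. [r * b * r], depend only on [mu] and
   [nu], and the moments of a compactly supported measure determine it. *)
Definition is_free_addconv (mu nu rho : probability R R) : Prop :=
  exists (S : star_ncps R) (a b : S),
    [/\ has_law a mu, has_law b nu, free_pair a b & has_law (a + b) rho].

(* [r] is the nonnegative square root of [r * r], the variable of law [mu];
   nonnegativity of [r] is read off its law. The square root of [a] lies in the
   closed algebra generated by [a], so that it is the pair [r, b] that is free. *)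
Definition is_free_mulconv (mu nu rho : probability R R) : Prop :=
  exists (S : star_ncps R) (r b : S) (lambda : probability R R),
    [/\ has_law r lambda /\ lambda `[0, +oo[%classic = 1%E,
        has_law (r * r) mu, has_law b nu, free_pair r b
      & has_law (r * b * r) rho].
End FreeConvolution.

Section RandomMatrices.
Variables (d : measure_display) (T : measurableType d) (R : realType).
Variables (P : probability T R) (n : nat).

(* Functions [T -> 'M_n.+1] as an algebra; the index [n] stands for the size
   [n.+1] throughout, matrix rings being defined for positive sizes only. *)
Definition mxfun : Type := T -> 'M[R[i]]_n.+1.
HB.instance Definition _ := GRing.NzRing.on mxfun.
HB.instance Definition _ := GRing.Lmodule.copy mxfun (T -> 'M[R[i]]_n.+1).
Lemma mxfun_scalerAl (c : R[i]) (X Y : mxfun) : c *: (X * Y) = c *: X * Y.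
Proof. by apply/funext => w; rewrite /GRing.scale /= /GRing.mul /= scalemxAl. Qed.
HB.instance Definition _ :=
  GRing.Lmodule_isLalgebra.Build R[i] mxfun mxfun_scalerAl.
Lemma mxfun_scalerAr (c : R[i]) (X Y : mxfun) : c *: (X * Y) = X * (c *: Y).
Proof. by apply/funext => w; rewrite /GRing.scale /= /GRing.mul /= scalemxAr. Qed.
HB.instance Definition _ :=
  GRing.Lalgebra_isAlgebra.Build R[i] mxfun mxfun_scalerAr.

Definition cmeasurable (f : T -> R[i]) : Prop :=
  measurable_fun setT (fun w => complex.Re (f w)) /\
  measurable_fun setT (fun w => complex.Im (f w)).

Definition ess_bounded (f : T -> R[i]) : Prop :=
  exists M : R, {ae P, forall w, `|f w| <= M%:C}.

Definition rmx_pred : {pred mxfun} := fun X =>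
  `[< forall i j, cmeasurable (fun w => X w i j) /\ ess_bounded (fun w => X w i j) >].

Definition cexpect (f : T -> R[i]) : R[i] :=
  (\int[P]_w complex.Re (f w)) +i* (\int[P]_w complex.Im (f w)).

Lemma cmeasurable_cst c : cmeasurable (fun=> c).
Proof. by split; exact: measurable_cst. Qed.

Lemma cmeasurableD f g : cmeasurable f -> cmeasurable g ->
  cmeasurable (fun w => f w + g w).
Proof.
move=> [f1 f2] [g1 g2]; split.
- rewrite (_ : (fun w => _) = (fun w => complex.Re (f w) + complex.Re (g w))).
    exact: measurable_funD.
  by apply/funext => w; case: (f w); case: (g w).
- rewrite (_ : (fun w => _) = (fun w => complex.Im (f w) + complex.Im (g w))).
    exact: measurable_funD.
  by apply/funext => w; case: (f w); case: (g w).
Qed.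

Lemma cmeasurableM f g : cmeasurable f -> cmeasurable g ->
  cmeasurable (fun w => f w * g w).
Proof.
move=> [f1 f2] [g1 g2]; split.
- rewrite (_ : (fun w => _) = (fun w => complex.Re (f w) * complex.Re (g w)
    - complex.Im (f w) * complex.Im (g w))).
    by apply: measurable_funB; exact: measurable_funM.
  by apply/funext => w; case: (f w); case: (g w).
- rewrite (_ : (fun w => _) = (fun w => complex.Re (f w) * complex.Im (g w)
    + complex.Im (f w) * complex.Re (g w))).
    by apply: measurable_funD; exact: measurable_funM.
  by apply/funext => w; case: (f w); case: (g w).
Qed.

Lemma cmeasurable_conj f : cmeasurable f -> cmeasurable (fun w => (f w)^*).
Proof.
move=> [f1 f2]; split.
- by rewrite (_ : (fun w => _) = (fun w => complex.Re (f w))) //;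
    apply/funext => w; case: (f w).
- rewrite (_ : (fun w => _) = (fun w => - complex.Im (f w))).
    exact: measurable_funN.
  by apply/funext => w; case: (f w).
Qed.

Lemma ess_bounded_cst c : ess_bounded (fun=> c).
Proof.
exists (Num.sqrt (complex.Re c ^+ 2 + complex.Im c ^+ 2)).
by apply: aeW => w; rewrite normc_def.
Qed.

Lemma ess_boundedD f g : ess_bounded f -> ess_bounded g ->
  ess_bounded (fun w => f w + g w).
Proof.
move=> [M Mf] [N Ng]; exists (M + N).
apply: filterS2 Mf Ng => w Mf Ng.
by rewrite rmorphD /= (le_trans (ler_normD _ _))// lerD.
Qed.

Lemma ess_boundedM f g : ess_bounded f -> ess_bounded g ->
  ess_bounded (fun w => f w * g w).
Proof.
move=> [M Mf] [N Ng]; exists (M * N).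
apply: filterS2 Mf Ng => w Mf Ng.
by rewrite rmorphM /= normrM ler_pM.
Qed.

Lemma ess_bounded_conj f : ess_bounded f -> ess_bounded (fun w => (f w)^*).
Proof.
by move=> [M Mf]; exists M; apply: filterS Mf => w; rewrite norm_conjC.
Qed.

Lemma cmeasurable_sum (I : Type) (r : seq I) (F : I -> T -> R[i]) :
  (forall i, cmeasurable (F i)) -> cmeasurable (fun w => \sum_(i <- r) F i w).
Proof.
move=> HF; elim: r => [|i r IHr].
  rewrite (_ : (fun w => _) = (fun=> 0)); first exact: cmeasurable_cst.
  by apply/funext => w; rewrite big_nil.
rewrite (_ : (fun w => _) = (fun w => F i w + \sum_(j <- r) F j w)).
  exact: cmeasurableD.
by apply/funext => w; rewrite big_cons.
Qed.

Lemma ess_bounded_sum (I : Type) (r : seq I) (F : I -> T -> R[i]) :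
  (forall i, ess_bounded (F i)) -> ess_bounded (fun w => \sum_(i <- r) F i w).
Proof.
move=> HF; elim: r => [|i r IHr].
  rewrite (_ : (fun w => _) = (fun=> 0)); first exact: ess_bounded_cst.
  by apply/funext => w; rewrite big_nil.
rewrite (_ : (fun w => _) = (fun w => F i w + \sum_(j <- r) F j w)).
  exact: ess_boundedD.
by apply/funext => w; rewrite big_cons.
Qed.

Lemma rmx_pred_cst (c : 'M[R[i]]_n.+1) : (fun=> c) \in rmx_pred.
Proof.
apply/asboolP => i j.
by split; [exact: cmeasurable_cst | exact: ess_bounded_cst].
Qed.

Lemma rmx_pred_subalg : GRing.subalg_closed rmx_pred.
Proof.
split; first exact: rmx_pred_cst.
- move=> c X Y /asboolP HX /asboolP HY; apply/asboolP => i j.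
  have [mX bX] := HX i j; have [mY bY] := HY i j.
  rewrite (_ : (fun w => _) = (fun w => c * X w i j + Y w i j)); last first.
    by apply/funext => w; rewrite !mxE.
  split.
    by apply: cmeasurableD => //; apply: cmeasurableM => //; exact: cmeasurable_cst.
  by apply: ess_boundedD => //; apply: ess_boundedM => //; exact: ess_bounded_cst.
- move=> X Y /asboolP HX /asboolP HY; apply/asboolP => i j.
  rewrite (_ : (fun w => _) = (fun w => \sum_k X w i k * Y w k j)); last first.
    by apply/funext => w; rewrite !mxE.
  split.
    apply: cmeasurable_sum => k; apply: cmeasurableM.
      by have [] := HX i k.
    by have [] := HY k j.
  apply: ess_bounded_sum => k; apply: ess_boundedM.
    by have [] := HX i k.
  by have [] := HY k j.
Qed.

Lemma rmx_pred_adj (X : mxfun) : X \in rmx_pred -> (fun w => (X w)^t* ) \in rmx_pred.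
Proof.
move=> /asboolP HX; apply/asboolP => i j; have [mX bX] := HX j i.
rewrite (_ : (fun w => _) = (fun w => (X w j i)^* )); last first.
  by apply/funext => w; rewrite !mxE.
by split; [exact: cmeasurable_conj | exact: ess_bounded_conj].
Qed.

Lemma integrable_part (g : T -> R) : measurable_fun setT g ->
  (exists M : R, {ae P, forall w, `|g w| <= M}) -> P.-integrable setT (EFin \o g).
Proof.
move=> mg [M Mg]; apply/integrableP; split; first exact/measurable_EFinP.
apply: (@le_lt_trans _ _ (`|M|%:E * P setT)%E); last first.
  by rewrite probability_setT mule1 ltry.
apply: integral_le_bound => //; first exact/measurable_EFinP.
apply: filterS Mg => w Mg _; rewrite /= lee_fin.
by rewrite (le_trans Mg)// ler_norm.
Qed.

Lemma integrable_Re f : cmeasurable f -> ess_bounded f ->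
  P.-integrable setT (EFin \o (fun w => complex.Re (f w))).
Proof.
move=> [mf _] [M Mf]; apply: integrable_part => //; exists M.
by apply: filterS Mf => w; rewrite -lecR; apply: le_trans; exact: normc_ge_Re.
Qed.

Lemma integrable_Im f : cmeasurable f -> ess_bounded f ->
  P.-integrable setT (EFin \o (fun w => complex.Im (f w))).
Proof.
move=> [_ mf] [M Mf]; apply: integrable_part => //; exists M.
apply: filterS Mf => w; rewrite -lecR; apply: le_trans.
rewrite normc_def lecR -sqrtr_sqr ler_wsqrtr// lerDr; exact: sqr_ge0.
Qed.

Lemma cexpect_linear (c : R[i]) f g : cmeasurable f -> ess_bounded f ->
  cmeasurable g -> ess_bounded g ->
  cexpect (fun w => c * f w + g w) = c * cexpect f + cexpect g.
Proof.
move=> mf bf mg bg; case: c => a b.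
have iRf := integrable_Re mf bf; have iIf := integrable_Im mf bf.
have iRg := integrable_Re mg bg; have iIg := integrable_Im mg bg.
have iZ (r : R) (h : T -> R) : P.-integrable setT (EFin \o h) ->
    P.-integrable setT (EFin \o (fun w => r * h w)).
  move=> ih; have := integrableZl measurableT r ih.
  by apply: eq_integrable => // w _.
rewrite /cexpect.
have -> : \int[P]_w complex.Re ((a +i* b) * f w + g w) =
    a * \int[P]_w complex.Re (f w) - b * \int[P]_w complex.Im (f w)
    + \int[P]_w complex.Re (g w).
  rewrite -!RintegralZl// -RintegralB//; [|exact: iZ|exact: iZ].
  rewrite -RintegralD//.
    by apply: eq_Rintegral => w _; case: (f w); case: (g w).
  have := integrableB measurableT (iZ a _ iRf) (iZ b _ iIf).
  by apply: eq_integrable => // w _.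
have -> : \int[P]_w complex.Im ((a +i* b) * f w + g w) =
    a * \int[P]_w complex.Im (f w) + b * \int[P]_w complex.Re (f w)
    + \int[P]_w complex.Im (g w).
  rewrite -!RintegralZl// -RintegralD//; [|exact: iZ|exact: iZ].
  rewrite -RintegralD//.
    by apply: eq_Rintegral => w _; case: (f w); case: (g w).
  have := integrableD measurableT (iZ a _ iIf) (iZ b _ iRf).
  by apply: eq_integrable => // w _.
by [].
Qed.

(* Random matrices with essentially bounded entries (as functions, not as
   classes modulo almost sure equality). *)
Record rmx : Type := Rmx { rmx_val : mxfun; _ : rmx_val \in rmx_pred }.
HB.instance Definition _ := [isSub for rmx_val].
Definition rmx_fun (X : rmx) : T -> 'M[R[i]]_n.+1 := rmx_val X.
Coercion rmx_fun : rmx >-> Funclass.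
HB.instance Definition _ := [Choice of rmx by <:].
HB.instance Definition _ :=
  GRing.isSubalgClosed.Build R[i] mxfun rmx_pred
    (GRing.subalg_closed_semi rmx_pred_subalg).
HB.instance Definition _ := [SubChoice_isSubAlgebra of rmx by <:].

Definition rmx_cst (M : 'M[R[i]]_n.+1) : rmx := Rmx (rmx_pred_cst M).
Definition rmx_adj (X : rmx) : rmx := Rmx (rmx_pred_adj (valP X)).

Definition rmx_state (Z : rmx) : R[i] :=
  n.+1%:R^-1 * cexpect (fun w => \tr (Z w)).

Lemma rmx_state_is_linear : linear_for *%R rmx_state.
Proof.
move=> c X Y; rewrite /rmx_state mulrCA -mulrDr; congr (_ * _).
have tr_ok (Z : rmx) : cmeasurable (fun w => \tr (Z w)) /\
    ess_bounded (fun w => \tr (Z w)).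
  have /asboolP HZ := valP Z; split.
    by apply: cmeasurable_sum => i; have [] := HZ i i.
  by apply: ess_bounded_sum => i; have [] := HZ i i.
have [mX bX] := tr_ok X; have [mY bY] := tr_ok Y.
by rewrite -cexpect_linear//; congr cexpect; apply/funext => w; rewrite linearP.
Qed.
HB.instance Definition _ :=
  GRing.isLinear.Build R[i] rmx R[i] *%R rmx_state rmx_state_is_linear.

Lemma rmx_state1 : rmx_state 1 = 1.
Proof.
rewrite /rmx_state (_ : (fun w => _) = fun=> n.+1%:R); last first.
  by apply/funext => w; rewrite mxtrace1.
have Ecst (r : R) : \int[P]_w r = r.
  rewrite Rintegral_cst// -[RHS]mulr1; congr (_ * _).
  exact: (congr1 fine (probability_setT P)).
rewrite /cexpect !Ecst -(rmorph_nat (real_complex R)) /= complexr0.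
by rewrite -fmorphV -rmorphM mulVf ?pnatr_eq0.
Qed.

Definition rmx_ncps : ncps R := NCPS rmx_state1.
End RandomMatrices.

Definition signed_perm_mx (R : realType) (m : nat) (w : 'M[R[i]]_m) : Prop :=
  exists (eps : 'I_m -> R[i]) (sigma : 'S_m),
    (forall i, eps i = 1 \/ eps i = -1) /\
    w = \matrix_(i, j) (eps i * (i == sigma j)%:R).

(* There are [2 ^ N * N`!] signed permutation matrices of size [N]. *)
Definition uniform_signed_perm d (T : measurableType d) (R : realType)
    (P : probability T R) (n : nat) (W : rmx P n) : Prop :=
  {ae P, forall t, signed_perm_mx (W t)} /\
  forall w, signed_perm_mx w ->
    P [set t | W t = w] = (((2 ^ n.+1 * n.+1`!)%N%:R : R)^-1)%:E.

Definition complex_hadamard (R : realType) (m : nat) (H : 'M[R[i]]_m) : Prop :=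
  (sqrtC m%:R)^-1 *: H \is unitarymx /\ forall i j, `|H i j| = 1.

(* The singular values of [A] are the nonnegative square roots of the eigenvalues
   of [A^t* *m A]; for [0 < m] there are finitely many and at least one, so the
   supremum is attained. *)
Definition max_singular_value (R : realType) (m : nat) (A : 'M[R[i]]_m) : R :=
  sup [set s : R | 0 <= s /\ eigenvalue (A^t* *m A) (s ^+ 2)%:C].

Definition psdmx (R : realType) (m : nat) (A : 'M[R[i]]_m) : Prop :=
  A \is hermsymmx /\ forall v : 'cV[R[i]]_m, 0 <= (v^t* *m A *m v) 0 0.

(* For [A] positive semidefinite this is its positive semidefinite square root,
   see [sqrtmx_sqr] and [sqrtmx_psd] below. *)
Definition sqrtmx (R : realType) (m : nat) (A : 'M[R[i]]_m) : 'M[R[i]]_m :=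
  let V := spectralmx A in
  invmx V *m diag_mx (map_mx sqrtC (spectral_diag A)) *m V.

Section SqrtMx.
Variables (R : realType) (m : nat) (A : 'M[R[i]]_m).
Hypothesis Apsd : psdmx A.
Let V := spectralmx A.

Let AE : A = V^t* *m diag_mx (spectral_diag A) *m V.
Proof.
rewrite -invmx_unitary ?spectral_unitarymx//.
by apply/orthomx_spectralP/hermitian_normalmx; case: Apsd.
Qed.

Lemma spectral_diag_psd i : 0 <= spectral_diag A 0 i.
Proof.
have [_ /(_ ((row i V)^t* ))] := Apsd; rewrite trmxCK.
have VV : V *m V^t* = 1%:M by apply/unitarymxP; exact: spectral_unitarymx.
have -> : row i V *m A *m (row i V)^t* = row i (V *m A *m V^t* ) *m (delta_mx 0 i)^T.
  rewrite !row_mul -!mulmxA; congr (_ *m _); congr (_ *m _).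
  by rewrite trmx_delta -colE; apply/matrixP => j k; rewrite !mxE.
rewrite {1}AE !mulmxA VV mul1mx -mulmxA VV mulmx1.
by rewrite trmx_delta -colE !mxE eqxx mulr1n.
Qed.

Lemma sqrtmx_sqr : sqrtmx A *m sqrtmx A = A.
Proof.
rewrite /sqrtmx -/V invmx_unitary ?spectral_unitarymx//.
rewrite {3}AE !mulmxA; congr (_ *m _); rewrite -!mulmxA; congr (_ *m _).
rewrite (mulmxA V) (_ : V *m V^t* = 1%:M) ?mul1mx; last first.
  by apply/unitarymxP; exact: spectral_unitarymx.
rewrite mulmx_diag; congr diag_mx; apply/rowP => j; rewrite !mxE.
by rewrite -expr2 sqrtCK.
Qed.

Lemma sqrtmx_psd : psdmx (sqrtmx A).
Proof.
rewrite /sqrtmx -/V invmx_unitary ?spectral_unitarymx//.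
pose D := map_mx sqrtC (spectral_diag A); rewrite -/D.
have D_ge0 i : 0 <= D 0 i by rewrite mxE sqrtC_ge0 spectral_diag_psd.
split.
  apply/is_hermitianmxP; rewrite expr0 scale1r !trmx_mul !map_mxM trmxCK.
  rewrite tr_diag_mx map_diag_mx mulmxA; congr (_ *m diag_mx _ *m _).
  by apply/rowP => j; rewrite [RHS]mxE; exact/esym/geC0_conj.
move=> v; have -> : v^t* *m (V^t* *m diag_mx D *m V) *m v =
    (V *m v)^t* *m diag_mx D *m (V *m v).
  by rewrite trmx_mul map_mxM !mulmxA.
move: (V *m v) => u; rewrite mxE sumr_ge0// => j _.
have -> : (u^t* *m diag_mx D) 0 j = (u j 0)^* * D 0 j.
  by rewrite mul_mx_diag !mxE.
by rewrite mulrAC mulr_ge0// mulrC mul_conjC_ge0.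
Qed.
End SqrtMx.

(* Main.v *)
(* Asymptotic freeness is the vanishing, in the limit, of the mean normalized trace
   of words in traceless matrices, every other one conjugated by [U]. Moving
   the signed permutation onto the letters, the trace of such a word of length [l]
   is a sum over paths, weighted by entries of the unitary matrices between the
   letters, all of size [1 / sqrt N] except for the last one, which closes the
   cycle. Averaging over signs keeps the paths that visit every vertex an even
   number of times, and averaging over permutations makes the weights invariant
   under relabelling. Each letter is split into its diagonal and its off-diagonal
   part: a diagonal part of zero trace gains a factor [sqrt N] over the trivial
   bound, and for off-diagonal parts the even paths are the mean of a product of
   Rademacher chaoses of order two, bounded by hypercontractivity. Both kinds
   contribute [O(sqrt N)] per letter, so that the trace is [O(sqrt N)] and the
   normalized trace tends to 0.

   The free convolutions are realized on noncommutative polynomials with the limit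
   state, whose positivity is inherited from the matrices. Limits of moments of
   uniformly bounded hermitian matrices are moments of a law, the limit of their
   eigenvalue distributions. *)
From HB Require Import structures.
Require Import Defs.
From mathcomp Require Import all_boot all_order all_algebra all_fingroup.
From mathcomp.multinomials Require monalg.
From mathcomp Require Import finmap ring lra zify.
From mathcomp Require Import complex spectral sesquilinear.
From mathcomp Require Import all_classical all_reals all_analysis.
From mathcomp Require Import measurable_realfun.
Import (canonicals) monalg.

Set Implicit Arguments.
Unset Strict Implicit.
Unset Printing Implicit Defensive.

Import Order.TTheory GRing.Theory Num.Theory numFieldNormedType.Exports.
Local Open Scope classical_set_scope.
Local Open Scope ring_scope.
Local Open Scope complex_scope.
Local Open Scope sesquilinear_scope.

(** * Sums over words with few coincidences *)

(** The powers of [q = sqrt N] balance as follows. A word of [l] letters has [l - 1] inner gaps,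
    each filled by the Hadamard unitary or its adjoint, since alternation rules out cancellation: a
    factor [q ^- (l - 1)]. The sum over paths is [O(q ^+ l)], one [q] survives, and division by [N]
    leaves [O(1 / q)]. The closing gap is the identity when the word begins and ends on the same
    side, so that nothing better than modulus 1 can be asked of it. Two obstacles shape the rest.
    The path weight couples the vertex of a zero-sum diagonal letter with all others; only the
    average over permutations makes the weight constant in a vertex that meets no other, so that
    coincidences alone remain. And polynomial letters are centered only in the limit: exact
    centering is traded against shorter words, both to make alternating words vanish and to obtain
    limits for all words. For the multiplicative convolution the root of [A] must be free from [B]:
    the model is run a second time with the root in place of [A], whose moments have to be shown to
    converge. *)

Fixpoint wsum (M : nmodType) (T : finType) (l : nat) (F : seq T -> M) : M :=
  if l is l'.+1 then \sum_(x : T) wsum l' (fun s => F (x :: s)) else F [::].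

Fixpoint zprod (C : pzSemiRingType) (T : Type) (gs : seq (T -> C)) (s : seq T) : C :=
  match gs, s with g :: gs', x :: s' => g x * zprod gs' s' | _, _ => 1 end.

Fixpoint All (T : Type) (P : T -> Prop) (s : seq T) : Prop :=
  if s is x :: s' then P x /\ All P s' else True.

Lemma All_impl (T : Type) (P Q : T -> Prop) s :
  (forall x, P x -> Q x) -> All P s -> All Q s.
Proof. by move=> PQ; elim: s => //= x s IH [/PQ ? /IH]. Qed.

Lemma ler_sum_All (R : numDomainType) (T : Type) (F : T -> R) B s :
  All (fun x => F x <= B) s -> \sum_(x <- s) F x <= (size s)%:R * B.
Proof.
elim: s => [_|x s IH [xB /IH]] /=; first by rewrite big_nil mul0r.
by rewrite big_cons -[_.+1]add1n natrD mulrDl mul1r; exact: lerD.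
Qed.

Section WSum.
Variable T : finType.

Lemma eq_wsum (M : nmodType) l (F G : seq T -> M) :
  (forall s, size s = l -> F s = G s) -> wsum l F = wsum l G.
Proof.
elim: l F G => [|l IH] F G FG /=; first exact: FG.
by apply: eq_bigr => x _; apply: IH => s sl; apply: FG; rewrite /= sl.
Qed.

Lemma wsum0 (M : nmodType) l : wsum l (fun _ : seq T => 0 : M) = 0.
Proof. by elim: l => //= l ->; rewrite big1. Qed.

Lemma wsum_sum (M : nmodType) (I : Type) (r : seq I) (P : pred I) l
    (F : I -> seq T -> M) :
  wsum l (fun s => \sum_(i <- r | P i) F i s) = \sum_(i <- r | P i) wsum l (F i).
Proof.
elim: l F => [|l IH] F //=.
by rewrite exchange_big; apply: eq_bigr => x _; exact: IH.
Qed.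

Lemma wsumD (M : nmodType) l (F G : seq T -> M) :
  wsum l (fun s => F s + G s) = wsum l F + wsum l G.
Proof.
elim: l F G => [|l IH] F G //=.
by rewrite -big_split; apply: eq_bigr => x _; exact: IH.
Qed.

Lemma raddf_wsum (M M' : nmodType) (f : {additive M -> M'}) l (F : seq T -> M) :
  f (wsum l F) = wsum l (fun s => f (F s)).
Proof.
elim: l F => [|l IH] F //=.
by rewrite raddf_sum; apply: eq_bigr => x _; exact: IH.
Qed.

Lemma mulr_wsumr (C : pzSemiRingType) l (F : seq T -> C) c :
  c * wsum l F = wsum l (fun s => c * F s).
Proof.
elim: l F => [|l IH] F //=.
by rewrite mulr_sumr; apply: eq_bigr => x _; exact: IH.
Qed.

Lemma mulr_wsuml (C : pzSemiRingType) l (F : seq T -> C) c :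
  wsum l F * c = wsum l (fun s => F s * c).
Proof.
elim: l F => [|l IH] F //=.
by rewrite mulr_suml; apply: eq_bigr => x _; exact: IH.
Qed.

Lemma wsum_map (M : nmodType) (f : T -> T) l (F : seq T -> M) :
  bijective f -> wsum l (fun s => F (map f s)) = wsum l F.
Proof.
move=> bf; elim: l F => [|l IH] F //=.
rewrite [RHS](reindex f); last exact: onW_bij.
by apply: eq_bigr => x _; rewrite (IH (fun s => F (f x :: s))).
Qed.

Lemma wsum_zprod (C : pzSemiRingType) (gs : seq (T -> C)) :
  wsum (size gs) (zprod gs) = \prod_(g <- gs) \sum_x g x.
Proof.
elim: gs => [|g gs IH] /=; first by rewrite big_nil.
rewrite big_cons mulr_suml; apply: eq_bigr => x _.
by rewrite -IH mulr_wsumr.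
Qed.

Lemma ler_wsum (C : numDomainType) l (F G : seq T -> C) :
  (forall s, size s = l -> F s <= G s) -> wsum l F <= wsum l G.
Proof.
elim: l F G => [|l IH] F G FG /=; first exact: FG.
by apply: ler_sum => x _; apply: IH => s sl; apply: FG; rewrite /= sl.
Qed.

Lemma ler_norm_wsum (C : numDomainType) l (F : seq T -> C) :
  `|wsum l F| <= wsum l (fun s => `|F s|).
Proof.
elim: l F => [|l IH] F //=.
by apply: le_trans (ler_norm_sum _ _ _) _; apply: ler_sum => x _; exact: IH.
Qed.

Lemma zprodM (C : comPzSemiRingType) (gs : seq (T -> C)) s c :
  size gs = size s ->
  zprod (map (fun g => fun x => c x * g x) gs) s = \prod_(x <- s) c x * zprod gs s.
Proof.
elim: gs s => [|g gs IH] [|x s] //=; first by rewrite big_nil mulr1.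
by move=> [/IH ->]; rewrite big_cons mulrACA.
Qed.

Lemma ler_norm_zprod (C : numDomainType) (gs : seq (T -> C)) s :
  `|zprod gs s| = zprod (map (fun g => fun x => `|g x|) gs) s.
Proof.
by elim: gs s => [|g gs IH] [|x s] /=; rewrite ?normr1// normrM IH.
Qed.

End WSum.

Lemma exchange_wsum (M : nmodType) (T T' : finType) l l' (F : seq T -> seq T' -> M) :
  wsum l (fun s => wsum l' (F s)) = wsum l' (fun t => wsum l (F^~ t)).
Proof.
elim: l F => [|l IH] F //=.
by rewrite wsum_sum; apply: eq_bigr => x _; exact: IH.
Qed.

Section DiagonalSums.
Variables (C : numFieldType) (V : finType) (q : C).
Hypotheses (q1 : 1 <= q) (qV : q ^+ 2 = #|V|%:R).

Let q0 : 0 <= q. Proof. exact: le_trans ler01 q1. Qed.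

(** With [r] the vertices already fixed, [c] may depend on how its letters coincide with each other
    and with [r], but not on their names. *)
Definition stab_inv (r : seq V) (c : seq V -> C) :=
  forall t : {perm V}, (forall u, u \in r -> t u = u) ->
  forall s, c (map t s) = c s.

Lemma stab_inv_cons r c u : stab_inv r c -> stab_inv (u :: r) (fun s => c (u :: s)).
Proof.
move=> ci t tr s; rewrite -[in LHS](tr u) ?mem_head//.
by rewrite -map_cons; apply: ci => v vr; rewrite tr// inE vr orbT.
Qed.

Lemma stab_inv_cons_mem r c u : u \in r -> stab_inv r c ->
  stab_inv r (fun s => c (u :: s)).
Proof.
by move=> ur ci t tr s; rewrite -[in LHS](tr u)// -map_cons; exact: ci.
Qed.

Definition fresh_value (r : seq V) (c : seq V -> C) (s : seq V) : C :=
  if [pick x | x \notin r ++ s] is Some x then c (x :: s) else 0.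

Lemma fresh_valueE r c s x : stab_inv r c -> x \notin r ++ s ->
  c (x :: s) = fresh_value r c s.
Proof.
move=> ci xrs; rewrite /fresh_value; case: pickP => [y yrs|/(_ x)]; last by rewrite xrs.
have id u : u \in r ++ s -> tperm x y u = u.
  by move=> urs; apply: tpermD; apply: contraTneq urs => <-.
rewrite -(ci (tperm x y)); first by rewrite /= tpermL map_id_in// => u us;
  apply: id; rewrite mem_cat us orbT.
by move=> u ur; apply: id; rewrite mem_cat ur.
Qed.

Lemma fresh_value_inv r c : stab_inv r c -> stab_inv r (fresh_value r c).
Proof.
move=> ci t tr s.
have memt x : (t x \in r ++ map t s) = (x \in r ++ s).
  rewrite !mem_cat (mem_map (@perm_inj _ t)); congr (_ || _).
  apply/idP/idP => [txr|xr]; last by rewrite tr.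
  by rewrite (_ : x = t x)//; apply: (@perm_inj _ t); rewrite [in RHS]tr.
case: (pickP [pred x | x \notin r ++ s]) => [x /= xrs|nox].
  rewrite -(fresh_valueE ci xrs) -(ci t tr) /=.
  by rewrite (fresh_valueE ci)// memt.
rewrite /fresh_value; case: pickP => [x|_].
  by rewrite -[x](permKV t) memt; have /= -> := nox (t^-1%g x).
by case: pickP => // x; have /= -> := nox x.
Qed.

Lemma fresh_value_bound r c s (K : C) : 0 <= K -> (forall s, `|c s| <= K) ->
  `|fresh_value r c s| <= K.
Proof.
by move=> K0 cK; rewrite /fresh_value; case: pickP => [x _|_]; rewrite ?normr0.
Qed.

(** A repeated element of [s] is charged to its first position only; a sum over positions allows the
    weight of [x] to be attached to one letter. *)
Lemma sum_mem_index (G : V -> C) (s : seq V) (x0 : V) (P : pred V) :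
  \sum_(x | P x && (x \in s)) G x =
  \sum_(j < size s) (P (nth x0 s j) && (index (nth x0 s j) s == j))%:R * G (nth x0 s j).
Proof.
transitivity (\sum_(x | P x && (x \in s))
    \sum_(j < size s | nth x0 s j == x) (index x s == j)%:R * G x).
  apply: eq_bigr => x /andP[_ xs].
  have xi : (index x s < size s)%N by rewrite index_mem.
  rewrite (bigD1 (Ordinal xi))/= ?nth_index//.
  rewrite eqxx mul1r big1 ?addr0// => j /andP[_].
  by rewrite -val_eqE/= eq_sym => /negbTE ->; rewrite mul0r.
rewrite (exchange_big_dep xpredT)//=; apply: eq_bigr => j _.
rewrite big_mkcond (bigD1 (nth x0 s j))//= big1 ?addr0; last first.
  by move=> x /negbTE xj; rewrite [_ == x]eq_sym xj andbF.
rewrite eqxx mem_nth ?andbT//; case: (P _) => //=; by rewrite mul0r.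
Qed.

(** When the summed vertex coincides with the [j]-th remaining letter, its weight [d] is absorbed
    there; the product need not have zero sum, whence the flag [false]. *)
Fixpoint upd_weight (j : nat) (d : V -> C) (ds : seq (bool * (V -> C))) :=
  match ds, j with
  | [::], _ => [::]
  | p :: ds', 0 => (false, fun x => d x * p.2 x) :: ds'
  | p :: ds', j'.+1 => p :: upd_weight j' d ds'
  end.

Lemma size_upd_weight j d ds : size (upd_weight j d ds) = size ds.
Proof. by elim: ds j => [|p ds IH] [|j] //=; rewrite IH. Qed.

Lemma zprod_upd_weight j d ds s x0 : (j < size s)%N -> size ds = size s ->
  zprod (map snd (upd_weight j d ds)) s = d (nth x0 s j) * zprod (map snd ds) s.
Proof.
elim: ds j s => [|p ds IH] [|j] [|x s] //=; rewrite ?ltnS.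
  by move=> _ _; rewrite mulrA.
by move=> js [dss]; rewrite IH// mulrCA.
Qed.

(** [q ^+ 2 = #|V|] is the trivial bound for one free vertex; a zero-sum weight, marked [true], is
    to cost only [q]. *)
Definition weight_size (b : bool) : C := if b then q else q ^+ 2.

Lemma weight_size_ge0 b : 0 <= weight_size b.
Proof. by rewrite /weight_size; case: b; rewrite ?exprn_ge0. Qed.

Definition weight_ok (p : bool * (V -> C)) :=
  (forall x, `|p.2 x| <= 1) /\ (p.1 -> \sum_x p.2 x = 0).

(** Losing one zero-sum flag costs a factor [q], which is exactly what the absorbed zero-sum letter
    was allowed. *)
Lemma prod_weight_upd j d ds : (j < size ds)%N ->
  \prod_(p <- upd_weight j d ds) weight_size p.1 <=
  q * \prod_(p <- ds) weight_size p.1.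
Proof.
elim: ds j => [|p ds IH] [|j] //=; rewrite ?ltnS.
  move=> _; rewrite !big_cons mulrA ler_wpM2r//.
    by apply: prodr_ge0 => i _; exact: weight_size_ge0.
  rewrite /weight_size /=; case: (p.1); rewrite ?expr2//.
  by rewrite ler_peMl// mulr_ge0.
move=> jd; rewrite !big_cons mulrCA ler_wpM2l ?weight_size_ge0//.
exact: IH.
Qed.

(** The summands serve the two kinds of leading weight. Without zero sum the summed vertex joins the
    [r] fixed ones; with zero sum it must hit one of [r] fixed vertices or [l'] later letters, and
    the centered coefficient is at most twice the original. *)
Fixpoint diag_cst (l r : nat) : nat :=
  if l is l'.+1 then (diag_cst l' r.+1 + 2 * (r + l') * diag_cst l' r)%N else 1%N.

Lemma All_upd_weight j d ds : (forall x, `|d x| <= 1) ->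
  All weight_ok ds -> All weight_ok (upd_weight j d ds).
Proof.
move=> d1; elim: ds j => [|p ds IH] [|j] //= [okp okds]; split=> //.
  by split=> //= x; rewrite normrM mulr_ile1//; have [] := okp.
exact: IH.
Qed.

(* The coefficients are invariant under relabelling, so that [c (x :: s)] does
   not depend on [x] outside [r ++ s]. Subtracting this common value from a
   weight of zero sum leaves [size r + l] values of [x] in place of [#|V|]. *)
Lemma diag_bound l r (K : C) (c : seq V -> C) (ds : seq (bool * (V -> C))) :
  size ds = l -> 0 <= K ->
  All weight_ok ds ->
  stab_inv r c -> (forall s, `|c s| <= K) ->
  `|wsum l (fun s => c s * zprod (map snd ds) s)| <=
  K * (diag_cst l (size r))%:R * \prod_(p <- ds) weight_size p.1.
Proof.
elim: l r K c ds => [|l IH] r K c [|[b d] ds] //=.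
  by move=> _ K0 _ _ cK; rewrite big_nil !mulr1.
move=> [dsl] K0 [[/= d1 dsum0] ok] ci cK; rewrite big_cons /=.
set W := \prod_(_ <- _) _.
have W0 : 0 <= W by apply: prodr_ge0 => i _; exact: weight_size_ge0.
case: b dsum0 => /= dsum0; last first.
  apply: (@le_trans _ _ (\sum_(x : V) K * (diag_cst l (size r).+1)%:R * W)).
    apply: le_trans (ler_norm_sum _ _ _) _; apply: ler_sum => x _.
    rewrite (_ : wsum _ _ = d x * wsum l (fun s => c (x :: s) * zprod (map snd ds) s)).
      rewrite normrM -[leRHS]mul1r; apply: ler_pM => //.
      exact: (IH (x :: r) K (fun s => c (x :: s)) ds dsl K0 ok (stab_inv_cons ci)
        (fun s => cK (x :: s))).
    by rewrite mulr_wsumr; apply: eq_wsum => s _; rewrite mulrCA.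
  rewrite (_ : \sum_x _ = K * (diag_cst l (size r).+1)%:R * W * q ^+ 2); last first.
    by rewrite sumr_const qV [RHS]mulr_natr.
  rewrite -[leLHS]mulrA [W * _]mulrC.
  rewrite ler_wpM2r ?mulr_ge0 ?exprn_ge0// ler_wpM2l//.
  by rewrite ler_nat leq_addr.
have [x0 _|noV] := pickP (fun _ : V => true); last first.
  rewrite big1 ?normr0; first by rewrite !mulr_ge0// weight_size_ge0.
  by move=> x; have := noV x.
have inner s : size s = l ->
    \sum_x c (x :: s) * (d x * zprod (map snd ds) s) =
    \sum_(u <- undup r) d u * ((c (u :: s) - fresh_value r c s) * zprod (map snd ds) s)
    + \sum_(j < l) [&& j < size s, nth x0 s j \notin r & index (nth x0 s j) s == j]%N%:R
      * (c (nth x0 s j :: s) - fresh_value r c s)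
      * zprod (map snd (upd_weight j d ds)) s.
  move=> sl; transitivity
    ((\sum_x (c (x :: s) - fresh_value r c s) * d x) * zprod (map snd ds) s).
    under [in RHS]eq_bigr do rewrite mulrBl.
    rewrite sumrB -mulr_sumr dsum0// mulr0 subr0 mulr_suml.
    by apply: eq_bigr => x _; rewrite mulrA.
  rewrite (bigID (mem r)) /= mulrDl; congr (_ + _).
    rewrite (eq_bigl (fun x => x \in undup r)); last by move=> x; rewrite mem_undup.
    rewrite -big_uniq ?undup_uniq//= mulr_suml.
    by apply: eq_bigr => x _; rewrite -mulrA mulrCA.
  transitivity ((\sum_(x | (x \notin r) && (x \in s))
      (c (x :: s) - fresh_value r c s) * d x) * zprod (map snd ds) s).
    congr (_ * _); rewrite (bigID (mem s))/= [X in _ + X]big1 ?addr0// => x /andP[xr xs].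
    by rewrite (fresh_valueE ci) ?subrr ?mul0r// mem_cat negb_or xr.
  rewrite (sum_mem_index _ _ x0) mulr_suml sl; apply: eq_bigr => j _.
  rewrite (zprod_upd_weight d (ds := ds) (s := s) x0) ?sl//.
  by rewrite ltn_ord /= -!mulrA.
rewrite -wsum_sum (eq_wsum inner) wsumD.
have cf u : u \in r -> stab_inv r (fun s => c (u :: s) - fresh_value r c s).
  move=> ur t tr s; rewrite (fresh_value_inv ci)//.
  by rewrite (stab_inv_cons_mem ur ci).
have cfK u s : `|c (u :: s) - fresh_value r c s| <= 2 * K.
  by rewrite mulr_natl mulr2n (le_trans (ler_normB _ _))// lerD// fresh_value_bound.
have K20 : 0 <= 2 * K by rewrite mulr_ge0.
set D := diag_cst l (size r).
apply: (@le_trans _ _ (2 * K * ((size r)%:R * D%:R * W) + 2 * K * (l%:R * D%:R * (q * W)))).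
  apply: le_trans (ler_normD _ _) _; apply: lerD; rewrite wsum_sum.
    apply: (@le_trans _ _ (\sum_(u <- undup r) 2 * K * D%:R * W)).
      apply: le_trans (ler_norm_sum _ _ _) _.
      rewrite big_seq [leRHS]big_seq; apply: ler_sum => u; rewrite mem_undup => ur.
      rewrite (_ : wsum _ _ = d u * wsum l (fun s =>
          (c (u :: s) - fresh_value r c s) * zprod (map snd ds) s)); last first.
        by rewrite mulr_wsumr.
      rewrite normrM -[leRHS]mul1r; apply: ler_pM => //.
      exact: (IH r _ (fun s => c (u :: s) - fresh_value r c s) ds dsl K20 ok (cf u ur) (cfK u)).
    rewrite big_tnth sumr_const card_ord -[leLHS]mulr_natl -!mulrA.
    rewrite [leLHS]mulrCA ler_wpM2l// [leLHS]mulrCA ler_wpM2l//.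
    by rewrite ler_wpM2r ?mulr_ge0// ler_nat size_undup.
  apply: (@le_trans _ _ (\sum_(j < l) 2 * K * D%:R * (q * W))).
    apply: le_trans (ler_norm_sum _ _ _) _; apply: ler_sum => j _.
    have jds : (j < size ds)%N by rewrite dsl.
    apply: le_trans (IH r (2 * K) (fun s : seq V =>
      [&& j < size s, nth x0 s j \notin r & index (nth x0 s j) s == j]%N%:R *
      (c (nth x0 s j :: s) - fresh_value r c s)) (upd_weight j d ds) _ _ _ _ _) _ => //.
    - by rewrite size_upd_weight.
    - exact: All_upd_weight.
    (* The indicator only records membership in [r] and first occurrence, both unchanged by a
       relabelling that fixes [r]. *)
    - move=> t tr s; rewrite size_map; case: ltnP => js; last by rewrite !mul0r.
      rewrite /= (nth_map x0)// index_map; last exact: perm_inj.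
      case: (boolP (nth x0 s j \in r)) => [xr|xr] /=.
        by rewrite tr// xr !mul0r.
      have -> : (t (nth x0 s j) \in r) = false.
        apply/negP => txr; case/negP: xr.
        by rewrite -(perm_inj (tr _ txr)).
      rewrite (fresh_value_inv ci)//; congr (_ * (_ - _)); exact: (ci t tr (_ :: s)).
    - move=> s; rewrite normrM -[leRHS]mul1r ler_pM// ?normr_nat.
      by case: [&& _, _ & _]; rewrite ?normr1 ?normr0.
    - by rewrite ler_wpM2l ?prod_weight_upd// mulr_ge0.
  rewrite sumr_const card_ord -[leLHS]mulr_natl le_eqVlt; apply/orP; left; apply/eqP.
  by ring.
(* Coincidences with [r] cost [W], those with later letters [q * W]; as [1 <= q], both fit under
   [q * W]. *)
have DW : D%:R * W <= D%:R * (q * W) by rewrite ler_wpM2l// ler_peMl.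
apply: (@le_trans _ _ (2 * K * (((size r)%:R + l%:R) * (D%:R * (q * W))))).
  by rewrite -mulrDr ler_wpM2l// mulrDl lerD// -mulrA ler_wpM2l.
rewrite natrD natrM natrM natrD.
have -> : K * ((diag_cst l (size r).+1)%:R + 2 * ((size r)%:R + l%:R) * D%:R) * (q * W) =
  2 * K * (((size r)%:R + l%:R) * (D%:R * (q * W)))
  + K * (diag_cst l (size r).+1)%:R * (q * W) by ring.
by rewrite lerDl !mulr_ge0.
Qed.
End DiagonalSums.

(** * Hypercontractivity *)
Section Rademacher.
Variable R : realFieldType.
Implicit Types f g p : seq bool -> R.

(** The mean over [n] independent uniform signs, [true] standing for -1; recursion on the first sign
    is the shape of the induction for Bonami's lemma. *)
Fixpoint emean (n : nat) (f : seq bool -> R) : R :=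
  if n is n'.+1 then (emean n' (fun s => f (true :: s))
                      + emean n' (fun s => f (false :: s))) / 2
  else f [::].

Lemma eq_emean n f g : f =1 g -> emean n f = emean n g.
Proof. by elim: n f g => [|n IH] f g fg //=; congr ((_ + _) / _); apply: IH => s. Qed.

Lemma emeanD n f g : emean n (fun s => f s + g s) = emean n f + emean n g.
Proof. by elim: n f g => [|n IH] f g //=; rewrite !IH; field. Qed.

Lemma emeanZ n c f : emean n (fun s => c * f s) = c * emean n f.
Proof. by elim: n f => [|n IH] f //=; rewrite !IH; field. Qed.

Lemma emean_cst n c : emean n (fun=> c) = c.
Proof. by elim: n => //= n ->; field. Qed.

Lemma emean_sum n (I : Type) (r : seq I) (P : pred I) (F : I -> seq bool -> R) :
  emean n (fun s => \sum_(i <- r | P i) F i s) = \sum_(i <- r | P i) emean n (F i).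
Proof.
elim: r => [|i r IH].
  by under eq_emean do rewrite big_nil; rewrite emean_cst big_nil.
under eq_emean do rewrite big_cons; rewrite big_cons -IH.
by case: (P i) => //; rewrite emeanD.
Qed.

Lemma ler_emean n f g : (forall s, f s <= g s) -> emean n f <= emean n g.
Proof.
elim: n f g => [|n IH] f g fg //=; rewrite ler_pM2r ?invr_gt0//.
by apply: lerD; apply: IH.
Qed.

Lemma emean_ge0 n f : (forall s, 0 <= f s) -> 0 <= emean n f.
Proof. by move=> f0; rewrite -(emean_cst n 0); exact: ler_emean. Qed.

Lemma emean_CauchySchwarz n f g :
  emean n (fun s => f s * g s) ^+ 2 <=
  emean n (fun s => f s ^+ 2) * emean n (fun s => g s ^+ 2).
Proof.
elim: n f g => [|n IH] f g /=; first by rewrite exprMn.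
have := IH (fun s => f (true :: s)) (fun s => g (true :: s)).
have := IH (fun s => f (false :: s)) (fun s => g (false :: s)).
set x1 := emean n (fun s => f (false :: s) * _).
set x2 := emean n (fun s => f (true :: s) * _).
have := @emean_ge0 n _ (fun s => sqr_ge0 (f (false :: s))).
have := @emean_ge0 n _ (fun s => sqr_ge0 (f (true :: s))).
have := @emean_ge0 n _ (fun s => sqr_ge0 (g (false :: s))).
have := @emean_ge0 n _ (fun s => sqr_ge0 (g (true :: s))).
set a1 := emean n (fun s => f (false :: s) ^+ 2).
set a2 := emean n (fun s => f (true :: s) ^+ 2).
set b1 := emean n (fun s => g (false :: s) ^+ 2).
set b2 := emean n (fun s => g (true :: s) ^+ 2).
move=> b20 b10 a20 a10 h1 h2.
(* This is [2 x1 x2 <= 2 sqrt(a1 b1 a2 b2) <= a1 b2 + a2 b1], argued on squares to avoid the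
   roots. *)
have h : 2 * (x1 * x2) <= a1 * b2 + a2 * b1.
  rewrite leNgt; apply/negP => lt.
  have z0 : 0 <= a1 * b2 + a2 * b1 by rewrite addr_ge0// mulr_ge0.
  have : (a1 * b2 + a2 * b1) ^+ 2 < (2 * (x1 * x2)) ^+ 2.
    by rewrite ltr_pXn2r// nnegrE// (le_trans z0)// ltW.
  have h3 : (x1 * x2) ^+ 2 <= a1 * b1 * (a2 * b2).
    by rewrite exprMn ler_pM// sqr_ge0.
  have := sqr_ge0 (a1 * b2 - a2 * b1).
  nra.
nra.
Qed.

(** Multilinear polynomials of degree at most [d] in the first [n] signs: [p] is free of the first
    sign and [q], its coefficient, has one degree less. *)
Fixpoint deg_le (n d : nat) (f : seq bool -> R) : Prop :=
  if n is n'.+1 then exists p q : seq bool -> R,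
    [/\ forall b s, f (b :: s) = p s + (-1) ^+ b * q s, deg_le n' d p
      & if d is d'.+1 then deg_le n' d' q else forall s, q s = 0]
  else True.

Lemma deg_le_ext n d f g : f =1 g -> deg_le n d f -> deg_le n d g.
Proof.
case: n => //= n fg [p [q [fpq dp dq]]].
by exists p, q; split=> // b s; rewrite -fg.
Qed.

Lemma deg_le_cst n d c : deg_le n d (fun=> c).
Proof.
elim: n d c => //= n IH d c; exists (fun=> c), (fun=> 0); split=> //.
  by move=> b s; rewrite mulr0 addr0.
by case: d.
Qed.

Lemma deg_leD n d f g : deg_le n d f -> deg_le n d g ->
  deg_le n d (fun s => f s + g s).
Proof.
elim: n d f g => //= n IH d f g [p [q [fpq dp dq]]] [p' [q' [gpq dp' dq']]].
exists (fun s => p s + p' s), (fun s => q s + q' s); split.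
- by move=> b s; rewrite fpq gpq; ring.
- exact: IH.
- by case: d dq dq' {dp dp'} => [q0 q0' s|d]; [rewrite q0 q0' addr0|exact: IH].
Qed.

Lemma deg_leS n d f : deg_le n d f -> deg_le n d.+1 f.
Proof.
elim: n d f => //= n IH d f [p [q [fpq dp dq]]].
exists p, q; split=> //; first exact: IH.
case: d dq {dp} => [q0|d]; last exact: IH.
by apply: (deg_le_ext (f := fun=> 0)) => //; exact: deg_le_cst.
Qed.

Lemma deg_leW n d d' f : (d <= d')%N -> deg_le n d f -> deg_le n d' f.
Proof. by move=> /subnK <-; elim: (d' - d)%N => //= k IH /IH; exact: deg_leS. Qed.

Lemma deg_leM n d d' f g : deg_le n d f -> deg_le n d' g ->
  deg_le n (d + d') (fun s => f s * g s).
Proof.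
elim: n d d' f g => //= n IH d d' f g [p [q [fpq dp dq]]] [p' [q' [gpq dp' dq']]].
exists (fun s => p s * p' s + q s * q' s), (fun s => p s * q' s + q s * p' s); split.
- move=> b s; rewrite fpq gpq; have : (-1) ^+ b * (-1) ^+ b = 1 :> R.
    by rewrite -expr2 sqrr_sign.
  by move=> e; rewrite !(mulrDl, mulrDr) mulrACA e; ring.
- apply: deg_leD; first exact: IH.
  case: d dq {dp} => [q0|d dq].
    by apply: (deg_le_ext (f := fun=> 0)) => [s|]; [rewrite q0 mul0r|exact: deg_le_cst].
  case: d' dq' {dp'} => [q0|d' dq'].
    by apply: (deg_le_ext (f := fun=> 0)) => [s|]; [rewrite q0 mulr0|exact: deg_le_cst].
  by apply: (@deg_leW _ (d + d')); [rewrite leq_add|exact: IH].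
- case: d dp dq => [dp q0|d dp dq]; case: d' dp' dq' => [dp' q0'|d' dp' dq'] /=.
  + by move=> s; rewrite q0 q0' mul0r mulr0 addr0.
  + apply: (deg_le_ext (f := fun s => p s * q' s)) => [s|]; last exact: IH dp dq'.
    by rewrite q0 mul0r addr0.
  + apply: (deg_le_ext (f := fun s => q s * p' s)) => [s|]; last exact: IH.
    by rewrite q0' mulr0 add0r.
  + by apply: deg_leD; [rewrite -addSnnS|]; exact: IH.
Qed.

Lemma deg_leX n d f k : deg_le n d f -> deg_le n (d * k) (fun s => f s ^+ k).
Proof.
move=> df; elim: k => [|k IH].
  by apply: (deg_le_ext (f := fun=> 1)) => //; exact: deg_le_cst.
rewrite mulnS; apply: deg_le_ext (deg_leM df IH) => s.
by rewrite exprS.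
Qed.

Lemma deg_le_sum n d (I : Type) (r : seq I) (F : I -> seq bool -> R) :
  (forall i, deg_le n d (F i)) -> deg_le n d (fun s => \sum_(i <- r) F i s).
Proof.
move=> dF; elim: r => [|i r IH].
  by apply: (deg_le_ext (f := fun=> 0)) => [s|]; [rewrite big_nil|exact: deg_le_cst].
by apply: deg_le_ext (deg_leD (dF i) IH) => s; rewrite big_cons.
Qed.

Lemma deg_le_nth n i : deg_le n 1 (fun s => (-1) ^+ nth false s i).
Proof.
elim: n i => //= n IH [|i].
  exists (fun=> 0), (fun=> 1); split; [|exact: deg_le_cst..].
  by move=> b s /=; rewrite add0r mulr1.
exists (fun s => (-1) ^+ nth false s i), (fun=> 0); split=> //.
- by move=> b s /=; rewrite mulr0 addr0.
- exact: deg_le_cst.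
Qed.

(** Bonami's lemma. Odd powers of the first sign average out and leave
    [p ^+ 4 + 6 * p ^+ 2 * q ^+ 2 + q ^+ 4], whose mixed term is controlled by Cauchy-Schwarz and
    the two induction hypotheses. *)
Lemma bonami n d f : deg_le n d f ->
  emean n (fun s => f s ^+ 4) <= 9 ^+ d * emean n (fun s => f s ^+ 2) ^+ 2.
Proof.
elim: n d f => [|n IH] d f /=.
  move=> _; rewrite -exprM ler_peMl ?exprn_even_ge0//.
  by rewrite exprn_ege1// ler1n.
move=> [p [q [fpq dp dq]]].
have E4 : (emean n (fun s => f (true :: s) ^+ 4) +
   emean n (fun s => f (false :: s) ^+ 4)) / 2 =
   emean n (fun s => p s ^+ 4) + 6 * emean n (fun s => p s ^+ 2 * q s ^+ 2)
   + emean n (fun s => q s ^+ 4).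
  rewrite -emeanZ -!emeanD mulrC -emeanZ; apply: eq_emean => s.
  by rewrite !fpq expr1 expr0; field.
have E2 : (emean n (fun s => f (true :: s) ^+ 2) +
   emean n (fun s => f (false :: s) ^+ 2)) / 2 =
   emean n (fun s => p s ^+ 2) + emean n (fun s => q s ^+ 2).
  rewrite -!emeanD mulrC -emeanZ; apply: eq_emean => s.
  by rewrite !fpq expr1 expr0; field.
rewrite E4 E2.
have := IH _ _ dp.
have := @emean_ge0 n _ (fun s => sqr_ge0 (p s)).
have := @emean_ge0 n _ (fun s => sqr_ge0 (q s)).
set a := emean n (fun s => p s ^+ 2); set b := emean n (fun s => q s ^+ 2).
set P4 := emean n (fun s => p s ^+ 4); set Q4 := emean n (fun s => q s ^+ 4).
have := emean_CauchySchwarz n (fun s => p s ^+ 2) (fun s => q s ^+ 2).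
set x := emean n _; rewrite (_ : emean n _ = P4); last first.
  by apply: eq_emean => s; rewrite -exprM.
rewrite (_ : emean n _ = Q4); last by apply: eq_emean => s; rewrite -exprM.
have x0 : 0 <= x by apply: emean_ge0 => s; rewrite mulr_ge0 ?sqr_ge0.
have Q40 : 0 <= Q4 by apply: emean_ge0 => s; rewrite exprn_even_ge0.
have P40 : 0 <= P4 by apply: emean_ge0 => s; rewrite exprn_even_ge0.
move=> CS b0 a0 Pa.
case: d dp dq Pa => [|d] dp dq Pa.
  have b_0 : b = 0 by rewrite /b -(emean_cst n 0); apply: eq_emean => s; rewrite dq expr0n.
  have Q_0 : Q4 = 0 by rewrite /Q4 -(emean_cst n 0); apply: eq_emean => s; rewrite dq expr0n.
  have x_0 : x = 0 by rewrite /x -(emean_cst n 0); apply: eq_emean => s; rewrite dq expr0n mulr0.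
  by rewrite b_0 Q_0 x_0 mulr0 !addr0.
have := IH _ _ dq; rewrite -/Q4 -/b => Qb.
move: Pa; rewrite exprS; set t := 9 ^+ d in Qb * => Pa.
have t0 : 0 < t by rewrite exprn_gt0.
(* [3 * t] is the geometric mean of the constants [9 * t] for [p] and [t] for [q]; then
   [6 * (3 * t)] is exactly the cross coefficient of [9 * t * (a + b) ^+ 2]. *)
have xab : x <= 3 * t * (a * b).
  have r0 : 0 <= 3 * t * (a * b) by rewrite !mulr_ge0// ltW.
  rewrite -(@ler_pXn2r _ 2)// ?nnegrE//.
  apply: le_trans CS _.
  apply: le_trans (ler_pM P40 Q40 Pa Qb) _.
  by rewrite le_eqVlt; apply/orP; left; apply/eqP; ring.
apply: le_trans (_ : 9 * t * a ^+ 2 + 6 * (3 * t * (a * b)) + t * b ^+ 2 <= _).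
  by rewrite !lerD// ler_pM2l.
have : 0 <= t * b ^+ 2 by rewrite mulr_ge0 ?sqr_ge0// ltW.
nra.
Qed.

(** Each doubling of the exponent applies the fourth moment bound to [f ^+ (2 ^ s')], of degree
    [d * 2 ^ s'], and squares the previous constant. *)
Fixpoint hyper_cst (d s : nat) : R :=
  if s is s'.+1 then 9 ^+ (d * 2 ^ s') * hyper_cst d s' ^+ 2 else 1.

Lemma hyper_cst_ge0 d s : 0 <= hyper_cst d s.
Proof. by elim: s => //= s IH; rewrite mulr_ge0 ?exprn_ge0. Qed.

Lemma hypercontractive n d f s : deg_le n d f ->
  emean n (fun x => f x ^+ (2 ^ s.+1)) <=
  hyper_cst d s * emean n (fun x => f x ^+ 2) ^+ (2 ^ s).
Proof.
move=> df; elim: s => [|s IH]; first by rewrite mul1r expr1.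
have h := bonami (deg_leX (2 ^ s) df).
have -> : emean n (fun x => f x ^+ (2 ^ s.+2)) = emean n (fun x => (f x ^+ (2 ^ s)) ^+ 4).
  by apply: eq_emean => x; rewrite -exprM (_ : 4 = 2 ^ 2)%N // -expnD addn2.
apply: (le_trans h); rewrite /= -mulrA ler_wpM2l ?exprn_ge0//.
rewrite (_ : 2 ^ s.+1 = 2 ^ s * 2)%N; last by rewrite expnS mulnC.
rewrite exprM -exprMn ler_pXn2r// ?nnegrE.
- apply: le_trans IH; rewrite le_eqVlt; apply/orP; left; apply/eqP.
  by apply: eq_emean => x; rewrite -exprM expnS mulnC.
- by apply: emean_ge0 => x; exact: sqr_ge0.
- by rewrite mulr_ge0 ?hyper_cst_ge0// exprn_ge0// emean_ge0// => x; exact: sqr_ge0.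
Qed.

Lemma emean_sign_prod n (m : 'I_n -> nat) :
  emean n (fun s => \prod_(i < n) ((-1) ^+ nth false s i) ^+ m i) =
  \prod_(i < n) (~~ odd (m i))%:R.
Proof.
elim: n m => [|n IH] m /=; first by rewrite !big_ord0.
have step b : emean n (fun s => \prod_(i < n.+1) ((-1) ^+ nth false (b :: s) i) ^+ m i) =
    ((-1) ^+ b) ^+ m ord0 * \prod_(i < n) (~~ odd (m (lift ord0 i)))%:R.
  rewrite -(IH (fun i => m (lift ord0 i))) -emeanZ; apply: eq_emean => s.
  by rewrite big_ord_recl.
rewrite !step big_ord_recl /= expr1 expr0 expr1n -signr_odd.
by case: (odd (m ord0)) => /=; rewrite ?expr1 ?expr0; field.
Qed.

Lemma emean_wsum (T : finType) n l (F : seq bool -> seq T -> R) :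
  emean n (fun s => wsum l (F s)) = wsum l (fun t => emean n (F^~ t)).
Proof.
elim: l F => [|l IH] F //=.
by rewrite emean_sum; apply: eq_bigr => x _; exact: IH.
Qed.
End Rademacher.

(** * Even multiplicities and Rademacher chaoses of order two *)

Section EvenMultiplicities.
Variable V : finType.

Definition evenly (zs : seq V) := [forall v, ~~ odd (count_mem v zs)].

Lemma prod_count_mem (C : comPzSemiRingType) (g : V -> C) zs :
  \prod_(z <- zs) g z = \prod_v g v ^+ count_mem v zs.
Proof.
elim: zs => [|z zs IH]; first by rewrite big_nil big1.
rewrite big_cons IH (bigD1 z)//= [RHS](bigD1 z)//= eqxx exprD expr1 mulrA.
by congr (_ * _); apply: eq_bigr => v /negbTE; rewrite eq_sym => ->.
Qed.

Lemma prod_not_odd (C : comPzSemiRingType) zs :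
  \prod_v (~~ odd (count_mem v zs))%:R = (evenly zs)%:R :> C.
Proof.
rewrite /evenly; case: forallP => [ev|nev]; first by rewrite big1// => v _; rewrite ev.
have [v] : exists v, odd (count_mem v zs).
  apply/existsP; rewrite -[X in is_true X]negbK negb_exists; apply/negP => /forallP.
  exact: nev.
by move=> ov; rewrite (bigD1 v)//= ov mul0r.
Qed.

Lemma sum_sign_prod (C : comPzRingType) zs :
  \sum_(e : {ffun V -> bool}) \prod_(z <- zs) (-1) ^+ e z =
  (2 ^ #|V| * evenly zs)%N%:R :> C.
Proof.
under eq_bigr do rewrite prod_count_mem.
rewrite -(bigA_distr_bigA (fun v (b : bool) => ((-1) ^+ b) ^+ count_mem v zs : C)) /=.
rewrite natrM -(prod_not_odd C) natrX -prodr_const -big_split.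
apply: eq_bigr => v _; rewrite big_bool /= expr1 expr0 expr1n -signr_odd.
by case: odd; rewrite /= ?expr1 ?expr0 ?mulr0 ?mulr1 ?addNr.
Qed.

Variable R : realFieldType.

Definition value_sign (s : seq bool) (v : V) : R := (-1) ^+ nth false s (enum_rank v).

Lemma emean_evenly zs :
  emean #|V| (fun s => \prod_(z <- zs) value_sign s z) = (evenly zs)%:R.
Proof.
have reE (G : V -> R) : \prod_v G v = \prod_(i < #|V|) G (enum_val i).
  by rewrite (reindex (@enum_val V xpredT))//; exact/onW_bij/enum_val_bij.
rewrite -prod_not_odd reE -emean_sign_prod; apply: eq_emean => s.
rewrite prod_count_mem reE; apply: eq_bigr => i _.
by rewrite /value_sign enum_valK.
Qed.

Definition flat (s : seq (V * V)) : seq V := flatten [seq [:: p.1; p.2] | p <- s].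

(** A Rademacher chaos of order two as soon as [Y] vanishes on the diagonal. *)
Definition quad_form (Y : V * V -> R) (s : seq bool) : R :=
  \sum_p value_sign s p.1 * value_sign s p.2 * Y p.

(** The parity indicator is the mean of the product of the signs of all visited vertices; with mean
    and sum exchanged, the sum factorizes letter by letter. *)
Lemma wsum_evenly (Ys : seq (V * V -> R)) :
  wsum (size Ys) (fun s => (evenly (flat s))%:R * zprod Ys s) =
  emean #|V| (fun s => \prod_(Y <- Ys) quad_form Y s).
Proof.
under eq_wsum do rewrite -emean_evenly mulrC -emeanZ.
rewrite -emean_wsum; apply: eq_emean => s.
transitivity (wsum (size Ys)
    (zprod (map (fun Y p => value_sign s p.1 * value_sign s p.2 * Y p) Ys))).
  apply: eq_wsum => t st; rewrite mulrC zprodM//; congr (_ * _).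
  by rewrite /flat big_flatten /= big_map; apply: eq_bigr => p _; rewrite big_cons big_seq1.
rewrite -[size Ys](size_map (fun Y p => value_sign s p.1 * value_sign s p.2 * Y p)).
by rewrite wsum_zprod big_map.
Qed.

Lemma deg_le_quad_form n Y : deg_le n 2 (quad_form Y).
Proof.
apply: deg_le_sum => p; apply: (@deg_leM _ n 2 0); last exact: deg_le_cst.
by apply: (@deg_leM _ n 1 1); exact: deg_le_nth.
Qed.

Lemma evenly4 (a b c e : V) : a != b -> evenly [:: a; b; c; e] ->
  ((c, e) == (a, b)) || ((c, e) == (b, a)).
Proof.
move=> ab /forallP ev; have := ev a; have := ev b; rewrite /= !xpair_eqE.
have ba : b != a by rewrite eq_sym.
rewrite !eqxx (negbTE ab) (negbTE ba) /=.
have [->|ca] := eqVneq c a; rewrite ?(negbTE ab) !(addn0, add0n) ?oddD ?oddb negbK.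
  by case: (e == b) => // _; rewrite negbK; case: (e == a).
by rewrite negbK => cb /eqP ea; move: cb; rewrite ea eqxx andbT (negbTE ab); case: (c == b).
Qed.

(** For [a != b] the four vertices [a, b, c, e] are even only if [(c, e)] is [(a, b)] or [(b, a)].
    The swapped products are bounded by the squares through [2 x y <= x ^+ 2 + y ^+ 2], whence the
    factor 2. *)
Lemma emean_quad_form2 (Y : V * V -> R) : (forall p, 0 <= Y p) ->
  (forall v, Y (v, v) = 0) ->
  emean #|V| (fun s => quad_form Y s ^+ 2) <= 2 * \sum_p Y p ^+ 2.
Proof.
move=> Y0 Yd.
have -> : emean #|V| (fun s => quad_form Y s ^+ 2) =
    \sum_p \sum_p' Y p * Y p' * (evenly [:: p.1; p.2; p'.1; p'.2])%:R.
  under eq_emean do rewrite expr2 /quad_form mulr_suml.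
  rewrite emean_sum; apply: eq_bigr => p _.
  under eq_emean do rewrite mulr_sumr.
  rewrite emean_sum; apply: eq_bigr => p' _.
  rewrite -emean_evenly -emeanZ; apply: eq_emean => s.
  by rewrite !big_cons big_nil; ring.
apply: (@le_trans _ _ (\sum_p (Y p ^+ 2 + Y p * Y (p.2, p.1)))).
  apply: ler_sum => -[a b] _ /=.
  have [<-|ab] := eqVneq a b.
    by rewrite Yd expr0n mul0r addr0 big1// => p' _; rewrite !mul0r.
  rewrite (bigD1 (a, b))//= (bigD1 (b, a))/=; last by rewrite xpair_eqE eq_sym negb_and ab.
  rewrite big1 ?addr0; last first.
    move=> [c e] /andP[n1 n2] /=; case ev: (evenly _); rewrite ?mulr0//.
    by have := evenly4 ab ev; rewrite (negbTE n1) (negbTE n2).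
  apply: lerD; last by rewrite ler_piMr ?mulr_ge0// lern1 leq_b1.
  by rewrite expr2 ler_piMr ?mulr_ge0// lern1 leq_b1.
rewrite big_split /= mulr_natl mulr2n lerD2l.
have swapE : \sum_(p : V * V) Y (p.2, p.1) ^+ 2 = \sum_p Y p ^+ 2.
  rewrite [RHS](reindex (fun p : V * V => (p.2, p.1)))//.
  by exists (fun p : V * V => (p.2, p.1)) => -[].
have : 0 <= \sum_p (Y p - Y (p.2, p.1)) ^+ 2 by apply: sumr_ge0 => p _; exact: sqr_ge0.
have -> : \sum_p (Y p - Y (p.2, p.1)) ^+ 2 =
    2 * \sum_p Y p ^+ 2 - 2 * \sum_p Y p * Y (p.2, p.1).
  rewrite mulr_natl mulr2n -[X in _ + X - _]swapE mulr_sumr -big_split -sumrB.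
  by apply: eq_bigr => p _ /=; ring.
lra.
Qed.

(** A substitute for the Hölder inequality: with [M] the larger of 1 and the greatest factor, the
    product is at most [M ^+ size as_ <= M ^+ e]. One exponent, a power of two, can thus serve all
    factors. *)
Lemma prod_le_sum_pow (as_ : seq R) e : all (fun x => 0 <= x) as_ -> (size as_ <= e)%N ->
  \prod_(x <- as_) x <= 1 + \sum_(x <- as_) x ^+ e.
Proof.
move=> as0 ase.
have [M [M1 asM Me]] : exists M, [/\ 1 <= M, all (fun x => x <= M) as_
    & M ^+ e <= 1 + \sum_(x <- as_) x ^+ e].
  elim: as_ as0 {ase} => [_|x as_ IH /= /andP[x0 as0]].
    by exists 1; rewrite big_nil addr0 expr1n.
  have [M [M1 asM Me]] := IH as0.
  have [xM|Mx] := leP x M.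
    exists M; rewrite M1 xM asM; split=> //.
    by rewrite big_cons addrCA (le_trans Me)// lerDr exprn_ge0.
  exists x; rewrite lexx; split; first exact: le_trans M1 (ltW Mx).
    by apply: sub_all asM => y /le_trans; apply; exact: ltW.
  rewrite big_cons addrCA lerDl addr_ge0// big_seq sumr_ge0// => y ys.
  by rewrite exprn_ge0// (allP as0).
apply: le_trans Me; apply: (@le_trans _ _ (M ^+ size as_)); last exact: ler_weXn2l.
elim: as_ as0 asM {ase} => [|x s IH] /=; first by rewrite big_nil.
move=> /andP[x0 s0] /andP[xM sM]; rewrite big_cons exprS ler_pM ?IH//.
by rewrite big_seq prodr_ge0// => y ys; exact: (allP s0).
Qed.

(** Each of the [l] forms, divided by [q], has second moment at most 2, so its moment of order
    [2 ^ l.+1] is at most [hyper_cst R 2 l * 2 ^+ (2 ^ l)]. *)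
Definition off_cst (l : nat) : R := 1 + l%:R * (hyper_cst R 2 l * 2 ^+ (2 ^ l)).

(* The parity constraint turns the sum into the mean of a product of quadratic
   forms in independent signs, which hypercontractivity controls by their second
   moments. *)
Lemma offdiag_bound (q : R) (Ys : seq (V * V -> R)) : 0 < q ->
  All (fun Y => [/\ forall p, 0 <= Y p, forall v, Y (v, v) = 0
     & \sum_p Y p ^+ 2 <= q ^+ 2]) Ys ->
  wsum (size Ys) (fun s => (evenly (flat s))%:R * zprod Ys s) <=
  off_cst (size Ys) * q ^+ size Ys.
Proof.
move=> q0 okY; rewrite wsum_evenly.
have qn0 : q != 0 by rewrite gt_eqF.
pose Q Y s := quad_form Y s / q.
have -> : emean #|V| (fun s => \prod_(Y <- Ys) quad_form Y s) =
    q ^+ size Ys * emean #|V| (fun s => \prod_(Y <- Ys) Q Y s).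
  rewrite -emeanZ; apply: eq_emean => s.
  elim: Ys {okY} => [|Y Ys IH]; first by rewrite !big_nil mulr1.
  by rewrite !big_cons IH /= exprS /Q; field.
rewrite mulrC ler_wpM2r ?exprn_ge0 ?(ltW q0)//.
set e := (2 ^ (size Ys).+1)%N.
have se : (size Ys <= e)%N.
  by rewrite /e (leq_trans (leqnSn _))// ltnW// ltn_expl.
apply: (@le_trans _ _ (emean #|V| (fun s => 1 + \sum_(Y <- Ys) Q Y s ^+ e))).
  apply: ler_emean => s.
  apply: (@le_trans _ _ (\prod_(x <- [seq `|Q Y s| | Y <- Ys]) x)).
    by rewrite big_map -normr_prod ler_norm.
  apply: le_trans (prod_le_sum_pow (e := e) _ _) _; rewrite ?size_map//.
    by elim: (Ys) => //= Y Ys1 ->; rewrite normr_ge0.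
  rewrite lerD2l big_map le_eqVlt; apply/orP; left; apply/eqP; apply: eq_bigr => Y _.
  by rewrite -normrX ger0_norm// /e expnS exprM exprn_ge0// sqr_ge0.
rewrite emeanD emean_cst lerD2l emean_sum /off_cst.
apply: ler_sum_All; apply: All_impl okY => Y [Y0 Yd Yq].
have dQ : deg_le #|V| 2 (Q Y).
  exact: (@deg_leM _ _ 2 0 _ (fun=> q^-1) (deg_le_quad_form _ _) (deg_le_cst _ _ _)).
apply: le_trans (hypercontractive _ dQ) _.
rewrite ler_wpM2l ?hyper_cst_ge0// lerXn2r ?nnegrE//.
  by apply: emean_ge0 => s; exact: sqr_ge0.
have -> : emean #|V| (fun s => Q Y s ^+ 2) =
    q ^- 2 * emean #|V| (fun s => quad_form Y s ^+ 2).
  by rewrite -emeanZ; apply: eq_emean => s; rewrite /Q exprMn exprVn mulrC.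
rewrite ler_pdivrMl ?exprn_gt0// (le_trans (emean_quad_form2 Y0 Yd))//.
by rewrite mulrC ler_wpM2r.
Qed.
End EvenMultiplicities.

(** * Separation of diagonal and off-diagonal letters *)

Section Interleave.
Variables (V : finType) (C : comPzRingType).
Implicit Types (X : V * V -> C) (G : seq (V * V) -> C).

Definition diag_part X (v : V) : C := X (v, v).
Definition off_part X (p : V * V) : C := if p.1 == p.2 then 0 else X p.

(** [b] marks the letters that take their diagonal part: these repeat one vertex of [vs], the others
    take a pair from [ys]. *)
Fixpoint interleave (b : seq bool) (vs : seq V) (ys : seq (V * V)) : seq (V * V) :=
  match b, vs, ys with
  | true :: b', v :: vs', _ => (v, v) :: interleave b' vs' ys
  | false :: b', _, y :: ys' => y :: interleave b' vs ys'
  | _, _, _ => [::]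
  end.

Definition split_sum G (Xs : seq (V * V -> C)) (b : seq bool) : C :=
  wsum (count id b) (fun vs => wsum (count negb b) (fun ys =>
    G (interleave b vs ys) * (zprod (map diag_part (mask b Xs)) vs
      * zprod (map off_part (mask (map negb b) Xs)) ys))).

Lemma wsum_diag_off G Xs :
  wsum (size Xs) (fun s => G s * zprod Xs s) =
  wsum (size Xs) (fun b => split_sum G Xs b).
Proof.
elim: Xs G => [|X Xs IH] G /=; first by rewrite /split_sum /= !mulr1.
have -> : \sum_p wsum (size Xs) (fun s => G (p :: s) * (X p * zprod Xs s)) =
    \sum_p X p * wsum (size Xs) (fun s => G (p :: s) * zprod Xs s).
  by apply: eq_bigr => p _; rewrite mulr_wsumr; apply: eq_wsum => s _; rewrite mulrCA.
have splitX (F : V * V -> C) : \sum_p X p * F p =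
    \sum_v X (v, v) * F (v, v) + \sum_p off_part X p * F p.
  rewrite (bigID (fun p : V * V => p.1 == p.2)) /=; congr (_ + _).
    rewrite (reindex (fun v : V => (v, v)))/=; last first.
      by exists fst => // -[x y] /=; rewrite inE => /eqP /= ->.
    by apply: eq_bigl => v; rewrite eqxx.
  by rewrite [LHS]big_mkcond; apply: eq_bigr => p _; rewrite /off_part; case: eqP; rewrite ?mul0r.
rewrite splitX big_bool /=; congr (_ + _).
  rewrite /split_sum /= wsum_sum; apply: eq_bigr => v _; rewrite IH mulr_wsumr.
  apply: eq_wsum => b _; rewrite mulr_wsumr; apply: eq_wsum => vs _.
  by rewrite mulr_wsumr; apply: eq_wsum => ys _; rewrite /diag_part; ring.
rewrite /split_sum /=.
under [RHS]eq_wsum do rewrite wsum_sum.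
rewrite wsum_sum; apply: eq_bigr => p _; rewrite IH mulr_wsumr.
apply: eq_wsum => b _; rewrite mulr_wsumr; apply: eq_wsum => vs _.
by rewrite mulr_wsumr; apply: eq_wsum => ys _; ring.
Qed.

Lemma flat_cons (p : V * V) s : flat (p :: s) = p.1 :: p.2 :: flat s.
Proof. by []. Qed.

(** A diagonal letter visits its vertex twice, so the parity constraint falls on the off-diagonal
    letters alone. *)
Lemma evenly_interleave b vs ys : size vs = count id b -> size ys = count negb b ->
  evenly (flat (interleave b vs ys)) = evenly (flat ys).
Proof.
move=> svs sys; apply: eq_forallb => v; congr (~~ _).
elim: b vs ys svs sys => [|[] b IH] [|x vs] [|y ys] //=.
- by rewrite add1n add0n => -[svs] sys; rewrite addnA addnn oddD odd_double IH.
- by rewrite add1n add0n => -[svs] sys; rewrite addnA addnn oddD odd_double IH.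
- by rewrite add1n add0n => svs [sys]; rewrite !oddD IH.
- by rewrite add1n add0n => svs [sys]; rewrite !oddD IH.
Qed.

(** Supplies the invariance that [diag_bound] asks for: a relabelling that fixes the vertices of the
    off-diagonal letters acts on the diagonal ones only. *)
Lemma interleave_map b vs ys (t : V -> V) : (forall u, u \in flat ys -> t u = u) ->
  interleave b (map t vs) ys = map (fun p => (t p.1, t p.2)) (interleave b vs ys).
Proof.
elim: b vs ys => [|[] b IH] [|x vs] [|[y z] ys] //= ty.
- by rewrite IH.
- by rewrite IH.
- congr (_ :: _); first by rewrite !ty// flat_cons !inE eqxx ?orbT.
  by apply: (IH [::]) => u uy; rewrite ty// flat_cons !inE uy !orbT.
- congr (_ :: _); first by rewrite !ty// flat_cons !inE eqxx ?orbT.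
  by apply: (IH (x :: vs)) => u uy; rewrite ty// flat_cons !inE uy !orbT.
Qed.

Lemma size_flat (s : seq (V * V)) : size (flat s) = (2 * size s)%N.
Proof. by elim: s => // p s IH; rewrite flat_cons /= IH mulnS. Qed.
End Interleave.

Section EvenSums.
Variables (R : rcfType) (V : finType).
Local Notation C := R[i].

(** One summand for each choice of the diagonal letters; every off-diagonal letter fixes two
    vertices, whence [2 * count negb b]. *)
Definition word_cst (l : nat) : R :=
  wsum l (fun b : seq bool => (diag_cst (count id b) (2 * count negb b))%:R
     * off_cst R (count negb b)).

Lemma normc_RealE (z : C) : `|z| = (complex.Re `|z|)%:C.
Proof. by rewrite RRe_real// normr_real. Qed.

Lemma All_mask (T : Type) (P : T -> Prop) b s : All P s -> All P (mask b s).
Proof. by elim: s b => [|x s IH] [|[] b] //= [? /IH]. Qed.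

Lemma All_map (T U : Type) (P : U -> Prop) (f : T -> U) s :
  All (fun x => P (f x)) s -> All P (map f s).
Proof. by elim: s => //= x s IH [? /IH]. Qed.

(** The off-diagonal path [ys] is held fixed while the diagonal vertices are summed, with
    cancellation, relative to [flat ys]; only afterwards are absolute values taken in the sum over
    [ys]. *)
Lemma even_sum_bound (q : R) (Xs : seq (V * V -> C)) (c : seq (V * V) -> C) :
  1 <= q -> q ^+ 2 = #|V|%:R ->
  All (fun X => [/\ forall p, `|X p| <= 1, \sum_v X (v, v) = 0
     & \sum_p `|X p| ^+ 2 <= (q ^+ 2)%:C]) Xs ->
  (forall (t : {perm V}) s, c (map (fun p => (t p.1, t p.2)) s) = c s) ->
  (forall s, `|c s| <= 1) ->
  `|wsum (size Xs) (fun s => c s * (evenly (flat s))%:R * zprod Xs s)| <=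
  (word_cst (size Xs) * q ^+ size Xs)%:C.
Proof.
move=> q1 qV okX ci c1.
have q0 : 0 < q := lt_le_trans ltr01 q1.
rewrite wsum_diag_off; apply: le_trans (ler_norm_wsum _ _) _.
rewrite /word_cst mulr_wsuml raddf_wsum.
apply: ler_wsum => b bX; rewrite /split_sum.
set lb := count id b; set ln := count negb b.
have lbn : (lb + ln = size Xs)%N by rewrite -bX -(count_predC id b).
rewrite -lbn exprD.
rewrite exchange_wsum; apply: le_trans (ler_norm_wsum _ _) _.
set ds := map (fun d => (true, d)) (map (@diag_part V C) (mask b Xs)).
set Ys := map (@off_part V C) (mask (map negb b) Xs).
set Ys' := map (fun Y p => complex.Re `|Y p|) Ys.
have sds : size ds = lb by rewrite !size_map size_mask.
have sYs : size Ys' = ln by rewrite !size_map size_mask ?size_map// count_map.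
have dsE : map snd ds = map (@diag_part V C) (mask b Xs).
  by rewrite -map_comp map_id.
apply: (@le_trans _ _ (wsum ln (fun ys => ((diag_cst lb (2 * ln))%:R * q ^+ lb)%:C
    * ((evenly (flat ys))%:R * zprod Ys' ys)%:C))).
  apply: ler_wsum => ys sys.
  have -> : wsum lb (fun vs => c (interleave b vs ys) * (evenly (flat (interleave b vs ys)))%:R
       * (zprod (map (@diag_part V C) (mask b Xs)) vs * zprod Ys ys)) =
      wsum lb (fun vs => c (interleave b vs ys) * zprod (map snd ds) vs)
      * ((evenly (flat ys))%:R * zprod Ys ys).
    rewrite mulr_wsuml; apply: eq_wsum => vs svs.
    by rewrite dsE evenly_interleave//; ring.
  rewrite normrM; apply: ler_pM => //.
    have okds : All (@weight_ok C V) ds.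
      rewrite /ds -map_comp; apply: All_map; apply: All_mask.
      apply: All_impl okX => X [X1 X0 _]; split=> //= x; exact: X1.
    have inv : stab_inv (flat ys) (fun vs => c (interleave b vs ys)).
      by move=> t tr vs; rewrite interleave_map.
    have := @diag_bound C V q%:C _ _ lb (flat ys) 1 _ ds sds ler01 okds inv (fun s => c1 _).
    rewrite mul1r size_flat sys big_map => /(_ _ _)/le_trans; apply.
    - by rewrite lecR.
    - by rewrite -rmorphXn/= qV rmorph_nat.
    rewrite /weight_size big_const_seq count_predT iter_mulr_1.
    by rewrite size_map size_mask// -rmorphXn -(rmorph_nat (real_complex R)) -rmorphM.
  rewrite normrM normr_nat rmorphM rmorph_nat ler_wpM2l//.
  rewrite ler_norm_zprod le_eqVlt; apply/orP; left; apply/eqP.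
  rewrite /Ys'; elim: (Ys) (ys) => [|Y Ys1 IH] [|y ys1] //=.
  by rewrite rmorphM IH.
rewrite -mulr_wsumr -raddf_wsum -rmorphM lecR.
have -> : (diag_cst lb (2 * ln))%:R * off_cst R ln * (q ^+ lb * q ^+ ln) =
  (diag_cst lb (2 * ln))%:R * q ^+ lb * (off_cst R ln * q ^+ ln) by ring.
rewrite ler_wpM2l ?mulr_ge0 ?exprn_ge0 ?(ltW q0)//.
rewrite -sYs; apply: offdiag_bound => //.
rewrite /Ys' /Ys -map_comp; apply: All_map; apply: All_mask.
apply: All_impl okX => X [X1 _ X2]; split.
- by move=> p; rewrite -lecR; have := normr_ge0 (off_part X p); rewrite normc_RealE.
- move=> v; have off0 : off_part X (v, v) = 0 by rewrite /off_part eqxx.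
  by rewrite -[RHS](congr1 (@complex.Re R) (normr0 C)) -off0.
- rewrite -lecR; apply: le_trans X2; rewrite rmorph_sum; apply: ler_sum => p _.
  have : `|off_part X p| ^+ 2 <= `|X p| ^+ 2.
    by rewrite /off_part; case: eqP => // _; rewrite normr0 expr0n exprn_ge0.
  by rewrite (normc_RealE (off_part X p)) -rmorphXn.
Qed.
End EvenSums.

(** * Averages over signed permutations *)
Section PathSums.
Variables (C : comPzRingType) (N : nat).
Local Notation V := 'I_N.

Fixpoint prod_pairs (Ys Ms : seq 'M[C]_N) : 'M[C]_N :=
  match Ys, Ms with
  | Y :: Ys', M :: Ms' => Y *m M *m prod_pairs Ys' Ms'
  | _, _ => 1%:M
  end.

(** A letter is the pair of its row and its column; each [M] joins the column of one letter to the
    row of the next, and the last one leads to [b]. *)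
Fixpoint path_weight (Ms : seq 'M[C]_N) (s : seq (V * V)) (b : V) : C :=
  match Ms, s with
  | M :: Ms', p :: s' => M p.2 (head (b, b) s').1 * path_weight Ms' s' b
  | _, _ => 1
  end.

Definition entry_fun (Y : 'M[C]_N) (p : V * V) : C := Y p.1 p.2.

Lemma prod_pairsE Ys Ms a b : size Ms = size Ys ->
  prod_pairs Ys Ms a b = wsum (size Ys) (fun s =>
    (a == (head (b, b) s).1)%:R * (zprod (map entry_fun Ys) s * path_weight Ms s b)).
Proof.
elim: Ys Ms a => [|Y Ys IH] [|M Ms] a //=; first by rewrite !mulr1 mxE.
move=> [sM]; rewrite mxE.
transitivity (\sum_x (\sum_y Y a y * M y x) * prod_pairs Ys Ms x b).
  by apply: eq_bigr => x _; rewrite mxE.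
have -> : \sum_x (\sum_y Y a y * M y x) * prod_pairs Ys Ms x b =
    \sum_y Y a y * \sum_x M y x * prod_pairs Ys Ms x b.
  under eq_bigr do rewrite mulr_suml.
  rewrite exchange_big; apply: eq_bigr => y _.
  by rewrite mulr_sumr; apply: eq_bigr => x _; rewrite mulrA.
rewrite -(pair_big xpredT xpredT (fun x y => wsum (size Ys) (fun s =>
   (a == x)%:R * (entry_fun Y (x, y) * zprod (map entry_fun Ys) s *
      (M y (head (b, b) s).1 * path_weight Ms s b))))) /=.
rewrite [RHS](bigD1 a)//= [X in _ = _ + X]big1 ?addr0; last first.
  move=> x /negbTE xa; rewrite big1// => y _.
  rewrite -[RHS](wsum0 ('I_N * 'I_N)%type C (size Ys)); apply: eq_wsum => s _.
  by rewrite [a == x]eq_sym xa mul0r.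
apply: eq_bigr => y _.
have -> : \sum_x M y x * prod_pairs Ys Ms x b = wsum (size Ys) (fun s =>
    M y (head (b, b) s).1 * (zprod (map entry_fun Ys) s * path_weight Ms s b)).
  transitivity (\sum_x wsum (size Ys) (fun s => M y x *
    ((x == (head (b, b) s).1)%:R * (zprod (map entry_fun Ys) s * path_weight Ms s b)))).
    by apply: eq_bigr => x _; rewrite IH// mulr_wsumr.
  rewrite -wsum_sum; apply: eq_wsum => s _.
  rewrite (bigD1 (head (b, b) s).1)//= eqxx mul1r big1 ?addr0// => x /negbTE ->.
  by rewrite mul0r mulr0.
rewrite mulr_wsumr; apply: eq_wsum => s _; rewrite eqxx mul1r /entry_fun /=; ring.
Qed.

Definition cycle_weight (Ms : seq 'M[C]_N) (s : seq (V * V)) : C :=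
  if s is p :: _ then path_weight Ms s p.1 else 0.

Lemma tr_prod_pairs Ys Ms : size Ms = size Ys -> (0 < size Ys)%N ->
  \tr (prod_pairs Ys Ms) =
  wsum (size Ys) (fun s => zprod (map entry_fun Ys) s * cycle_weight Ms s).
Proof.
move=> sM Y0; rewrite /mxtrace.
under eq_bigr do rewrite prod_pairsE//.
rewrite -wsum_sum; apply: eq_wsum => -[|p s]; first by move=> s0; rewrite -s0 in Y0.
move=> _; rewrite (bigD1 p.1)//= eqxx mul1r big1 ?addr0// => x /negbTE ->.
by rewrite mul0r.
Qed.
End PathSums.

Section SignedPermutations.
Variables (C : comPzRingType) (N : nat).

Definition spm (e : {ffun 'I_N -> bool}) (t : 'S_N) : 'M[C]_N :=
  \matrix_(i, j) ((-1) ^+ e i * (i == t j)%:R).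

Lemma spm_row (e : {ffun 'I_N -> bool}) (t : 'S_N) i (F : 'I_N -> C) :
  \sum_j spm e t i j * F j = (-1) ^+ e i * F ((t^-1)%g i).
Proof.
rewrite (bigD1 (t^-1 i)%g)//= big1 ?addr0 => [|j ji]; rewrite mxE.
  by rewrite permKV eqxx mulr1.
rewrite (_ : (i == t j) = false) ?mulr0 ?mul0r//.
by apply: contraNF ji => /eqP ->; rewrite permK.
Qed.

Lemma spm_conj e t (X : 'M[C]_N) i j : (spm e t *m X *m (spm e t)^T) i j =
  (-1) ^+ e i * (-1) ^+ e j * X ((t^-1)%g i) ((t^-1)%g j).
Proof.
rewrite mxE (eq_bigr (fun k => spm e t j k * ((-1) ^+ e i * X ((t^-1)%g i) k))).
  by rewrite spm_row mulrCA mulrA.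
by move=> k _; rewrite [in LHS]mxE spm_row [in LHS]mxE mulrC.
Qed.

Lemma spm_unitary e t : spm e t *m (spm e t)^T = 1%:M.
Proof.
rewrite -[X in X *m _]mulmx1; apply/matrixP => i j; rewrite spm_conj !mxE.
rewrite (inj_eq (@perm_inj _ _)); case: eqP => [->|_]; last by rewrite mulr0.
by rewrite -expr2 sqrr_sign mulr1.
Qed.
End SignedPermutations.

Section AverageTrace.
Variables (R : rcfType) (n : nat).
Local Notation C := R[i].
Local Notation N := n.+1.
Local Notation q := (Num.sqrt N%:R : R).

Definition perm_pairs (t : 'S_N) (s : seq ('I_N * 'I_N)) := map (fun p => (t p.1, t p.2)) s.

Lemma evenly_map (t : 'S_N) zs : evenly (map t zs) = evenly zs.
Proof.
have cnt v : count_mem v (map t zs) = count_mem (t^-1 v)%g zs.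
  rewrite count_map; apply: eq_count => z /=.
  by apply/eqP/eqP => [<-|->]; rewrite ?permK ?permKV.
apply/forallP/forallP => h v; last by rewrite cnt.
by have := h (t v); rewrite cnt permK.
Qed.

(** Relabelling the path by [t] undoes the permutation inside the conjugated letters, so that [t] is
    left only in the signs and in the weights between the letters. *)
Lemma zprod_spm_conj (Xs : seq 'M[C]_N) e t s : size s = size Xs ->
  zprod (map (@entry_fun C N) (map (fun X => spm C e t *m X *m (spm C e t)^T) Xs))
    (perm_pairs t s) =
  \prod_(z <- map t (flat s)) (-1) ^+ e z * zprod (map (@entry_fun C N) Xs) s.
Proof.
elim: Xs s => [|X Xs IH] [|p s] //=; first by rewrite big_nil mulr1.
move=> [/IH ->]; rewrite /entry_fun spm_conj !permK -/(flat s) !big_cons; ring.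
Qed.

Definition avg_weight (Ms : seq 'M[C]_N) (s : seq ('I_N * 'I_N)) : C :=
  (N`!)%:R^-1 * \sum_(t : 'S_N) cycle_weight Ms (perm_pairs t s).

(** Translation in the symmetric group; a single [cycle_weight] has no such invariance in
    general. *)
Lemma avg_weight_perm Ms (t : 'S_N) s : avg_weight Ms (perm_pairs t s) = avg_weight Ms s.
Proof.
congr (_ * _); rewrite [RHS](reindex_inj (mulgI t)) /=.
apply: eq_bigr => u _; congr (cycle_weight _ _); rewrite /perm_pairs -map_comp.
by apply: eq_map => p /=; rewrite !permM.
Qed.

Lemma sum_tr_spm (Xs Ms : seq 'M[C]_N) : size Ms = size Xs -> (0 < size Xs)%N ->
  \sum_(t : 'S_N) \sum_(e : {ffun 'I_N -> bool})
     \tr (prod_pairs (map (fun X => spm C e t *m X *m (spm C e t)^T) Xs) Ms) =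
  (2 ^ N * N`!)%N%:R * wsum (size Xs) (fun s =>
    avg_weight Ms s * (evenly (flat s))%:R * zprod (map (@entry_fun C N) Xs) s).
Proof.
move=> sM X0.
transitivity (\sum_(t : 'S_N) \sum_(e : {ffun 'I_N -> bool}) wsum (size Xs) (fun s =>
    \prod_(z <- map t (flat s)) (-1) ^+ e z *
    (zprod (map (@entry_fun C N) Xs) s * cycle_weight Ms (perm_pairs t s)))).
  apply: eq_bigr => t _; apply: eq_bigr => e _.
  rewrite tr_prod_pairs ?size_map// -[LHS](wsum_map (f := fun p => (t p.1, t p.2))).
    by apply: eq_wsum => s ss; rewrite -/(perm_pairs t s) zprod_spm_conj// mulrA.
  by exists (fun p => ((t^-1)%g p.1, (t^-1)%g p.2)) => -[x y]; rewrite /= ?permK ?permKV.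
transitivity (\sum_(t : 'S_N) wsum (size Xs) (fun s => (2 ^ N)%:R * (evenly (flat s))%:R *
    (zprod (map (@entry_fun C N) Xs) s * cycle_weight Ms (perm_pairs t s)))).
  apply: eq_bigr => t _; rewrite -wsum_sum; apply: eq_wsum => s _.
  by rewrite -mulr_suml sum_sign_prod evenly_map card_ord natrM.
rewrite -wsum_sum mulr_wsumr; apply: eq_wsum => s _.
rewrite -mulr_sumr -mulr_sumr /avg_weight natrM.
have N0 : (N`!)%:R != 0 :> C by rewrite pnatr_eq0 -lt0n fact_gt0.
by field.
Qed.

Lemma q_gt0 : 0 < q. Proof. by rewrite sqrtr_gt0 ltr0n. Qed.
Lemma q_ge1 : 1 <= q. Proof. by rewrite -[leLHS]sqrtr1 ler_wsqrtr// ler1n. Qed.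
Lemma sqr_q : q ^+ 2 = N%:R. Proof. by rewrite sqr_sqrtr. Qed.

Lemma path_weight_bound (Ms : seq 'M[C]_N) (M0 : 'M[C]_N) s b :
  All (fun M : 'M[C]_N => forall i j, `|M i j| <= (q^-1)%:C) Ms ->
  (forall i j, `|M0 i j| <= 1) -> size s = (size Ms).+1 ->
  `|path_weight (rcons Ms M0) s b| <= (q ^- size Ms)%:C.
Proof.
move=> Mq M01; elim: Ms s Mq => [|M Ms IH] [|p s] //=.
  by move=> _ [/size0nil ->] /=; rewrite mulr1 expr0 invr1.
move=> [Mq MMs] [ss]; rewrite normrM exprS invfM rmorphM ler_pM// IH//.
Qed.

Lemma norm_perm_sum (F : 'S_N -> C) (B : C) : (forall t, `|F t| <= B) ->
  `|(N`!)%:R^-1 * \sum_(t : 'S_N) F t| <= B.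
Proof.
move=> FB; rewrite normrM normfV normr_nat mulrC.
have N0 : 0 < (N`!)%:R :> C by rewrite ltr0n fact_gt0.
rewrite ler_pdivrMr//; apply: le_trans (ler_norm_sum _ _ _) _.
apply: le_trans (ler_sum _ (fun t _ => FB t)) _.
by rewrite sumr_const mulr_natr -card_Sn.
Qed.

Lemma avg_trace_bound (Xs Ms : seq 'M[C]_N) (M0 : 'M[C]_N) :
  size Xs = (size Ms).+1 ->
  All (fun X : 'M[C]_N => [/\ forall i j, `|X i j| <= 1, \tr X = 0
     & \sum_i \sum_j `|X i j| ^+ 2 <= N%:R]) Xs ->
  All (fun M : 'M[C]_N => forall i j, `|M i j| <= (q^-1)%:C) Ms ->
  (forall i j, `|M0 i j| <= 1) ->
  `|\sum_(t : 'S_N) \sum_(e : {ffun 'I_N -> bool})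
     \tr (prod_pairs (map (fun X => spm C e t *m X *m (spm C e t)^T) Xs) (rcons Ms M0))|
  <= (2 ^ N * N`!)%N%:R * (word_cst R (size Xs) * q)%:C.
Proof.
move=> sX okX okM okM0; rewrite sum_tr_spm ?size_rcons ?sX//.
rewrite normrM normr_nat ler_wpM2l ?ler0n//.
set l := size Ms.
(* Rescaled by the [l] inner gaps to have modulus at most 1; set to 0 at other lengths, where the
   weight need not be that small although [even_sum_bound] wants a bound everywhere. *)
pose c s := if size s == l.+1 then (q ^+ l)%:C * avg_weight (rcons Ms M0) s else 0.
have ql0 : 0 < q ^+ l by rewrite exprn_gt0// q_gt0.
have -> : wsum l.+1 (fun s => avg_weight (rcons Ms M0) s * (evenly (flat s))%:R *
      zprod (map (@entry_fun C N) Xs) s) =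
    (q ^- l)%:C * wsum l.+1 (fun s => c s * (evenly (flat s))%:R *
      zprod (map (@entry_fun C N) Xs) s).
  rewrite mulr_wsumr; apply: eq_wsum => s sl; rewrite /c sl eqxx.
  rewrite !mulrA -rmorphM mulVf ?gt_eqF// mul1r//.
have hql : 0 <= (q ^- l)%:C :> C by rewrite ler0c invr_ge0 ltW.
rewrite normrM (ger0_norm hql).
apply: (@le_trans _ _ ((q ^- l)%:C * (word_cst R l.+1 * q ^+ l.+1)%:C)).
  rewrite ler_wpM2l//.
  have := @even_sum_bound R 'I_N q (map (@entry_fun C N) Xs) c.
  rewrite size_map sX; apply.
  - exact: q_ge1.
  - by rewrite sqr_q card_ord.
  - apply: All_map; apply: All_impl okX => X [X1 X0 X2]; split=> //.
      by move=> p; exact: X1.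
    by rewrite sqr_q rmorph_nat; apply: le_trans X2; rewrite pair_big.
  - by move=> t s; rewrite /c size_map -/(perm_pairs t s) avg_weight_perm.
  - move=> s; rewrite /c; case: eqP => [sl|_]; last by rewrite normr0.
    have qlC : 0 < (q ^+ l)%:C :> C by rewrite -[0]/(0%:C) ltcR.
    rewrite normrM (ger0_norm (ltW qlC)) mulrC -(ler_pdivlMr _ _ qlC) mul1r -fmorphV.
    apply: norm_perm_sum => t; rewrite /cycle_weight.
    case ps: (perm_pairs t s) => [|p s']; first by rewrite normr0.
    by rewrite -ps path_weight_bound// size_map.
rewrite -rmorphM lecR exprS le_eqVlt; apply/orP; left; apply/eqP.
by move: ql0; set x := q ^+ l => x0; field; rewrite gt_eqF.
Qed.
End AverageTrace.

(** * Noncommutative polynomials *)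
Section WordEvaluation.
Variables (R : realType) (I : choiceType) (A : algType R[i]) (a : I -> A).

Definition word_eval (m : monalg.fmonom I) : A := \prod_(i <- monalg.fmonom_val m) a i.

Lemma word_eval_mmorphism : monalg.mmorphism word_eval.
Proof.
split; last by rewrite /word_eval monalg.fm1 big_nil.
by move=> m1 m2; rewrite /word_eval monalg.fmM big_cat.
Qed.
Canonical word_eval_mm : monalg.MMorphism.type _ A :=
  monalg.MMorphism.Pack (monalg.MMorphism.Class
    (monalg.isMultiplicative.Axioms_ _ _ word_eval_mmorphism)).

Lemma ncevalE : nceval a = monalg.mmap (GRing.in_alg A) word_eval.
Proof. by []. Qed.

Lemma nceval_is_linear : linear (nceval a : ncpoly R I -> A).
Proof.
move=> c f g; rewrite ncevalE raddfD; congr (_ + _).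
by rewrite [LHS]monalg.mmapZ -scalerAl mul1r.
Qed.

Lemma ncevalM (f g : ncpoly R I) : nceval a (f * g) = nceval a f * nceval a g.
Proof.
rewrite ncevalE; apply: (monalg.commr_mmap_is_multiplicative _).1 => h m m'.
by rewrite /GRing.comm /= -scalerAl -scalerAr mul1r mulr1.
Qed.

Lemma nceval1 : nceval a (1 : ncpoly R I) = 1.
Proof. by rewrite ncevalE [LHS](monalg.mmap1 (f := GRing.in_alg A) (h := word_eval_mm)). Qed.

Lemma ncevalX i : nceval a (ncX R i) = a i.
Proof.
rewrite ncevalE [LHS]monalg.mmapU /= scale1r mul1r /word_eval monalg.fmU.
by rewrite big_seq1.
Qed.

HB.instance Definition _ := GRing.isLinear.Build R[i] (ncpoly R I) A *:%R (nceval a)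
  nceval_is_linear.

Lemma nceval_horner (p : {poly R[i]}) i :
  nceval a (horner_alg (ncX R i) p) = horner_alg (a i) p.
Proof.
elim/poly_ind: p => [|p c IH]; first by rewrite !rmorph0 linear0.
rewrite !rmorphD !rmorphM /= !horner_algX !horner_algC linearD /= ncevalM IH ncevalX.
by rewrite linearZ /= nceval1.
Qed.

Lemma nceval_prod (J : Type) (r : seq J) (F : J -> ncpoly R I) :
  nceval a (\prod_(j <- r) F j) = \prod_(j <- r) nceval a (F j).
Proof.
by elim: r => [|j r IH]; rewrite ?big_nil ?nceval1// !big_cons ncevalM IH.
Qed.
End WordEvaluation.

(* Stated for an abstract algebra spanned by words: over the concrete type of
   noncommutative polynomials unification unfolds the finite-support encoding. *)
Section WordAlgebra.
Variables (R : realType) (I : choiceType) (A : algType R[i]) (w : seq I -> A) (st : A -> A).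
Hypothesis w_ind : forall P : A -> Prop, (forall c s, P (c *: w s)) ->
  (forall f g, P f -> P g -> P (f + g)) -> forall f, P f.
Hypothesis wM : forall s t, w s * w t = w (s ++ t).
Hypothesis stD : {morph st : f g / f + g}.
Hypothesis stW : forall c s, st (c *: w s) = c^* *: w (rev s).

Lemma word_starK : involutive st.
Proof.
elim/w_ind => [c s|f g IHf IHg]; last by rewrite !stD IHf IHg.
by rewrite !stW revK conjCK.
Qed.

Lemma word_star_semilinear (c : R[i]) (f g : A) :
  st (c *: f + g) = c^* *: st f + st g.
Proof.
rewrite stD; congr (_ + _); elim/w_ind: f => [e s|f1 f2 IH1 IH2].
  by rewrite scalerA !stW scalerA rmorphM.
by rewrite scalerDr !stD IH1 IH2 scalerDr.
Qed.

Lemma word_starM f g : st (f * g) = st g * st f.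
Proof.
elim/w_ind: f => [c s|f1 f2 IH1 IH2]; last by rewrite mulrDl !stD IH1 IH2 mulrDr.
elim/w_ind: g => [e t|g1 g2 IH1 IH2]; last by rewrite mulrDr !stD IH1 IH2 mulrDl.
rewrite -scalerAl -scalerAr scalerA wM !stW rev_cat -wM.
by rewrite -scalerAl -scalerAr scalerA rmorphM [_^* * _]mulrC.
Qed.

Lemma word_eval_morph (B D : algType R[i]) (h : B -> D) (ev : {linear A -> B})
    (ev' : {linear A -> D}) (a : I -> B) (a' : I -> D) f :
  (forall s, ev (w s) = \prod_(i <- s) a i) ->
  (forall s, ev' (w s) = \prod_(i <- s) a' i) ->
  (forall c x y, h (c *: x + y) = c *: h x + h y) -> {morph h : x y / x * y} ->
  h 1 = 1 -> (forall i, h (a i) = a' i) -> h (ev f) = ev' f.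
Proof.
move=> evw ev'w hL hM h1 ha.
have hD x y : h (x + y) = h x + h y by rewrite -[x]scale1r hL !scale1r.
have h0 : h 0 = 0 by apply: (addrI (h 0)); rewrite -hD !addr0.
elim/w_ind: f => [c s|f g IHf IHg]; last by rewrite !linearD hD IHf IHg.
rewrite !linearZ /= -[_ *: ev _]addr0 hL h0 addr0 evw ev'w; congr (_ *: _).
by elim: s => [|i s IH]; rewrite ?big_nil// !big_cons hM IH ha.
Qed.

Lemma word_eval_star (B : algType R[i]) (stB : B -> B) (ev : {linear A -> B}) (a : I -> B) f :
  (forall s, ev (w s) = \prod_(i <- s) a i) ->
  (forall (c : R[i]) x y, stB (c *: x + y) = c^* *: stB x + stB y) ->
  (forall x y, stB (x * y) = stB y * stB x) -> stB 1 = 1 ->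
  (forall i, stB (a i) = a i) -> ev (st f) = stB (ev f).
Proof.
move=> evw sL sM s1 sa.
have sD x y : stB (x + y) = stB x + stB y.
  by rewrite -[x]scale1r sL rmorph1 !scale1r.
have s0 : stB 0 = 0 by apply: (addrI (stB 0)); rewrite -sD !addr0.
elim/w_ind: f => [c s|f g IHf IHg]; last by rewrite stD !linearD sD IHf IHg.
rewrite stW !linearZ /= -[_ *: ev (w s)]addr0 sL s0 addr0 !evw; congr (_ *: _).
elim: s => [|i s IH]; first by rewrite big_nil s1.
by rewrite rev_cons -cats1 big_cat big_seq1 big_cons sM -IH sa.
Qed.
End WordAlgebra.

Definition ncword (R : realType) (I : choiceType) (s : seq I) : ncpoly R I :=
  \prod_(i <- s) ncX R i.

(** The adjoint for self-adjoint variables; evaluation at hermitian matrices carries it to the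
    matrix adjoint. *)
HB.lock Definition ncstar (R : realType) (I : choiceType) : ncpoly R I -> ncpoly R I :=
  monalg.mmap (fun c : R[i] => (c^* )%:A)
    (fun m => ncword R (rev (monalg.fmonom_val m))).

Section NCPolyInduction.
Variables (R : realType) (I : choiceType).
Local Notation ncword := (@ncword R I).
Local Notation ncstar := (@ncstar R I).

Lemma mkmalgU_ncword c m : monalg.mkmalgU m c = c *: ncword (monalg.fmonom_val m).
Proof.
have mulU k1 k2 : (monalg.mkmalgU (monalg.mmul k1 k2) 1 : ncpoly R I) =
    monalg.mkmalgU k1 1 * monalg.mkmalgU k2 1.
  by rewrite [RHS]monalg.malgM_def monalg.fgmulUU mulr1.
have -> : monalg.mkmalgU m c = c *: (monalg.mkmalgU m 1 : ncpoly R I).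
  apply/monalg.malgP => k; rewrite monalg.mcoeffZ !monalg.mcoeffU.
  by case: (m == k); rewrite ?mulr1n ?mulr1 ?mulr0n ?mulr0.
congr (_ *: _); rewrite /ncword; case: m => s /=; elim: s => [|i s IH].
  by rewrite big_nil -monalg.fmoneE.
rewrite big_cons -IH /ncX -mulU; congr (monalg.mkmalgU _ _).
by apply/eqP; rewrite monalg.fmP monalg.fmM monalg.fmU.
Qed.

Lemma ncpoly_ind (P : ncpoly R I -> Prop) :
  (forall c s, P (c *: ncword s)) -> (forall f g, P f -> P g -> P (f + g)) ->
  forall f, P f.
Proof.
move=> Pw PD f; rewrite [f]monalg.monalgE; elim/big_rec: _ => [|m g _ Pg].
  by rewrite -(scale0r (ncword [::])).
by apply: PD => //; rewrite mkmalgU_ncword.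
Qed.

Lemma nceval_ncword (A : algType R[i]) (a : I -> A) s :
  nceval a (ncword s) = \prod_(i <- s) a i.
Proof. by rewrite nceval_prod; apply: eq_bigr => i _; rewrite ncevalX. Qed.

Lemma ncstar_additive : {morph ncstar : f g / f + g}.
Proof.
have conjA : additive (fun c : R[i] => (c^* )%:A : ncpoly R I).
  by move=> c e; rewrite rmorphB scalerBl.
pose h : {additive R[i] -> ncpoly R I} := HB.pack (fun c : R[i] => (c^* )%:A : ncpoly R I)
  (GRing.isZmodMorphism.Build _ _ _ conjA).
by rewrite unlock => f g; exact: (raddfD (monalg.mmap h _)).
Qed.

Lemma ncstar_word c s : ncstar (c *: ncword s) = c^* *: ncword (rev s).
Proof.
have conjA : additive (fun c : R[i] => (c^* )%:A : ncpoly R I).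
  by move=> x e; rewrite rmorphB scalerBl.
pose h : {additive R[i] -> ncpoly R I} := HB.pack (fun c : R[i] => (c^* )%:A : ncpoly R I)
  (GRing.isZmodMorphism.Build _ _ _ conjA).
rewrite -(mkmalgU_ncword c (monalg.FMonom s)) unlock.
by rewrite (monalg.mmapU (f := h)) /= -scalerAl mul1r.
Qed.

Lemma ncwordM s t : ncword s * ncword t = ncword (s ++ t).
Proof. by rewrite /Defs.ncX -big_cat. Qed.

Lemma ncstarK : involutive ncstar.
Proof. exact: word_starK ncpoly_ind ncstar_additive ncstar_word. Qed.

Lemma ncstar_semilinear (c : R[i]) (f g : ncpoly R I) :
  ncstar (c *: f + g) = c^* *: ncstar f + ncstar g.
Proof. exact: word_star_semilinear ncpoly_ind ncstar_additive ncstar_word c f g. Qed.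

Lemma ncstarM f g : ncstar (f * g) = ncstar g * ncstar f.
Proof. exact: word_starM ncpoly_ind ncwordM ncstar_additive ncstar_word f g. Qed.

Lemma ncstarX i : ncstar (ncX R i) = ncX R i.
Proof.
have w1 : ncword [:: i] = ncX R i by exact: big_seq1.
rewrite -w1 -[X in ncstar X]scale1r; transitivity (1^* *: ncword (rev [:: i])).
  exact: ncstar_word.
by rewrite rmorph1 scale1r.
Qed.

Lemma nceval_morph (A B : algType R[i]) (h : A -> B) (a : I -> A) f :
  (forall c x y, h (c *: x + y) = c *: h x + h y) -> {morph h : x y / x * y} ->
  h 1 = 1 -> h (nceval a f) = nceval (h \o a) f.
Proof.
move=> hL hM h1.
apply: (word_eval_morph (a := a) (a' := h \o a) (h := h)
  (ev := nceval a : {linear _ -> _}) (ev' := nceval (h \o a) : {linear _ -> _})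
  ncpoly_ind) => // s; exact: nceval_ncword.
Qed.

Lemma nceval_ncstar (A : algType R[i]) (st : A -> A) (a : I -> A) f :
  (forall (c : R[i]) x y, st (c *: x + y) = c^* *: st x + st y) ->
  (forall x y, st (x * y) = st y * st x) -> st 1 = 1 -> (forall i, st (a i) = a i) ->
  nceval a (ncstar f) = st (nceval a f).
Proof.
move=> sL sM s1 sa.
apply: (word_eval_star (a := a) (ev := nceval a : {linear _ -> _}) ncpoly_ind
  ncstar_additive ncstar_word) => // s; exact: nceval_ncword.
Qed.
End NCPolyInduction.

(** * Asymptotic freeness from alternating words *)
Section ComplexLimits.
Variable R : realType.
Implicit Types (u v : nat -> R[i]) (k l : R[i]).

Lemma ccvgP u l : ccvg u l <->
  forall e : R, 0 < e -> exists N, forall n, (N <= n)%N -> `|u n - l| < e%:C.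
Proof.
split=> [ul e e0|ul].
  have e0' : 0 < e%:C :> R[i] by rewrite -[0]/(0%:C) ltcR.
  have /cvgrPdist_lt/(_ _ e0')[N _ NP] := ul.
  by exists N => n Nn; rewrite distrC; exact: NP.
apply/cvgrPdist_lt => e e0.
have [e1 e2] : complex.Im e = 0 /\ 0 < complex.Re e.
  by move: e0; rewrite ltcE /= => /andP[/eqP <-].
have -> : e = (complex.Re e)%:C by case: e e1 {e0 e2} => x y /= ->.
have [N NP] := ul _ e2; exists N => // n /= Nn.
by rewrite distrC; exact: NP.
Qed.

Lemma ccvg_cst k : ccvg (fun=> k) k.
Proof. exact: (@cvg_cst R[i]^o). Qed.

Lemma ccvgD u v k l : ccvg u k -> ccvg v l -> ccvg (fun n => u n + v n) (k + l).
Proof. exact: (@cvgD R[i] R[i]^o). Qed.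

Lemma ccvgZ c u l : ccvg u l -> ccvg (fun n => c * u n) (c * l).
Proof. by move=> ul; exact: (@cvgZr _ R[i]^o _ _ _ c _ _ ul). Qed.

Lemma ccvgB u v k l : ccvg u k -> ccvg v l -> ccvg (fun n => u n - v n) (k - l).
Proof. exact: (@cvgB R[i] R[i]^o). Qed.

Lemma ccvg_unique u k l : ccvg u k -> ccvg u l -> k = l.
Proof.
move=> uk ul; have [//|kl] := eqVneq k l.
have [e e0 ekl] : exists2 e : R, 0 < e & `|k - l| = e%:C + e%:C.
  exists (complex.Re `|k - l| / 2).
    rewrite divr_gt0// -ltcR RRe_real ?normr_real// normr_gt0 subr_eq0//.
  by rewrite -rmorphD -splitr; apply/esym/RRe_real; exact: normr_real.
have [N1 H1] := (ccvgP _ _).1 uk _ e0; have [N2 H2] := (ccvgP _ _).1 ul _ e0.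
have := ltrD (H1 _ (leq_maxl N1 N2)) (H2 _ (leq_maxr N1 N2)).
rewrite -ekl distrC => /(le_lt_trans (ler_normD _ _)).
by rewrite addrA subrK ltxx.
Qed.

Lemma eq_ccvg u v l : ccvg u l -> u =1 v -> ccvg v l.
Proof. by move=> ul /funext <-. Qed.

Lemma ccvg_norm0 u (v : nat -> R) : v @ \oo --> (0 : R) ->
  (forall n, `|u n| <= (v n)%:C) -> ccvg u 0.
Proof.
move=> v0 uv; apply/ccvgP => e e0.
have /cvgrPdist_lt/(_ _ e0)[N _ NP] := v0.
exists N => n Nn; rewrite subr0 (le_lt_trans (uv n))// ltcR.
have := NP n Nn; rewrite sub0r normrN; apply: le_lt_trans; exact: ler_norm.
Qed.

Lemma ccvgM0 u v K : ccvg u 0 -> (forall n, `|v n| <= K) -> ccvg (fun n => u n * v n) 0.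
Proof.
move=> u0 vK; apply/ccvgP => e e0.
have K0 : 0 <= K by apply: le_trans (vK 0%N).
have [k k0 Kk] : exists2 k : R, 0 < k & K <= k%:C.
  exists (complex.Re K + 1).
    by rewrite ltr_wpDl// -lecR RRe_real// ger0_real.
  by rewrite rmorphD /= RRe_real ?ger0_real// lerDl.
have ek : 0 < e / k by rewrite divr_gt0.
have [N NP] := (ccvgP _ _).1 u0 _ ek; exists N => n Nn.
rewrite subr0 normrM; have := NP n Nn; rewrite subr0 => un.
apply: (@le_lt_trans _ _ (`|u n| * k%:C)).
  by rewrite ler_wpM2l// (le_trans (vK n)).
have -> : e%:C = (e / k)%:C * k%:C :> R[i] by rewrite -rmorphM divfK ?gt_eqF.
by rewrite ltr_pM2r// -[0]/(0%:C) ltcR.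
Qed.

Lemma ccvg_real (x : nat -> R) (l : R) : ccvg (fun n => (x n)%:C) l%:C <->
  x @ \oo --> l.
Proof.
rewrite ccvgP; split=> [h|h e e0].
  apply/cvgrPdist_lt => e e0; have [N NP] := h e e0.
  exists N => // n /= Nn; have := NP n Nn.
  by rewrite -rmorphB /= normc_def /= expr0n addr0 sqrtr_sqr ltcR distrC.
have /cvgrPdist_lt/(_ _ e0)[N _ NP] := h; exists N => n Nn.
rewrite -rmorphB /= normc_def /= expr0n addr0 sqrtr_sqr ltcR distrC.
exact: NP.
Qed.
End ComplexLimits.
Arguments ccvg_cst {R} k _ _.
Arguments ccvgD {R u v k l} _ _ _ _.
Arguments ccvgZ {R} c {u l} _ _ _.
Arguments ccvgB {R u v k l} _ _ _ _.
Arguments eq_ccvg {R u v l} _ _ _ _.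
Arguments ccvg_unique {R u k l} _ _.

Section WordConvergence.
Variables (R : realType) (I : choiceType) (S : nat -> ncps R) (a : forall n, I -> S n).
Local Notation word := (seq (I * {poly R[i]})).

(** Letters are polynomials in one variable: these make up the subalgebra that the variable
    generates, hence the factors in the definition of freeness. *)
Definition word_state n (w : word) : R[i] :=
  nc_state (S n) (\prod_(p <- w) horner_alg (a n p.1) p.2).

Definition alternating (w : word) := sorted (fun p q => p.1 != q.1) w.

Definition centered (p : I * {poly R[i]}) :=
  ccvg (fun n => nc_state (S n) (horner_alg (a n p.1) p.2)) 0.

Hypothesis moments_cvg : forall i k, exists l, ccvg (fun n => nc_state (S n) (a n i ^+ k)) l.
Hypothesis alternating_cvg0 : forall w, w != [::] -> alternating w ->
  (forall p, p \in w -> centered p) -> ccvg (word_state^~ w) 0.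

Lemma horner_alg_sum (A : algType R[i]) (x : A) p :
  horner_alg x p = \sum_(k < size p) p`_k *: x ^+ k.
Proof.
rewrite -[in LHS](coefK p) poly_def linear_sum; apply: eq_bigr => k _.
by rewrite linearZ /= rmorphXn /= horner_algX -scalerAl mul1r.
Qed.

Lemma poly_cvg i p :
  exists l, ccvg (fun n => nc_state (S n) (horner_alg (a n i) p)) l.
Proof.
have h (r : seq 'I_(size p)) : exists l,
    ccvg (fun n => \sum_(k <- r) p`_k * nc_state (S n) (a n i ^+ k)) l.
  elim: r => [|k r [l IH]].
    by exists 0; apply: eq_ccvg (ccvg_cst _) _ => n; rewrite big_nil.
  have [m mP] := moments_cvg i k.
  exists (p`_k * m + l); apply: eq_ccvg (ccvgD (ccvgZ p`_k mP) IH) _ => n.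
  by rewrite big_cons.
have [l lP] := h (index_enum _); exists l; apply: eq_ccvg lP _ => n.
by rewrite horner_alg_sum linear_sum; apply: eq_bigr => k _; rewrite linearZ.
Qed.

Lemma alternatingPn (w : word) : ~~ alternating w ->
  exists u v i p q, w = u ++ (i, p) :: (i, q) :: v.
Proof.
elim: w => // -[i p] [|[j q] w] IH //=; rewrite negb_and negbK => /orP[/eqP ij|/IH].
  by exists [::], w, i, p, q; rewrite /= -ij in IH *.
by move=> [u [v [i' [p' [q' ->]]]]]; exists ((i, p) :: u), v, i', p', q'.
Qed.

Lemma alternating_upd u (i : I) (p q : {poly R[i]}) v :
  alternating (u ++ (i, p) :: v) -> alternating (u ++ (i, q) :: v).
Proof.
case: u => [|x u] /=; first by case: v.
by rewrite !cat_path /= => /andP[-> /=]; case: v.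
Qed.

(** Induction on the length. If a word does not alternate, two neighbours merge; otherwise each
    letter is centered at the price of a shorter word, until the hypothesis on centered words
    applies. *)
Lemma words_cvg w : exists l, ccvg (word_state^~ w) l.
Proof.
have [l] := ubnP (size w); elim: l w => // l IHl w.
rewrite ltnS leq_eqVlt => /orP[/eqP wl|]; last exact: IHl.
have [walt|] := boolP (alternating w); last first.
  move=> /alternatingPn[u [v [i [p [q wE]]]]].
  have [|m mP] := IHl (u ++ (i, p * q) :: v).
    by rewrite -wl wE !size_cat /= ltn_add2l.
  exists m; apply: eq_ccvg mP _ => n; rewrite wE /word_state !big_cat !big_cons /=.
  by rewrite rmorphM /= -mulrA.
(* [u] collects the letters already centered, [v] those still to be treated. *)
suff : forall v u, size (u ++ v) = l -> alternating (u ++ v) ->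
    (forall p, p \in u -> centered p) -> exists m, ccvg (word_state^~ (u ++ v)) m.
  by move=> /(_ w [::]); apply.
elim=> [|[i p] v IHv] u.
  rewrite cats0; case: u => [_ _ _|x u _ ualt uc].
    exists 1; apply: eq_ccvg (ccvg_cst _) _ => n.
    by rewrite /word_state big_nil nc_state1.
  by exists 0; exact: alternating_cvg0.
move=> uvl uvalt uc; have [c cP] := poly_cvg i p.
have [|||m1 m1P] := IHv (rcons u (i, p - c%:P)).
- by rewrite cat_rcons -uvl !size_cat.
- by rewrite cat_rcons; exact: alternating_upd uvalt.
- move=> x; rewrite mem_rcons inE => /orP[/eqP ->|]; last exact: uc.
  rewrite /centered /= -(subrr c); apply: eq_ccvg (ccvgB cP (ccvg_cst c)) _ => n.
  by rewrite rmorphB /= horner_algC linearB /= linearZ /= nc_state1 mulr1.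
have [|m2 m2P] := IHl (u ++ v).
  by rewrite -uvl !size_cat /= ltn_add2l.
exists (m1 + c * m2); apply: eq_ccvg (ccvgD m1P (ccvgZ c m2P)) _ => n.
rewrite cat_rcons /word_state !big_cat !big_cons /= rmorphB /= horner_algC.
rewrite -linearZ -linearD /=; congr (nc_state _ _).
by rewrite mulrBl mulrBr -scalerAl mul1r -scalerAr subrK.
Qed.

Lemma joint_law_cvg f : exists l, ccvg (fun n => joint_law (a n) f) l.
Proof.
elim/ncpoly_ind: f => [c s|f g [k kP] [l lP]].
  have [m mP] := words_cvg [seq (i, 'X) | i <- s].
  exists (c * m); apply: eq_ccvg (ccvgZ c mP) _ => n.
  rewrite /joint_law linearZ /= nceval_ncword linearZ /=; congr (_ * nc_state _ _).
  by rewrite big_map; apply: eq_bigr => i _; rewrite horner_algX.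
exists (k + l); apply: eq_ccvg (ccvgD kP lP) _ => n.
by rewrite /joint_law !linearD.
Qed.

Lemma generated_subalg_horner i x : generated_subalg [set ncX R i] x ->
  exists p, x = horner_alg (ncX R i : ncpoly R I) p.
Proof.
pose B : set (ncpoly R I) := [set x | exists p, x = horner_alg (ncX R i : ncpoly R I) p].
move=> /(_ B); apply; split; last first.
  by move=> _ /= ->; exists 'X; rewrite horner_algX.
split.
- by rewrite inE; exists 1; rewrite rmorph1.
- move=> c y z; rewrite !inE => -[p ->] [q ->]; exists (c *: p + q).
  by rewrite linearD linearZ /= -[in RHS]scalerAl mul1r.
- by move=> y z; rewrite !inE => -[p ->] [q ->]; exists (p * q); rewrite rmorphM.
Qed.

(** Limits of joint laws are chosen polynomial by polynomial and are linear by uniqueness. An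
    element with zero limit state is a centered letter, so freeness of the limit is the hypothesis
    on alternating words once more. *)
Lemma asymptotically_free_of_alternating : asymptotically_free a.
Proof.
have lims f : {l | ccvg (fun n => joint_law (a n) f) l} by apply/cid/joint_law_cvg.
pose tau0 f := sval (lims f).
have tau0P f : ccvg (fun n => joint_law (a n) f) (tau0 f) := svalP (lims f).
have tau0_lin : linear_for *%R tau0.
  move=> c f g; apply: (ccvg_unique (tau0P _)).
  apply: eq_ccvg (ccvgD (ccvgZ c (tau0P f)) (tau0P g)) _ => n.
  by rewrite /joint_law !linearP.
pose tau : {scalar ncpoly R I} := HB.pack tau0 (GRing.isLinear.Build _ _ _ _ _ tau0_lin).
have tau1 : tau 1 = 1.
  apply: (ccvg_unique (tau0P 1)); apply: eq_ccvg (ccvg_cst 1) _ => n.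
  by rewrite /joint_law nceval1 nc_state1.
exists tau, tau1; split=> //.
move=> l i x l2 ialt xB.
have [p pE] : {p : nat -> {poly R[i]} |
    forall j, (j < l)%N -> x j = horner_alg (ncX R (i j) : ncpoly R I) (p j)}.
  have /choice[p pP] : forall j, exists p, (j < l)%N ->
      x j = horner_alg (ncX R (i j) : ncpoly R I) p.
    move=> j; case: (ltnP j l) => [jl|_]; last by exists 0.
    have [/generated_subalg_horner[p ->] _] := xB j jl; by exists p.
  by exists p.
apply: (ccvg_unique (tau0P _)).
pose w := [seq (i j, p j) | j <- iota 0 l].
have -> : \prod_(0 <= j < l) x j =
    \prod_(j <- w) horner_alg (ncX R j.1 : ncpoly R I) j.2.
  rewrite /w big_map /index_iota subn0 big_seq [RHS]big_seq.
  by apply: eq_bigr => j; rewrite mem_iota => /andP[_ jl]; rewrite /= -pE.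
apply: eq_ccvg (alternating_cvg0 (w := w) _ _ _) _; last 1 first.
- move=> n; rewrite /word_state /joint_law nceval_prod; congr (nc_state _ _).
  by apply: eq_bigr => j _; rewrite nceval_horner.
- by rewrite /w; case: (l) l2.
- apply/(sortedP (i 0%N, 0)) => j; rewrite size_map size_iota => jl.
  have jl' := ltnW jl.
  rewrite !(nth_map 0%N) ?size_iota//= !nth_iota// !add0n.
  by apply/eqP; exact: ialt.
- move=> y /mapP[j]; rewrite mem_iota add0n => /andP[_ jl] ->.
  rewrite /centered /=; have [_ /= xj0] := xB j jl.
  have := tau0P (x j); rewrite xj0; move=> /eq_ccvg; apply => n.
  by rewrite /joint_law pE// nceval_horner.
Qed.
End WordConvergence.

(** * Limit laws of samples *)
Section CellIntegration.
Variables (d : measure_display) (T : measurableType d) (R : realType).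
Variables (P : probability T R) (m : nat) (A : nat -> set T).
Hypothesis mA : forall k, measurable (A k).
Hypothesis A0 : A 0%N = set0.
Hypothesis AS : forall k, A k `<=` A k.+1.
Hypothesis PA : forall k, (k <= m)%N -> P (A k) = (k%:R / m%:R)%:E.
Hypothesis Am : A m = setT.

Variables (g : T -> R) (B : R) (c delta : nat -> R).
Hypothesis mg : measurable_fun setT g.
Hypothesis gB : forall t, `|g t| <= B.
Hypothesis gc : forall j t, (j < m)%N -> A j.+1 t -> ~ A j t -> `|g t - c j| <= delta j.

Let integrable_bounded (h : T -> R) (K : R) D : measurable D -> measurable_fun setT h ->
  (forall t, `|h t| <= K) -> P.-integrable D (EFin \o h).
Proof.
move=> mD mh hK; apply: (@integrableS _ _ _ _ setT) => //.
apply: integrable_part => //; exists K; exact: aeW.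
Qed.

(** The increments of the chain [A] all have mass [1 / m]. Used with a genuine error for Riemann
    sums of monotone functions, and with [delta = 0] for step functions. *)
Lemma cell_integral :
  `|\int[P]_t g t - (\sum_(j < m) c j) / m%:R| <= (\sum_(j < m) delta j) / m%:R.
Proof.
suff step k : (k <= m)%N ->
    `|\int[P]_(t in A k) g t - (\sum_(j < k) c j) / m%:R| <= (\sum_(j < k) delta j) / m%:R.
  by have := step m (leqnn m); rewrite Am.
elim: k => [_|k IH km].
  by rewrite A0 Rintegral_set0 !big_ord0 !mul0r subr0 normr0.
have mD : measurable (A k.+1 `\` A k) by exact: measurableD.
have AE : A k.+1 = A k `|` (A k.+1 `\` A k).
  by rewrite setUDr setDv setD0 setUC; apply/esym/setUidPl/AS.
have PD : P (A k.+1 `\` A k) = (m%:R^-1)%:E.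
  have -> : P (A k.+1 `\` A k) = (P (A k.+1) - P (A k))%E.
    rewrite measureD//; last by rewrite (le_lt_trans (probability_le1 _ _)) ?ltry.
    by congr (_ - P _)%E; apply: setIidr; exact: AS.
  rewrite !PA//; last exact: ltnW.
  by rewrite -EFinB -mulrBl -natrB// subSnn mul1r.
rewrite AE Rintegral_setU//; last 2 first.
- by rewrite -AE; exact: (integrable_bounded (K := B)).
- by apply/disj_set2P; rewrite setDE setICA setICr setI0.
rewrite !big_ord_recr /= !mulrDl opprD addrACA.
apply: le_trans (ler_normD _ _) _; apply: lerD; first exact: IH (ltnW km).
have cst (r : R) : \int[P]_(t in A k.+1 `\` A k) r = r / m%:R.
  by rewrite Rintegral_cst//; congr (_ * _); exact: (congr1 fine PD).
have icst (r : R) D : measurable D -> P.-integrable D (EFin \o (fun=> r)).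
  by move=> ?; apply: (integrable_bounded (K := `|r|)).
have ig D : measurable D -> P.-integrable D (EFin \o g).
  by move=> ?; apply: (integrable_bounded (K := B)).
rewrite -!cst -RintegralB//; [|exact: ig|exact: icst].
have iB : P.-integrable (A k.+1 `\` A k) (EFin \o (fun t => g t - c k)).
  apply: (integrable_bounded (K := B + `|c k|)) => //; first exact: measurable_funB.
  by move=> t; rewrite (le_trans (ler_normB _ _))// lerD2r.
apply: le_trans (le_normr_Rintegral _ _) _ => //.
have mgc : measurable_fun setT (fun t => g t - c k) by exact: measurable_funB.
have gcB t : `|g t - c k| <= B + `|c k| by rewrite (le_trans (ler_normB _ _))// lerD2r.
apply: le_Rintegral => //; last by move=> t [At nAt]; exact: gc.
- apply: (integrable_bounded (K := B + `|c k|)) => //; last by move=> t; rewrite normr_id.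
  exact: measurableT_comp.
- exact: icst.
Qed.
End CellIntegration.

Section UniformCells.
Variable R : realType.
Local Notation U := (uniform_prob (@ltr01 R)).

(** The events [t < k / m], the last one enlarged to the whole line and the first one emptied: the
    integrands live on [R] although the uniform law sits on [[0, 1]]. *)
Definition ucell (m k : nat) : set R :=
  if k == 0%N then set0 else if (m <= k)%N then setT else [set` `]-oo, (k%:R / m%:R)[].

Lemma measurable_ucell m k : measurable (ucell m k).
Proof. by rewrite /ucell; case: eqP => // _; case: ifP. Qed.

Lemma ucellS m k : ucell m k `<=` ucell m k.+1.
Proof.
rewrite /ucell /=; case: eqP => [_|_]; first exact: sub0set.
case: (leqP m k) => [mk|km].
  by rewrite (leq_trans mk).
case: ifP => // _ t /=; rewrite !in_itv /= => /lt_le_trans; apply.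
by rewrite ler_pM2r ?ler_nat// invr_gt0 ltr0n (leq_ltn_trans _ km).
Qed.

Lemma uniform_ucell m k : (0 < m)%N -> (k <= m)%N -> U (ucell m k) = (k%:R / m%:R)%:E.
Proof.
move=> m0 km; rewrite /ucell; case: eqP => [->|/eqP k0]; first by rewrite mul0r measure0.
case: ifP => [mk|].
  have -> : k = m by apply/eqP; rewrite eqn_leq km.
  by rewrite divff ?pnatr_eq0 -?lt0n// probability_setT.
move=> /negbT; rewrite -ltnNge => {}km.
set x := _ / _; have x0 : 0 < x by rewrite divr_gt0 ?ltr0n// lt0n.
have x1 : x <= 1 by rewrite ler_pdivrMr ?ltr0n// mul1r ler_nat ltnW.
rewrite /uniform_prob integral_uniform_pdf.
have -> : [set` `]-oo, x[] `&` [set` `[0, 1]] = [set` `[0, x[] :> set R.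
  apply/seteqP; split=> t /=; rewrite !in_itv /=.
    by move=> [-> /andP[->]].
  by move=> /andP[-> tx]; rewrite tx (ltW (lt_le_trans tx x1)).
rewrite (eq_integral (fun=> 1%:E)); last first.
  move=> t; rewrite inE /= in_itv /= /uniform_pdf => /andP[-> tx].
  by rewrite (ltW (lt_le_trans tx x1)) subr0 invr1.
rewrite integral_cst//= lebesgue_measure_itv /= lte_fin x0.
by rewrite mul1e oppr0 adde0.
Qed.

Lemma expr_lipschitz (B x y : R) k : 1 <= B -> `|x| <= B -> `|y| <= B ->
  `|x ^+ k - y ^+ k| <= k%:R * B ^+ k * `|x - y|.
Proof.
move=> B1 xB yB; elim: k => [|k IH]; first by rewrite !expr0 subrr normr0 !mul0r.
have -> : x ^+ k.+1 - y ^+ k.+1 = x * (x ^+ k - y ^+ k) + (x - y) * y ^+ k.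
  by rewrite !exprS; ring.
apply: le_trans (ler_normD _ _) _; rewrite !normrM.
apply: (@le_trans _ _ (B * (k%:R * B ^+ k * `|x - y|) + `|x - y| * B ^+ k.+1)).
  apply: lerD; first by rewrite ler_pM.
  rewrite ler_wpM2l// normrX; apply: (@le_trans _ _ (B ^+ k)).
    by rewrite lerXn2r ?nnegrE// (le_trans ler01).
  by rewrite exprS ler_peMl// exprn_ge0// (le_trans ler01).
by rewrite exprS -natr1 le_eqVlt; apply/orP; left; apply/eqP; ring.
Qed.

(** The leftmost cell is unbounded below, so the lower bound [lo] stands in for the value at its
    left end. *)
Definition riemann_node (q : R -> R) (lo : R) (m j : nat) : R :=
  if j == 0%N then lo else q (j%:R / m%:R).

(** On each cell [q] varies by at most its increment, and the increments telescope to [hi - lo]. The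
    bound depends on [q] only through its range, so it passes to limits along an ultrafilter, where
    dominated convergence fails in general. *)
Lemma monotone_riemann_sum (q : R -> R) (lo hi B : R) (m k : nat) : (0 < m)%N ->
  nondecreasing_fun q -> (forall t, lo <= q t <= hi) -> 1 <= B -> `|lo| <= B -> `|hi| <= B ->
  `|\int[U]_t (q t ^+ k) - (\sum_(j < m) riemann_node q lo m j ^+ k) / m%:R|
    <= k%:R * B ^+ k * (hi - lo) / m%:R.
Proof.
move=> m0 qnd qlh B1 loB hiB; pose lvl := riemann_node q lo m; rewrite -/lvl.
pose lv j := if (m <= j)%N then hi else lvl j.
have bnd x : lo <= x <= hi -> `|x| <= B.
  move: loB hiB; rewrite !ler_norml => /andP[l1 _] /andP[_ h2] /andP[xl xh].
  by rewrite (le_trans l1 xl) (le_trans xh h2).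
have lohi : lo <= hi by have /andP[/le_trans] := qlh 0; apply.
have lvb j : lo <= lv j <= hi.
  rewrite /lv /lvl /riemann_node; case: ifP; rewrite ?lohi ?lexx//.
  by case: eqP => //; rewrite lohi lexx.
have mq : measurable_fun setT q by exact: nondecreasing_measurable.
have C0 : 0 <= k%:R * B ^+ k by rewrite mulr_ge0// exprn_ge0// (le_trans ler01).
have := @cell_integral _ _ R U m (ucell m) (measurable_ucell m) (erefl _) (@ucellS m)
  (fun j jm => uniform_ucell m0 jm) _ (fun t => q t ^+ k) (B ^+ k)
  (fun j => lvl j ^+ k) (fun j => k%:R * B ^+ k * (lv j.+1 - lv j)).
have -> : (\sum_(j < m) k%:R * B ^+ k * (lv j.+1 - lv j)) = k%:R * B ^+ k * (hi - lo).
  rewrite -mulr_sumr -(big_mkord xpredT (fun j => lv j.+1 - lv j)) telescope_sumr//.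
  by rewrite /lv leqnn leqNgt m0.
apply.
- by rewrite /ucell leqnn; case: eqP m0 => // ->.
- exact: measurable_funX.
- have B0 : 0 <= B by exact: le_trans B1.
  by move=> t; rewrite normrX; apply: lerXn2r; rewrite ?nnegrE// bnd.
- move=> j t jm At nAt.
  have lvlj : lvl j = lv j by rewrite /lv leqNgt jm.
  have h1 : lv j <= q t.
    rewrite -lvlj /lvl /riemann_node; case: eqP => [_|/eqP j0]; first by have /andP[] := qlh t.
    apply: qnd; rewrite leNgt; apply/negP => tj; apply: nAt.
    by rewrite /ucell (negbTE j0) leqNgt jm /= in_itv.
  have h2 : q t <= lv j.+1.
    rewrite /lv; case: ifP => [_|/negbT]; first by have /andP[] := qlh t.
    rewrite -ltnNge => jm1; apply: qnd; move: At.
    by rewrite /ucell /= leqNgt jm1 /= in_itv /= => /ltW.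
  rewrite lvlj; apply: le_trans (expr_lipschitz k B1 (bnd _ (qlh t)) (bnd _ (lvb j))) _.
  by rewrite ler_wpM2l// ger0_norm ?subr_ge0// lerD2r.
Qed.

(** Cells are numbered from 0 and node 0 is left out of the count, so that the count is the number
    of the cell containing [t]. *)
Definition quantile_index (m : nat) (t : R) : nat :=
  count (fun k : nat => k%:R / m%:R <= t) (iota 1 m.-1).

Lemma quantile_index_cell m j t : (j < m)%N -> ucell m j.+1 t -> ~ ucell m j t ->
  quantile_index m t = j.
Proof.
move=> jm At nAt; have m0 : (0 < m)%N by apply: leq_ltn_trans jm.
have mr : 0 < m%:R^-1 :> R by rewrite invr_gt0 ltr0n.
have jt : j != 0%N -> j%:R / m%:R <= t.
  move=> j0; rewrite leNgt; apply/negP => tj; apply: nAt.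
  by rewrite /ucell (negbTE j0) leqNgt jm /= in_itv.
have tj : (j.+1 < m)%N -> t < j.+1%:R / m%:R.
  by move=> jm1; move: At; rewrite /ucell /= leqNgt jm1 /= in_itv.
rewrite /quantile_index; have -> : m.-1 = (j + (m.-1 - j))%N by lia.
rewrite iotaD count_cat [X in (X + _)%N](_ : _ = j); last first.
  rewrite -[RHS](size_iota 1 j); apply/eqP; rewrite -all_count; apply/allP => k.
  rewrite mem_iota => /andP[k1 kj].
  have j0 : j != 0%N by lia.
  by apply: le_trans (jt j0); rewrite ler_pM2r// ler_nat; lia.
rewrite [X in (_ + X)%N](_ : _ = 0%N) ?addn0//.
apply/eqP; rewrite -leqn0 leqNgt -has_count; apply/hasPn => k.
rewrite mem_iota => /andP[k1 km].
have jm1 : (j.+1 < m)%N by lia.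
rewrite -ltNge; apply: lt_le_trans (tj jm1) _.
by rewrite ler_pM2r// ler_nat; lia.
Qed.

Lemma quantile_index_lt m t : (0 < m)%N -> (quantile_index m t < m)%N.
Proof.
move=> m0; rewrite /quantile_index (leq_ltn_trans (count_size _ _))// size_iota.
by rewrite prednK.
Qed.

Lemma quantile_index_nd m t t' : t <= t' -> (quantile_index m t <= quantile_index m t')%N.
Proof. by move=> tt'; apply: sub_count => k /le_trans; apply. Qed.

(** The empirical quantile function: under the uniform law its distribution is the empirical
    distribution of [s]. *)
Definition quantile (s : seq R) (t : R) : R :=
  nth 0 (sort <=%R s) (quantile_index (size s) t).

Lemma quantile_mem s t : (0 < size s)%N -> quantile s t \in s.
Proof.
move=> s0; rewrite -(mem_sort <=%R) mem_nth// size_sort.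
exact: quantile_index_lt.
Qed.

Lemma quantile_nd s : (0 < size s)%N -> nondecreasing_fun (quantile s).
Proof.
move=> s0 t t' tt'; apply: (sorted_leq_nth le_trans le_refl 0 (sort_le_sorted _)).
- by rewrite inE size_sort quantile_index_lt.
- by rewrite inE size_sort quantile_index_lt.
- exact: quantile_index_nd.
Qed.

Lemma integral_quantile s (B : R) k : (0 < size s)%N -> (forall x, x \in s -> `|x| <= B) ->
  \int[U]_t (quantile s t ^+ k) = (\sum_(x <- s) x ^+ k) / (size s)%:R.
Proof.
move=> s0 sB.
have mq : measurable_fun setT (quantile s).
  by apply: nondecreasing_measurable => //; exact: quantile_nd.
have := @cell_integral _ _ R U (size s) (ucell (size s)) (measurable_ucell _) (erefl _)
  (@ucellS _) (fun j jm => uniform_ucell s0 jm) _ (fun t => quantile s t ^+ k) (B ^+ k)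
  (fun j => nth 0 (sort <=%R s) j ^+ k) (fun j => 0).
rewrite [X in _ <= X / _]big1// mul0r => h.
have -> : \sum_(x <- s) x ^+ k = \sum_(j < size s) nth 0 (sort <=%R s) j ^+ k.
  by rewrite -(perm_big _ (permEl (perm_sort <=%R s))) (big_nth 0) big_mkord size_sort.
apply/eqP; rewrite -subr_eq0 -normr_le0; apply: h.
- by rewrite /ucell leqnn; case: eqP s0 => // ->.
- exact: measurable_funX.
- move=> t; have qB := sB _ (quantile_mem t s0).
  by rewrite normrX; apply: lerXn2r; rewrite ?nnegrE//; exact: le_trans qB.
- by move=> j t js At nAt; rewrite /quantile (quantile_index_cell js At nAt) subrr normr0.
Qed.
End UniformCells.

Section LimitLaw.
Variable R : realType.

(** By compactness the image ultrafilter clusters somewhere, and a cluster point of an ultrafilter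
    is a limit. *)
Lemma ultra_cvg (F : set_system nat) (u : nat -> R) (lo hi : R) : UltraFilter F ->
  (forall n, lo <= u n <= hi) -> exists x : R, u n @[n --> F] --> x.
Proof.
move=> UF ulh.
have [] := @segment_compact R lo hi (u @ F) _.
  by apply: (@filterE _ F) => n; rewrite /= in_itv /= ulh.
move=> p [_ clp]; exists p => A nA.
have [//|Fn] := in_ultra_setVsetC (u @^-1` A) UF.
by have [x [nAx Ax]] := clp (~` A) A Fn nA.
Qed.

Lemma moment_distribution d (T : measurableType d) (P : probability T R)
    (X : {RV P >-> R}) (B : R) k : {ae P, forall t, `|X t| <= B} ->
  moment (distribution P X) k = \int[P]_t (X t ^+ k).
Proof.
move=> XB; rewrite /moment /Rintegral; congr fine.
rewrite (integral_distribution (f := fun x : R => (x ^+ k)%:E))//.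
  by apply/measurable_EFinP; apply: measurable_funX.
apply: (@integrable_part _ _ _ _ (fun t => X t ^+ k)).
  exact: measurable_funX.
exists (B ^+ k); apply: filterS XB => t XB; rewrite normrX.
by apply: lerXn2r; rewrite ?nnegrE//; exact: le_trans XB.
Qed.

(* The law is that of a pointwise limit, along an ultrafilter, of the quantile
   functions of the samples, which are monotone functions on [0, 1]. *)
Lemma limit_law (lo hi : R) (s : nat -> seq R) (m : nat -> R) :
  (forall n, (0 < size (s n))%N) ->
  (forall n x, x \in s n -> lo <= x <= hi) ->
  (forall k, (fun n => (\sum_(x <- s n) x ^+ k) / (size (s n))%:R) @ \oo --> m k) ->
  exists rho : probability R R, rho [set` `[lo, hi]] = 1%E /\
    forall k, moment rho k = m k.
Proof.
move=> s0 slh sm.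
have [F [UF sF]] := ultraFilterLemma (eventually_filter).
have PF : ProperFilter F by exact: ultra_proper.
have qlh n t : lo <= quantile (s n) t <= hi by apply: slh (quantile_mem t (s0 n)).
have /choice[X XP] : forall t, exists x : R, quantile (s n) t @[n --> F] --> x.
  by move=> t; exact: (ultra_cvg UF (fun n => qlh n t)).
have Xlh t : lo <= X t <= hi.
  apply/andP; split.
    by apply: (cvgr_to_ge (XP t)); apply: filterE => n; have /andP[] := qlh n t.
  by apply: (cvgr_to_le (XP t)); apply: filterE => n; have /andP[] := qlh n t.
(* Limits along an ultrafilter do not preserve measurability in general; monotonicity survives the
   limit and implies it. *)
have Xnd : nondecreasing_fun X.
  move=> t t' tt'; apply: (ler_cvg_to (XP t) (XP t')).
  by apply: filterE => n; apply: quantile_nd => //; exact: s0.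
have mX : measurable_fun setT X by exact: nondecreasing_measurable.
pose U : probability _ R := uniform_prob (@ltr01 R).
pose X' : {RV U >-> R} := HB.pack X (@isMeasurableFun.Build _ _
  (g_sigma_algebraType (R.-ocitv.-measurable)) R X mX).
exists (distribution U X'); split.
  have XT : X' @^-1` [set` `[lo, hi]] = setT.
    by apply/seteqP; split=> // t _; rewrite /= in_itv /= Xlh.
  exact: etrans (congr1 U XT) (probability_setT U).
pose B := Num.max 1 (Num.max `|lo| `|hi|).
have B1 : 1 <= B by rewrite le_max lexx.
have loB : `|lo| <= B by rewrite !le_max lexx orbT.
have hiB : `|hi| <= B by rewrite !le_max lexx !orbT.
have XB t : `|X t| <= B.
  move: loB hiB (Xlh t); rewrite !ler_norml => /andP[l1 _] /andP[_ h2] /andP[xl xh].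
  by rewrite (le_trans l1 xl) (le_trans xh h2).
move=> k; rewrite (@moment_distribution _ _ U X' B)//; last exact: aeW.
apply/eqP; rewrite -subr_eq0 -normr_le0; apply/ler_addgt0Pr => e e0.
rewrite add0r.
pose C := k%:R * B ^+ k * (hi - lo).
(* Two integrals are compared through the same nodes, that of the limit [X] and the limit of those
   of the quantile functions; each comparison costs [C / M]. *)
have [M [M0 CM]] : exists M : nat, (0 < M)%N /\ 2 * C / M%:R <= e.
  exists (Num.truncn `|2 * C / e|).+1; split=> //.
  rewrite ler_pdivrMr ?ltr0n// -ler_pdivrMl// mulrC.
  apply: (le_trans (ler_norm _)); exact/ltW/truncnS_gt.
have node_cvg j : riemann_node (quantile (s n)) lo M j @[n --> F] --> riemann_node X lo M j.
  by rewrite /riemann_node; case: eqP => _; [exact: cvg_cst|exact: XP].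
have sum_cvg l : (\sum_(j < l) riemann_node (quantile (s n)) lo M j ^+ k) @[n --> F] -->
    \sum_(j < l) riemann_node X lo M j ^+ k.
  elim: l => [|l IH].
    by rewrite big_ord0; under eq_fun do rewrite big_ord0; exact: cvg_cst.
  rewrite big_ord_recr /=; under eq_fun do rewrite big_ord_recr /=.
  apply: cvgD => //; apply: (cvg_comp _ (fun x => x ^+ k) (node_cvg l)).
  exact: exprn_continuous.
have h1 := monotone_riemann_sum k M0 Xnd Xlh B1 loB hiB.
have h2 : `|m k - (\sum_(j < M) riemann_node X lo M j ^+ k) / M%:R| <= C / M%:R.
  have c1 : (\int[U]_t (quantile (s n) t ^+ k)
     - (\sum_(j < M) riemann_node (quantile (s n)) lo M j ^+ k) / M%:R) @[n --> F] -->
     m k - (\sum_(j < M) riemann_node X lo M j ^+ k) / M%:R.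
    apply: cvgB; last by apply: cvgM (sum_cvg M) (cvg_cst _).
    have -> : (fun n => \int[U]_t (quantile (s n) t ^+ k)) =
       (fun n => (\sum_(x <- s n) x ^+ k) / (size (s n))%:R).
      apply/funext => n; apply: (integral_quantile k (s0 n) (B := B)) => x xs.
      move: loB hiB (slh n x xs); rewrite !ler_norml => /andP[l1 _] /andP[_ h2] /andP[xl xh].
      by rewrite (le_trans l1 xl) (le_trans xh h2).
    exact: cvg_trans (cvg_app _ sF) (sm k).
  apply: (cvgr_to_le (cvg_norm c1)); apply: filterE => n.
  exact: (monotone_riemann_sum k M0 (quantile_nd (s0 n)) (qlh n) B1 loB hiB).
apply: le_trans CM.
rewrite [2 * C]mulrC mulrAC mulr_natr mulr2n.
apply: le_trans (lerD h1 h2); rewrite (distrC (m k)).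
by apply: le_trans (ler_normD _ _); rewrite addrA subrK.
Qed.
End LimitLaw.

(** * Operator bounds of hermitian matrices *)
Section OperatorBound.
Variables (R : realType) (n : nat).
Local Notation C := R[i].
Local Notation N := n.+1.
Implicit Types (X Y : 'M[C]_N) (v : 'rV[C]_N) (k l : R).

Definition sqnorm v : C := \sum_j `|v 0 j| ^+ 2.

(** Operator norm at most [|k|] for the action on row vectors, squared to avoid roots. *)
Definition opbound k X := forall v, sqnorm (v *m X) <= (k ^+ 2)%:C * sqnorm v.

Lemma sqnorm_ge0 v : 0 <= sqnorm v.
Proof. by apply: sumr_ge0 => j _; rewrite exprn_ge0. Qed.

Lemma sqnormE v : sqnorm v = (v *m v^t* ) 0 0.
Proof. by rewrite mxE; apply: eq_bigr => j _; rewrite !mxE normCK. Qed.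

Lemma sqnormZ c v : sqnorm (c *: v) = `|c| ^+ 2 * sqnorm v.
Proof. by rewrite mulr_sumr; apply: eq_bigr => j _; rewrite mxE normrM exprMn. Qed.

Lemma sqnormD v w : sqnorm (v + w) <= 2 * sqnorm v + 2 * sqnorm w.
Proof.
rewrite !mulr_sumr -big_split; apply: ler_sum => j _ /=; rewrite mxE.
set a := v 0 j; set b := w 0 j.
have h : `|a + b| ^+ 2 <= (`|a| + `|b|) ^+ 2.
  by rewrite lerXn2r ?nnegrE ?addr_ge0// ler_normD.
apply: (le_trans h); rewrite -subr_ge0.
have -> : 2 * `|a| ^+ 2 + 2 * `|b| ^+ 2 - (`|a| + `|b|) ^+ 2 = (`|a| - `|b|) ^+ 2 by ring.
by rewrite real_exprn_even_ge0// realB ?normr_real.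
Qed.

Lemma opboundM k l X Y : opbound k X -> opbound l Y -> opbound (k * l) (X *m Y).
Proof.
move=> kX lY v; rewrite mulmxA; apply: (le_trans (lY _)).
have -> : ((k * l) ^+ 2)%:C = (l ^+ 2)%:C * (k ^+ 2)%:C :> C.
  by rewrite exprMn mulrC; exact: (rmorphM (real_complex R)).
rewrite -mulrA.
apply: ler_wpM2l; first by rewrite ler0c sqr_ge0.
exact: kX.
Qed.

Lemma opbound_le k l X : 0 <= k -> k <= l -> opbound k X -> opbound l X.
Proof.
move=> k0 kl kX v; apply: (le_trans (kX v)); rewrite ler_wpM2r ?sqnorm_ge0//.
by rewrite lecR lerXn2r// nnegrE (le_trans k0).
Qed.

(** The constant is not sharp: [2 * k ^+ 2 + 2 * l ^+ 2 <= (2 * (k + l)) ^+ 2] spares the triangle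
    inequality for the norm. *)
Lemma opboundD k l X Y : 0 <= k -> 0 <= l -> opbound k X -> opbound l Y ->
  opbound (2 * (k + l)) (X + Y).
Proof.
move=> k0 l0 kX lY v; rewrite mulmxDr; apply: (le_trans (sqnormD _ _)).
apply: (@le_trans _ _ (2 * ((k ^+ 2)%:C * sqnorm v) + 2 * ((l ^+ 2)%:C * sqnorm v))).
  by apply: lerD; rewrite ler_wpM2l.
rewrite -!mulrDr -mulrDl mulrA ler_wpM2r ?sqnorm_ge0//.
rewrite -(rmorph_nat (real_complex R)) -rmorphD -rmorphM lecR.
have := mulr_ge0 k0 l0; have := sqr_ge0 k; have := sqr_ge0 l; nra.
Qed.

Lemma opbound_scalar (c : C) k : `|c| <= k%:C -> opbound k c%:M.
Proof.
move=> ck v; rewrite mul_mx_scalar sqnormZ ler_wpM2r ?sqnorm_ge0//.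
by rewrite rmorphXn lerXn2r ?nnegrE// (le_trans _ ck).
Qed.

Lemma sqnorm_unitary v X : X \is unitarymx -> sqnorm (v *m X) = sqnorm v.
Proof.
move=> /unitarymxP XX; rewrite !sqnormE trmx_mul map_mxM -!mulmxA.
by rewrite (mulmxA X) XX mul1mx.
Qed.

Lemma opbound_unitary X : X \is unitarymx -> opbound 1 X.
Proof. by move=> uX v; rewrite sqnorm_unitary// expr1n mul1r. Qed.

Lemma sqnorm_delta i : sqnorm (delta_mx 0 i : 'rV[C]_N) = 1.
Proof.
rewrite /sqnorm (bigD1 i)//= mxE !eqxx normr1 expr1n big1 ?addr0// => j /negbTE ji.
by rewrite mxE ji andbF normr0 expr0n.
Qed.

Lemma opbound_row k X i : opbound k X -> \sum_j `|X i j| ^+ 2 <= (k ^+ 2)%:C.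
Proof.
move=> /(_ (delta_mx 0 i)); rewrite sqnorm_delta mulr1 -rowE => h.
apply: le_trans h; rewrite le_eqVlt; apply/orP; left; apply/eqP.
by apply: eq_bigr => j _; rewrite mxE.
Qed.

Lemma opbound_entry k X i j : 0 <= k -> opbound k X -> `|X i j| <= k%:C.
Proof.
move=> k0 /(@opbound_row _ _ i); rewrite (bigD1 j)//= => h.
have {}h : `|X i j| ^+ 2 <= k%:C ^+ 2.
  have -> : k%:C ^+ 2 = (k ^+ 2)%:C :> C by rewrite rmorphXn.
  apply: le_trans h; rewrite lerDl; apply: sumr_ge0 => m _.
  by rewrite exprn_ge0.
by rewrite -(@ler_pXn2r _ 2)// ?nnegrE// ler0c.
Qed.

Lemma opbound_hs k X : opbound k X -> \sum_i \sum_j `|X i j| ^+ 2 <= N%:R * (k ^+ 2)%:C.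
Proof.
move=> kX; apply: le_trans (ler_sum _ (fun i _ => opbound_row i kX)) _.
by rewrite sumr_const card_ord mulr_natl.
Qed.

Lemma opbound_tr k X : 0 <= k -> opbound k X -> `|N%:R^-1 * \tr X| <= k%:C.
Proof.
move=> k0 kX; rewrite normrM normfV normr_nat ler_pdivrMl ?ltr0n//.
apply: le_trans (ler_norm_sum _ _ _) _.
apply: le_trans (ler_sum _ (fun i _ => opbound_entry i i k0 kX)) _.
by rewrite sumr_const card_ord mulr_natl.
Qed.

Lemma opbound_diag k (V : 'M[C]_N) (D : 'rV[C]_N) : V \is unitarymx ->
  (forall i, `|D 0 i| <= k%:C) -> opbound k (V^t* *m diag_mx D *m V).
Proof.
move=> uV Dk v; rewrite !mulmxA sqnorm_unitary//.
have uV' : V^t* \is unitarymx by rewrite trmxC_unitary.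
rewrite -(sqnorm_unitary v uV') /sqnorm mulr_sumr; apply: ler_sum => j _.
rewrite mul_mx_diag mxE normrM exprMn mulrC ler_wpM2r ?exprn_ge0//.
by rewrite rmorphXn lerXn2r ?nnegrE// (le_trans _ (Dk j)).
Qed.

Lemma herm_spectralE X : X \is hermsymmx ->
  X = (spectralmx X)^t* *m diag_mx (spectral_diag X) *m spectralmx X.
Proof.
move=> hX; rewrite -invmx_unitary ?spectral_unitarymx//.
exact/orthomx_spectralP/hermitian_normalmx.
Qed.

Lemma herm_adj X : X \is hermsymmx -> X^t* = X.
Proof. by move=> /is_hermitianmxP e; rewrite [RHS]e expr0 scale1r. Qed.

Lemma spectral_row X i : X \is hermsymmx ->
  row i (spectralmx X) *m X = spectral_diag X 0 i *: row i (spectralmx X).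
Proof.
move=> hX; have XE := herm_spectralE hX.
move: (spectralmx X) (spectral_diag X) XE (spectral_unitarymx X) => V D XE uV.
have VV : V *m V^t* = 1%:M by apply/unitarymxP.
rewrite XE !mulmxA -row_mul VV -row_mul mul1mx row_diag_mx -scalemxAl -rowE //.
Qed.

(** The moduli of the eigenvalues of a hermitian matrix are singular values, hence lie below the
    supremum, and the spectral decomposition turns this into an operator bound. *)
Lemma opbound_max_singular_value X M : X \is hermsymmx ->
  max_singular_value X <= M -> opbound M X /\ 0 <= M.
Proof.
move=> hX XM.
have uV := spectral_unitarymx X.
set D := spectral_diag X.
have Dreal i : (complex.Re (D 0 i))%:C = D 0 i.
  have /mxOverP/(_ 0 i) := hermitian_spectral_diag_real hX.
  exact: RRe_real.
pose S := [set s : R | 0 <= s /\ eigenvalue (X^t* *m X) (s ^+ 2)%:C].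
(* A crude bound, which only serves to show that the set of singular values is bounded, so that
   [sup] is an upper bound of it. *)
pose K : R := \sum_i `|complex.Re (D 0 i)|.
have K0 : 0 <= K by apply: sumr_ge0.
have normD i : `|D 0 i| = `|complex.Re (D 0 i)|%:C.
  by rewrite -[in LHS]Dreal normc_def /= expr0n addr0 sqrtr_sqr.
have XK : opbound K X.
  rewrite [X](herm_spectralE hX); apply: opbound_diag => // i.
  rewrite -/D normD lecR /K (bigD1 i)//= lerDl; exact: sumr_ge0.
have SK : ubound S K.
  move=> s [s0 /eigenvalueP[v vE v0]].
  have := opboundM XK XK v; rewrite -{1}(herm_adj hX) vE sqnormZ.
  have v_gt0 : 0 < sqnorm v.
    rewrite lt_neqAle sqnorm_ge0 andbT eq_sym; apply: contra v0.
    rewrite psumr_eq0; last by move=> j _; rewrite exprn_ge0.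
    move=> /allP v0; apply/eqP/rowP => j; rewrite mxE; apply/eqP.
    by have := v0 j (mem_index_enum j); rewrite /= expf_eq0 /= normr_eq0.
  rewrite ler_pM2r// -expr2 -exprM normc_def /= expr0n addr0 sqrtr_sqr.
  rewrite -rmorphXn lecR ger0_norm ?sqr_ge0// -exprM.
  by rewrite ler_pXn2r// nnegrE.
have SD i : S `|complex.Re (D 0 i)|.
  split=> //; apply/eigenvalueP; exists (row i (spectralmx X)).
    rewrite herm_adj// mulmxA spectral_row// -scalemxAl spectral_row// scalerA -/D.
    congr (_ *: _); rewrite real_normK ?num_real//.
    by rewrite -{1 2}Dreal -rmorphM.
  apply/eqP => r0; have := sqnorm_unitary (delta_mx 0 i) uV.
  rewrite -rowE r0 sqnorm_delta /sqnorm big1 => [/eqP|j _]; last by rewrite mxE normr0 expr0n.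
  by rewrite eq_sym oner_eq0.
have supS : has_sup S by split; [exists `|complex.Re (D 0 ord0)|; exact: SD|exists K].
have DM i : `|complex.Re (D 0 i)| <= M.
  by apply: le_trans XM; rewrite /max_singular_value; exact: (sup_upper_bound supS (SD i)).
split; last exact: le_trans (DM ord0).
rewrite [X](herm_spectralE hX); apply: opbound_diag => // i.
by rewrite -/D normD lecR.
Qed.

Lemma tr_unitary_diag_pow (V : 'M[C]_N) (D : 'rV[C]_N) (k : nat) : V \is unitarymx ->
  \tr ((V^t* *m diag_mx D *m V) ^+ k) = \sum_i D 0 i ^+ k.
Proof.
move=> /unitarymxP VV.
have -> : (V^t* *m diag_mx D *m V) ^+ k = V^t* *m diag_mx (\row_i D 0 i ^+ k) *m V.
  elim: k => [|k IH].
    rewrite expr0 (_ : diag_mx _ = 1%:M); last first.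
      by apply/matrixP => i j; rewrite !mxE expr0.
    by rewrite mulmx1 (mulmx1C VV).
  rewrite exprSr IH -[LHS]/(_ *m _) !mulmxA.
  rewrite -[_ *m V *m V^t* ]mulmxA VV mulmx1 -[_ *m diag_mx _ *m diag_mx _]mulmxA.
  rewrite mulmx_diag; congr (_ *m diag_mx _ *m _).
  by apply/rowP => i; rewrite !mxE exprSr.
rewrite mxtrace_mulC mulmxA VV mul1mx mxtrace_diag.
by apply: eq_bigr => i _; rewrite mxE.
Qed.

Lemma tr_herm_pow X (k : nat) : X \is hermsymmx ->
  \tr (X ^+ k) = \sum_i spectral_diag X 0 i ^+ k.
Proof.
by move=> hX; rewrite [in LHS](herm_spectralE hX) tr_unitary_diag_pow// spectral_unitarymx.
Qed.

Lemma spectral_diag_bound k X i : X \is hermsymmx -> 0 <= k -> opbound k X ->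
  `|spectral_diag X 0 i| <= k%:C.
Proof.
move=> hX k0 kX; have := kX (row i (spectralmx X)).
rewrite spectral_row// sqnormZ rowE sqnorm_unitary ?spectral_unitarymx//.
rewrite sqnorm_delta !mulr1 rmorphXn ler_pXn2r// nnegrE//.
by rewrite ler0c.
Qed.

Lemma sqrtmxE X : sqrtmx X =
  (spectralmx X)^t* *m diag_mx (map_mx sqrtC (spectral_diag X)) *m spectralmx X.
Proof. by rewrite /sqrtmx invmx_unitary ?spectral_unitarymx. Qed.

(** The root has norm at most [sqrt k], and [1 <= k] lets one constant serve for the matrix and its
    root. *)
Lemma opbound_sqrtmx k X : X \is hermsymmx -> 1 <= k -> opbound k X -> opbound k (sqrtmx X).
Proof.
move=> hX k1 kX; have k0 : 0 <= k := le_trans ler01 k1.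
rewrite sqrtmxE; apply: opbound_diag => [|i]; first exact: spectral_unitarymx.
rewrite mxE -(@ler_pXn2r _ 2)// ?nnegrE ?ler0c// -normrX sqrtCK.
apply: le_trans (spectral_diag_bound i hX k0 kX) _.
by rewrite -rmorphXn lecR expr2 ler_peMl.
Qed.
End OperatorBound.

(** * Alternating words in the Hadamard model *)
Lemma prod_pairs_rcons (C : comPzRingType) N (Ys Ms : seq 'M[C]_N) (M0 Q : 'M[C]_N) :
  size Ys = (size Ms).+1 ->
  prod_pairs Ys (rcons Ms M0) *m Q = prod_pairs Ys (rcons Ms (M0 *m Q)).
Proof.
elim: Ms Ys => [|M Ms IH] [|Y Ys] //= [sY]; last by rewrite -mulmxA IH.
by rewrite (size0nil sY) /= !mulmx1 mulmxA.
Qed.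

Lemma prod_pairsZ (C : comPzRingType) N (Ys Ms : seq 'M[C]_N) (c : C) :
  size Ms = size Ys ->
  prod_pairs (map (fun Y => c *: Y) Ys) Ms = c ^+ size Ys *: prod_pairs Ys Ms.
Proof.
elim: Ys Ms => [|Y Ys IH] [|M Ms] //=; first by rewrite scale1r.
by move=> [sM]; rewrite IH// -!scalemxAl -scalemxAr scalerA exprSr mulrC.
Qed.

Section MatrixWords.
Variables (R : realType) (n : nat).
Local Notation C := R[i].
Local Notation N := n.+1.
Local Notation q := (Num.sqrt N%:R : R).
Variable (h : 'M[C]_N).
Hypothesis h_unitary : h \is unitarymx.
Hypothesis h_entry : forall i j, `|h i j| = (q^-1)%:C.
Local Notation letter := (bool * 'M[C]_N)%type.
Implicit Types (e : {ffun 'I_N -> bool}) (t : 'S_N).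

(** [h] is the Hadamard matrix divided by [sqrt N]; the transpose serves as adjoint because signed
    permutation matrices are real. *)
Definition had_conj (w : 'M[C]_N) : 'M[C]_N := w^T *m h *m w.

Definition letter_mx (w : 'M[C]_N) (p : letter) : 'M[C]_N :=
  if p.1 then had_conj w *m p.2 *m (had_conj w)^t* else p.2.

Definition word_mx (w : 'M[C]_N) (L : seq letter) : 'M[C]_N :=
  \prod_(p <- L) letter_mx w p.

Definition avg_word (L : seq letter) : C :=
  (2 ^ N * N`!)%N%:R^-1 * \sum_(t : 'S_N) \sum_(e : {ffun 'I_N -> bool})
    (N%:R^-1 * \tr (word_mx (spm C e t) L)).

Definition pre (i : bool) : 'M[C]_N := if i then h else 1%:M.
Definition post (i : bool) : 'M[C]_N := if i then h^t* else 1%:M.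

Fixpoint mids (L : seq letter) : seq 'M[C]_N :=
  match L with
  | p :: ((r :: _) as L') => post p.1 *m pre r.1 :: mids L'
  | _ => [::]
  end.

Lemma size_mids p L : size (mids (p :: L)) = size L.
Proof. by elim: L p => //= r L IH p; rewrite IH. Qed.

Lemma spm_adj e t : (spm C e t)^t* = (spm C e t)^T.
Proof.
apply/matrixP => i j; rewrite !mxE rmorphM rmorphXn rmorphN rmorph1.
by rewrite rmorph_nat.
Qed.

Lemma had_conj_adj e t : (had_conj (spm C e t))^t* =
  (spm C e t)^T *m h^t* *m spm C e t.
Proof.
have wr : map_mx Num.conj (spm C e t) = spm C e t.
  by rewrite -[RHS]trmxK -spm_adj -map_trmx trmxK.
by rewrite /had_conj !trmx_mul !map_mxM trmxK wr spm_adj mulmxA.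
Qed.

(** Conjugation by [w], invisible to the trace, turns [U] into [h] and moves [w] onto all letters
    alike, on both sides of the word. *)
Lemma word_mx_conj e t (L : seq letter) : let w := spm C e t in
  w *m word_mx w L *m w^T =
  \prod_(p <- L) (pre p.1 *m (w *m p.2 *m w^T) *m post p.1).
Proof.
move=> w; have ww : w *m w^T = 1%:M by exact: spm_unitary.
have ww' : w^T *m w = 1%:M := mulmx1C ww.
elim: L => [|p L IH]; first by rewrite /word_mx !big_nil mulmx1.
rewrite /word_mx !big_cons -IH -/(word_mx w L) -![_ * _]/(_ *m _).
have -> : pre p.1 *m (w *m p.2 *m w^T) *m post p.1 = w *m letter_mx w p *m w^T.
  rewrite /letter_mx /pre /post; case: p.1; last by rewrite mul1mx mulmx1.
  rewrite /w had_conj_adj -/w /had_conj.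
  rewrite !mulmxA ww mul1mx.
  by rewrite -[in RHS]mulmxA ww mulmx1.
by rewrite !mulmxA -[_ *m w^T *m w]mulmxA ww' mulmx1.
Qed.

Lemma prod_prepost (Y : letter -> 'M[C]_N) p (L : seq letter) :
  \prod_(r <- p :: L) (pre r.1 *m Y r *m post r.1) =
  pre p.1 *m prod_pairs (map Y (p :: L)) (rcons (mids (p :: L)) (post (last p L).1)).
Proof.
elim: L p => [|r L IH] p.
  by rewrite big_cons big_nil mulr1 /= mulmx1 mulmxA.
rewrite big_cons IH -[LHS]/(_ *m _) [in RHS]/= !mulmxA.
by [].
Qed.

Definition alternating_letters (L : seq letter) := sorted (fun p r : letter => p.1 != r.1) L.

Let q0 : 0 < q. Proof. exact: q_gt0. Qed.

Let qi1 : (q^-1)%:C <= 1 :> C.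
Proof. by rewrite lecR invf_le1// q_ge1. Qed.

Lemma mids_bound L : alternating_letters L ->
  All (fun M : 'M[C]_N => forall i j, `|M i j| <= (q^-1)%:C) (mids L).
Proof.
case: L => // p L; elim: L p => //= r L IH p /andP[pr rL]; split; last exact: IH.
rewrite /post /pre; move: pr; case: p.1; case: r.1 => // _ i j.
  by rewrite mulmx1 !mxE norm_conjC h_entry.
by rewrite mul1mx h_entry.
Qed.

Lemma closing_bound a b i j : `|(post a *m pre b) i j| <= 1.
Proof.
rewrite /post /pre; case: a; case: b.
- rewrite (mulmx1C (unitarymxP h_unitary)) mxE; case: eqP; rewrite ?normr1//.
  by rewrite mulr0n normr0.
- by rewrite mulmx1 !mxE norm_conjC h_entry.
- by rewrite mul1mx h_entry.
- by rewrite mulmx1 mxE; case: eqP; rewrite ?normr1// mulr0n normr0.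
Qed.

Lemma avg_word_traceless (k : R) L : 0 < k -> L != [::] -> alternating_letters L ->
  All (fun p : letter => opbound k p.2 /\ \tr p.2 = 0) L ->
  `|avg_word L| <= (k ^+ size L * word_cst R (size L) / q)%:C.
Proof.
case: L => // p L k0 _ altL okL.
have kV0 : 0 <= (k^-1)%:C :> C by rewrite ler0c invr_ge0 ltW.
have kl0 : 0 <= (k ^+ size (p :: L))%:C :> C by rewrite ler0c exprn_ge0// ltW.
have kn0 : k%:C != 0 :> C by rewrite fmorph_eq0 gt_eqF.
set l := size (p :: L).
(* Division by [k] makes the entries at most 1 in modulus and the sum of their squares at most [N],
   as [avg_trace_bound] requires. *)
pose Xs := map (fun r : letter => (k^-1)%:C *: r.2) (p :: L).
have trE e t : \tr (word_mx (spm C e t) (p :: L)) =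
    (k ^+ l)%:C * \tr (prod_pairs (map (fun X => spm C e t *m X *m (spm C e t)^T) Xs)
      (rcons (mids (p :: L)) (post (last p L).1 *m pre p.1))).
  set w := spm C e t; have ww : w *m w^T = 1%:M by exact: spm_unitary.
  rewrite -[word_mx _ _]mul1mx -(mulmx1C ww) -mulmxA mxtrace_mulC word_mx_conj -/w.
  rewrite (prod_prepost (fun r => w *m r.2 *m w^T)) mxtrace_mulC.
  rewrite prod_pairs_rcons ?size_map ?size_mids//.
  have -> : map (fun r : letter => w *m r.2 *m w^T) (p :: L) =
      map (fun Y => k%:C *: Y) (map (fun X => w *m X *m w^T) Xs).
    rewrite /Xs -!map_comp; apply: eq_map => r /=.
    rewrite -scalemxAr -scalemxAl scalerA -rmorphM mulfV ?gt_eqF//.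
    by rewrite scale1r.
  rewrite prod_pairsZ; last by rewrite size_rcons !size_map size_mids.
  by rewrite mxtraceZ !size_map -/l; congr (_ * _); rewrite rmorphXn.
rewrite /avg_word.
under eq_bigr do under eq_bigr do rewrite trE mulrA.
under eq_bigr do rewrite -mulr_sumr.
rewrite -mulr_sumr !normrM.
have := @avg_trace_bound R n Xs (mids (p :: L)) (post (last p L).1 *m pre p.1).
rewrite size_mids size_map -/l => /(_ erefl) bnd.
have {}bnd := bnd _ (mids_bound altL) (closing_bound _ _).
have G0 : 0 < (2 ^ N * N`!)%N%:R :> C.
  by rewrite ltr0n muln_gt0 expn_gt0 fact_gt0.
rewrite !normfV !normr_nat ler_pdivrMl//.
apply: (@le_trans _ _ (N%:R^-1 * `|(k ^+ l)%:C| *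
   ((2 ^ N * N`!)%N%:R * (word_cst R l * q)%:C))).
  apply: ler_wpM2l; first by rewrite mulr_ge0// invr_ge0.
  apply: bnd; apply: All_map; apply: All_impl okL => r [kr tr0]; split.
  - move=> i j; rewrite mxE normrM -(@ler_pM2l _ k%:C) ?ltcR//.
    rewrite mulrA (ger0_norm kV0) -rmorphM mulfV ?gt_eqF// mul1r mulr1.
    by apply: opbound_entry => //; exact: ltW.
  - by rewrite mxtraceZ tr0 mulr0.
  - under eq_bigr do under eq_bigr do rewrite mxE normrM exprMn.
    under eq_bigr do rewrite -mulr_sumr.
    rewrite -mulr_sumr (ger0_norm kV0) -rmorphXn.
    rewrite exprVn fmorphV ler_pdivrMl ?ltcR ?exprn_gt0// mulrC.
    exact: opbound_hs.
rewrite mulrCA ler_wpM2l ?ler0n// (ger0_norm kl0).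
rewrite -(rmorph_nat (real_complex R)) -fmorphV -!rmorphM lecR.
rewrite le_eqVlt; apply/orP; left; apply/eqP.
move: q0 (sqr_q R n); move: (q) => x x0 <-.
by field; rewrite gt_eqF.
Qed.

Lemma had_conj_unitary e t : had_conj (spm C e t) \is unitarymx.
Proof.
have uw : spm C e t \is unitarymx by apply/unitarymxP; rewrite spm_adj spm_unitary.
rewrite /had_conj; apply: mul_unitarymx; last exact: uw.
apply: mul_unitarymx; last exact: h_unitary.
by rewrite -spm_adj trmxC_unitary.
Qed.

Lemma letter_mx_bound (k : R) e t p : opbound k p.2 -> opbound k (letter_mx (spm C e t) p).
Proof.
rewrite /letter_mx; case: p.1 => // kp.
rewrite -[k]mulr1 -{1}[k]mul1r; apply: opboundM.
  by apply: opboundM => //; apply: opbound_unitary; exact: had_conj_unitary.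
by apply: opbound_unitary; rewrite trmxC_unitary; exact: had_conj_unitary.
Qed.

(** Holds for words that do not alternate, such as those left after the removal of a letter:
    conjugation by a unitary keeps operator bounds. *)
Lemma avg_word_bound (k : R) L : 0 <= k -> All (fun p : letter => opbound k p.2) L ->
  `|avg_word L| <= (k ^+ size L)%:C.
Proof.
move=> k0 okL.
have G0 : 0 < (2 ^ N * N`!)%N%:R :> C.
  by rewrite ltr0n muln_gt0 expn_gt0 fact_gt0.
rewrite normrM normfV normr_nat ler_pdivrMl//.
apply: le_trans (ler_norm_sum _ _ _) _.
apply: (@le_trans _ _ (\sum_(t : 'S_N) \sum_(e : {ffun 'I_N -> bool}) (k ^+ size L)%:C)).
  apply: ler_sum => t _; apply: le_trans (ler_norm_sum _ _ _) _; apply: ler_sum => e _.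
  apply: opbound_tr; first exact: exprn_ge0.
  rewrite /word_mx; elim: L okL => [_|p L IH /= [okp /IH okL]].
    by rewrite big_nil; apply: opbound_scalar; rewrite normr1.
  by rewrite big_cons exprS; apply: opboundM => //; exact: letter_mx_bound.
rewrite !sumr_const card_ffun card_bool card_ord -mulrnA -card_Sn.
by rewrite mulr_natl mulrnA.
Qed.
End MatrixWords.

(** * Letters that are traceless only in the limit *)

Section LetterSequences.
Variable R : realType.
Local Notation C := R[i].
Variable h : forall n, 'M[C]_n.+1.
Hypothesis h_unitary : forall n, h n \is unitarymx.
Hypothesis h_entry : forall n i j, `|h n i j| = ((Num.sqrt n.+1%:R)^-1)%:C.
Local Notation mxseq := (forall n, 'M[C]_n.+1).
Local Notation lseq := (bool * mxseq)%type.

Definition letters_at n (L : seq lseq) : seq (bool * 'M[C]_n.+1) :=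
  map (fun p => (p.1, p.2 n)) L.

Definition avg_seq (L : seq lseq) n : C := avg_word (h n) (letters_at n L).

Definition unif_bounded (X : mxseq) := exists k : R, 0 <= k /\ forall n, opbound k (X n).

Definition ntrace (X : mxseq) n : C := n.+1%:R^-1 * \tr (X n).

Lemma common_bound L : All (fun p : lseq => unif_bounded p.2) L ->
  exists k : R, 0 < k /\ forall n, All (fun p => opbound k p.2) (letters_at n L).
Proof.
elim: L => [_|p L IH /= [[k [k0 kp]] /IH[l [l0 lL]]]]; first by exists 1.
exists (k + l); split=> [|n]; first by rewrite ltr_wpDl.
split; first by apply: opbound_le (kp n); rewrite // lerDl ltW.
by apply: All_impl (lL n) => r; apply: opbound_le; rewrite ?(ltW l0)// lerDr.
Qed.

Lemma inv_sqrt_cvg0 (K : R) : (fun n => K / Num.sqrt n.+1%:R) @ \oo --> (0 : R).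
Proof.
apply/cvgrPdist_lt => e e0.
exists (Num.truncn ((`|K| / e) ^+ 2)) => // n /= Nn.
rewrite sub0r normrN normrM normfV (ger0_norm (sqrtr_ge0 _)).
rewrite ltr_pdivrMr ?sqrtr_gt0 ?ltr0n// mulrC -ltr_pdivrMr//.
have h0 : 0 <= `|K| / e by rewrite divr_ge0// ltW.
have -> : `|K| / e = Num.sqrt ((`|K| / e) ^+ 2) by rewrite sqrtr_sqr (ger0_norm h0).
rewrite ltr_sqrt ?ltr0n//.
apply: (lt_le_trans (truncnS_gt _)); by rewrite ler_nat.
Qed.

Lemma letter_mx_center n e t i (X : 'M[C]_n.+1) (d : C) :
  letter_mx (h n) (spm C e t) (i, X - d%:M) =
  letter_mx (h n) (spm C e t) (i, X) - d%:M.
Proof.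
rewrite /letter_mx /=; case: i => //; rewrite mulmxBr mulmxBl; congr (_ - _).
rewrite scalar_mxC -mulmxA (unitarymxP (had_conj_unitary (h_unitary n) e t)).
by rewrite mulmx1.
Qed.

(** Scalars commute with the conjugation by [U], so centering a letter leaves [d] times the word
    without it. *)
Lemma avg_word_center n u i (X : 'M[C]_n.+1) (d : C) v :
  avg_word (h n) (u ++ (i, X) :: v) =
  avg_word (h n) (u ++ (i, X - d%:M) :: v) + d * avg_word (h n) (u ++ v).
Proof.
rewrite /avg_word mulrCA -mulrDr; congr (_ * _).
rewrite mulr_sumr -big_split; apply: eq_bigr => t _.
rewrite mulr_sumr -big_split; apply: eq_bigr => e _ /=.
rewrite mulrCA -mulrDr; congr (_ * _); rewrite -linearZ -linearD /=; congr (\tr _).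
rewrite /word_mx !big_cat !big_cons /= letter_mx_center mulrBl mulrBr.
rewrite -[d%:M * _]/(d%:M *m _) mul_scalar_mx -scalerAr.
by rewrite subrK.
Qed.

Definition alternating_seq (L : seq lseq) := sorted (fun i j : bool => i != j) (map fst L).

Lemma alternating_lettersE n L : alternating_letters (letters_at n L) = alternating_seq L.
Proof.
rewrite /alternating_letters /alternating_seq sorted_map.
case: L => //= p L; elim: L p => //= r L IH p.
by rewrite IH.
Qed.

(* The letters are made exactly traceless from left to right; each correction is
   a vanishing normalized trace times a bounded average. *)
Lemma avg_seq_cvg0 L : L <> [::] -> alternating_seq L ->
  All (fun p : lseq => unif_bounded p.2 /\ ccvg (ntrace p.2) 0) L ->
  ccvg (avg_seq L) 0.
Proof.
suff H : forall v u, u ++ v <> [::] -> alternating_seq (u ++ v) ->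
    All (fun p : lseq => unif_bounded p.2 /\ forall n, \tr (p.2 n) = 0) u ->
    All (fun p : lseq => unif_bounded p.2 /\ ccvg (ntrace p.2) 0) v ->
    ccvg (avg_seq (u ++ v)) 0.
  by move=> L0 La okL; exact: (H L [::]).
elim=> [|[i X] v IH] u.
  rewrite cats0 => u0 ualt oku _.
  have [k [k0 ku]] := common_bound (All_impl (fun p => @proj1 _ _) oku).
  apply: (ccvg_norm0 (inv_sqrt_cvg0 (k ^+ size u * word_cst R (size u)))) => n.
  have su : size (letters_at n u) = size u by rewrite size_map.
  rewrite -su; apply: avg_word_traceless => //.
  - by case: (u) u0.
  - by rewrite alternating_lettersE.
  - move: (ku n) oku; elim: (u) => //= p u' IHu [kp ku'] [[_ p0] oku'].
    by split; [split|exact: IHu].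
move=> _ uvalt oku [[[k [k0 kX]] X0] okv].
pose d n := ntrace X n.
have dk n : `|d n| <= k%:C by exact: opbound_tr.
pose Y n := X n - (d n)%:M.
have okY : unif_bounded Y /\ forall n, \tr (Y n) = 0.
  split=> [|n].
    exists (2 * (k + k)); split; first by rewrite mulr_ge0// addr_ge0.
    move=> n; apply: opboundD => //; rewrite -raddfN.
    by apply: opbound_scalar; rewrite normrN.
  rewrite /Y linearB /= mxtrace_scalar -[_ *+ n.+1]mulr_natl /d /ntrace.
  by rewrite mulVKf ?pnatr_eq0// subrr.
have c1 : ccvg (avg_seq (rcons u (i, Y) ++ v)) 0.
  apply: IH => //.
  - by move=> /(congr1 size)/eqP; rewrite size_cat size_rcons.
  - by move: uvalt; rewrite /alternating_seq cat_rcons !map_cat.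
  - by elim: (u) oku => //= p u' IHu [? /IHu].
have okuv : All (fun p : lseq => unif_bounded p.2) (u ++ v).
  elim: (u) oku => [_|p u' IHu /= [[pb _] /IHu]] //=.
  by apply: All_impl okv => p [].
have [l [l0 luv]] := common_bound okuv.
have c2 : ccvg (fun n => d n * avg_seq (u ++ v) n) 0.
  apply: (ccvgM0 (K := (l ^+ size (u ++ v))%:C)) => // n.
  rewrite -(size_map (fun p : lseq => (p.1, p.2 n))).
  by apply: avg_word_bound => //; exact: ltW.
have := ccvgD c1 c2; rewrite addr0 => /eq_ccvg; apply=> n.
rewrite /avg_seq cat_rcons /letters_at !map_cat /=.
by rewrite [RHS](avg_word_center _ _ _ (d n)).
Qed.
End LetterSequences.

(** * Expectations under the uniform law as finite averages *)

Section UniformExpectation.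
Variables (d : measure_display) (T : measurableType d) (R : realType).
Variables (P : probability T R) (n : nat) (W : rmx P n).
Hypothesis W_unif : uniform_signed_perm W.
Local Notation N := n.+1.
Local Notation C := R[i].
Local Notation spm := (spm C).
Local Notation I := ('S_N * {ffun 'I_N -> bool})%type.

Let oneN1 : (1 == -1 :> C) = false.
Proof. by rewrite -subr_eq0 opprK -mulr2n pnatr_eq0. Qed.

Lemma signed_perm_spm (t : 'S_N) (e : {ffun 'I_N -> bool}) : signed_perm_mx (spm e t).
Proof.
exists (fun i => (-1) ^+ e i), t; split=> [i|//].
by case: (e i); [right; rewrite expr1|left; rewrite expr0].
Qed.

Lemma signed_perm_exists (w : 'M[C]_N) : signed_perm_mx w ->
  exists i : I, w = spm i.2 i.1.
Proof.
move=> [eps [s [eps1 ->]]].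
exists (s, [ffun i => eps i == -1]); apply/matrixP => i j; rewrite !mxE ffunE.
congr (_ * _); case: (eps1 i) => ->; last by rewrite eqxx expr1.
by rewrite oneN1 expr0.
Qed.

Lemma spm_inj : injective (fun i : I => spm i.2 i.1).
Proof.
move=> [s e] [s' e'] /= /matrixP E.
have sgn0 b : (-1) ^+ b != 0 :> C by rewrite signr_eq0.
have ss : s = s'.
  apply/permP => j; have := E (s j) j; rewrite !mxE eqxx mulr1.
  by case: eqP => // _ /eqP; rewrite mulr0 (negbTE (sgn0 _)).
rewrite -ss in E *; congr (_, _); apply/ffunP => i.
have := E i ((s^-1)%g i); rewrite !mxE permKV eqxx !mulr1.
case: (e i); case: (e' i) => //= /eqP; rewrite expr1 expr0.
  by rewrite eq_sym oneN1.
by rewrite oneN1.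
Qed.

Let E (i : I) : set T := [set t | W t = spm i.2 i.1].

Let mE i : measurable (E i).
Proof.
have /asboolP mW := valP W.
have -> : E i = \bigcap_(j in [set: 'I_N * 'I_N])
    ([set t | complex.Re (W t j.1 j.2) = complex.Re (spm i.2 i.1 j.1 j.2)]
     `&` [set t | complex.Im (W t j.1 j.2) = complex.Im (spm i.2 i.1 j.1 j.2)]).
  apply/seteqP; split=> t /=; first by rewrite /E /= => Wt j _ /=; rewrite Wt.
  move=> h; apply/matrixP => a b; have [/= h1 h2] := h (a, b) Logic.I.
  by apply/eqP; rewrite eq_complex; apply/andP; split; apply/eqP.
apply: fin_bigcap_measurable => // -[a b] _ /=.
have [[mr mi] _] := mW a b.
apply: measurableI.
  by rewrite -[X in measurable X]setTI; exact: (mr measurableT [set _]).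
by rewrite -[X in measurable X]setTI; exact: (mi measurableT [set _]).
Qed.

Let PE i : P (E i) = ((((2 ^ N * N`!)%N%:R : R)^-1)%:E).
Proof. by have [_ ->] := W_unif; [|exact: signed_perm_spm]. Qed.

Let integrable_bnd (f : T -> R) (K : R) : measurable_fun setT f ->
  (forall t, `|f t| <= K) -> P.-integrable setT (EFin \o f).
Proof. by move=> mf fK; apply: integrable_part => //; exists K; exact: aeW. Qed.

Let step_sum (r : seq I) (c : I -> R) : exists K,
  measurable_fun setT (fun t => \sum_(i <- r) c i * \1_(E i) t) /\
  (forall t, `|\sum_(i <- r) c i * \1_(E i) t| <= K).
Proof.
elim: r => [|i r [K [mr rK]]].
  exists 0; split=> [|t]; last by rewrite big_nil normr0.
  by under eq_fun do rewrite big_nil; exact: measurable_cst.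
exists (`|c i| + K); split=> [|t].
  under eq_fun do rewrite big_cons.
  by apply: measurable_funD => //; apply: measurable_funM => //; exact: measurable_indic.
rewrite big_cons (le_trans (ler_normD _ _))// lerD// normrM ler_piMr//.
by rewrite indicE; case: (_ \in _); rewrite ?normr1 ?normr0.
Qed.

Let integral_step (r : seq I) (c : I -> R) :
  \int[P]_t (\sum_(i <- r) c i * \1_(E i) t) =
  (2 ^ N * N`!)%N%:R^-1 * \sum_(i <- r) c i.
Proof.
elim: r => [|i r IH].
  rewrite big_nil mulr0; under eq_Rintegral do rewrite big_nil.
  by rewrite Rintegral_cst// mul0r.
have [K [mr rK]] := step_sum r c.
have i1 : P.-integrable setT (EFin \o \1_(E i)).
  apply: (@integrable_bnd _ 1); first exact: measurable_indic.
  by move=> t; rewrite indicE; case: (_ \in _); rewrite ?normr1 ?normr0.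
under eq_Rintegral do rewrite big_cons.
rewrite RintegralD//; last 2 first.
- apply: (@integrable_bnd _ `|c i|).
    by apply: measurable_funM => //; exact: measurable_indic.
  move=> t; rewrite normrM ler_piMr//.
  by rewrite indicE; case: (_ \in _); rewrite ?normr1 ?normr0.
- exact: (integrable_bnd mr rK).
rewrite IH big_cons mulrDr; congr (_ + _).
rewrite RintegralZl// mulrC; congr (_ * _).
by rewrite /Rintegral integral_indic// setIT; exact: (congr1 fine (PE i)).
Qed.

(** Almost everywhere [f] is a step function over the events that fix the value of [W]; these are
    disjoint because [spm] is injective. *)
Lemma Rintegral_uniform (f : T -> R) (g : 'M[C]_N -> R) : measurable_fun setT f ->
  (forall t, f t = g (W t)) ->
  \int[P]_t f t = (2 ^ N * N`!)%N%:R^-1 * \sum_(t : 'S_N) \sum_(e : {ffun 'I_N -> bool})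
    g (spm e t).
Proof.
move=> mf fg; rewrite pair_big /= -(integral_step _ (fun i : I => g (spm i.2 i.1))).
rewrite /Rintegral; congr fine; apply: ae_eq_integral => //.
- exact/measurable_EFinP.
- apply/measurable_EFinP.
  by have [K []] := step_sum (index_enum _) (fun i : I => g (spm i.2 i.1)).
- have [ae _] := W_unif; apply: filterS ae => t /signed_perm_exists[i Wi] _.
  congr EFin; rewrite (bigD1 i)//= big1 ?addr0 => [|j ji].
    by rewrite indicE mem_set// mulr1 fg Wi.
  rewrite indicE memNset ?mulr0// /E /= => Wj; move/eqP: ji; apply.
  by apply: spm_inj; rewrite -Wj -Wi.
Qed.

Lemma rmx_state_uniform (Z : rmx P n) (F : 'M[C]_N -> 'M[C]_N) :
  (forall t, Z t = F (W t)) ->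
  rmx_state Z = (2 ^ N * N`!)%N%:R^-1 * \sum_(t : 'S_N) \sum_(e : {ffun 'I_N -> bool})
    (N%:R^-1 * \tr (F (spm e t))).
Proof.
move=> ZF; have /asboolP mZ := valP Z.
have [mRe mIm] : cmeasurable (fun t => \tr (Z t)).
  by apply: cmeasurable_sum => i; have [] := mZ i i.
rewrite /rmx_state /cexpect.
rewrite (Rintegral_uniform (g := fun w => complex.Re (\tr (F w))))//; last first.
  by move=> t; rewrite ZF.
rewrite (Rintegral_uniform (g := fun w => complex.Im (\tr (F w))))//; last first.
  by move=> t; rewrite ZF.
under [in RHS]eq_bigr do rewrite -mulr_sumr.
rewrite -mulr_sumr mulrCA; congr (_ * _).
rewrite -(rmorph_nat (real_complex R)) -fmorphV.
set K := _^-1.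
have -> : \sum_t \sum_e \tr (F (spm e t)) =
   (\sum_t \sum_e complex.Re (\tr (F (spm e t)))) +i*
   (\sum_t \sum_e complex.Im (\tr (F (spm e t)))).
  apply/eqP; rewrite eq_complex /= !raddf_sum; apply/andP; split; apply/eqP;
    by apply: eq_bigr => t _; rewrite raddf_sum.
by rewrite /= /GRing.mul /=; congr (_ +i* _); rewrite mul0r ?subr0 ?addr0.
Qed.
End UniformExpectation.

(** * Square roots *)
Section SquareRootMoments.
Variable R : realType.

(* On [0, 1] the values at [y ^+ 2] increase to [y], uniformly. *)
Fixpoint sqrt_poly (j : nat) : {poly R} :=
  if j is j'.+1 then sqrt_poly j' + 2^-1 *: ('X - sqrt_poly j' ^+ 2) else 0.

(** The rate [y - p <= 2 * y / (2 + j * y)], multiplied out, is strong enough for induction: one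
    step multiplies the error by [1 - (y + p) / 2]. *)
Lemma sqrt_poly_bound j (y : R) : 0 <= y <= 1 ->
  0 <= (sqrt_poly j).[y ^+ 2] <= y /\ (y - (sqrt_poly j).[y ^+ 2]) * (2 + j%:R * y) <= 2 * y.
Proof.
move=> /andP[y0 y1]; elim: j => [|j [/andP[p0 py] IH]] /=.
  by rewrite horner0 lexx y0 subr0 mul0r addr0 mulrC.
rewrite !hornerE; move: p0 py IH; set p := (sqrt_poly j).[_] => p0 py IH.
have h1 : y - (p + 2^-1 * (y ^+ 2 - p ^+ 2)) = (y - p) * (1 - (y + p) / 2) by field.
have yp0 : 0 <= y - p by rewrite subr_ge0.
have f0 : 0 <= 1 - (y + p) / 2 by lra.
split.
  apply/andP; split; last by rewrite -subr_ge0 h1 mulr_ge0.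
  apply: addr_ge0 => //; rewrite mulr_ge0// subr_ge0 lerXn2r ?nnegrE//.
have -> : 2 + j.+1%:R * y = 2 + j%:R * y + y by rewrite -natr1; ring.
rewrite h1; apply: le_trans IH; rewrite -mulrA ler_wpM2l//.
have j0 : 0 <= j%:R :> R by [].
move: (j%:R) j0 => x x0.
have : 0 <= x * y by rewrite mulr_ge0.
have : 0 <= x * y * y by rewrite !mulr_ge0.
have : 0 <= y * p by rewrite mulr_ge0.
have : 0 <= x * y * p by rewrite !mulr_ge0.
have : 0 <= y * y by rewrite mulr_ge0.
nra.
Qed.

Lemma sqrt_poly_cvg j (y : R) : 0 <= y <= 1 ->
  `|y - (sqrt_poly j.+1).[y ^+ 2]| <= 2 / j.+1%:R.
Proof.
move=> y01; have [/andP[p0 py] h] := sqrt_poly_bound j.+1 y01.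
move: y01 => /andP[y0 y1]; rewrite ger0_norm ?subr_ge0// ler_pdivlMr ?ltr0n//.
move: py h; set e := y - _; rewrite -subr_ge0 -/e => e0 h.
have [y_0|yn0] := eqVneq y 0.
  have ey : e <= y by rewrite /e gerBl.
  have -> : e = 0 by apply/eqP; rewrite eq_le e0 andbT -y_0.
  by rewrite mul0r.
have ygt : 0 < y by rewrite lt0r yn0.
rewrite -(ler_pM2r ygt); nra.
Qed.

Lemma cvg_approx (s : nat -> R) :
  (forall e : R, 0 < e -> exists c : nat -> R, cvgn c /\ forall n, `|s n - c n| <= e) ->
  cvgn s.
Proof.
move=> sc; apply/cauchy_cvgP/cauchy_exP => e e0.
have e3 : 0 < e / 4 by rewrite divr_gt0.
have [c [/cvg_ex[/= l cl] sce]] := sc _ e3.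
exists l; have /cvgrPdist_lt/(_ _ e3)[N _ NP] := cl.
exists N => // n /= Nn; rewrite /ball /=.
have := NP n Nn; have := sce n; rewrite distrC => h1 h2.
have -> : l - s n = (l - c n) + (c n - s n) by ring.
apply: le_lt_trans (ler_normD _ _) _.
have : e / 4 < e by lra.
lra.
Qed.

Variable x : forall n, 'I_n.+1 -> R.
Local Notation mean f n := (n.+1%:R^-1 * \sum_(i < n.+1) f (x i)).

Lemma cvg_mean_poly (p : {poly R}) : (forall k, cvgn (fun n => mean (fun t => t ^+ k) n)) ->
  cvgn (fun n => mean (fun t => p.[t]) n).
Proof.
move=> mc; have -> : (fun n => mean (fun t => p.[t]) n) =
    (fun n => \sum_(k < size p) p`_k * mean (fun t => t ^+ k) n).
  apply/funext => n; under eq_bigr do rewrite horner_coef.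
  rewrite exchange_big mulr_sumr; apply: eq_bigr => k _ /=.
  by rewrite mulrCA; congr (_ * _); rewrite mulr_sumr.
elim: (size p) => [|m IH].
  by under eq_fun do rewrite big_ord0; exact: is_cvg_cst.
under eq_fun do rewrite big_ord_recr /=.
by apply: is_cvgD => //; apply: is_cvgM; [exact: is_cvg_cst|exact: mc].
Qed.

(** Rescaled to [[0, c ^+ 2]], the polynomials approximate the root uniformly, hence the means
    uniformly in [n], and means of polynomials converge. *)
Lemma cvg_mean_sqrt (c : R) k : 0 < c -> (forall n i, 0 <= @x n i <= c ^+ 2) ->
  (forall k, cvgn (fun n => mean (fun t => t ^+ k) n)) ->
  cvgn (fun n => mean (fun t => Num.sqrt t ^+ k) n).
Proof.
move=> c0 xc mc; apply: cvg_approx => e e0.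
(* [B] only has to dominate 1 and [c]; [K] is a Lipschitz constant of the [k]-th power on [[-B, B]]
   times the scale [c], and [j] is chosen to make [2 * K / j.+1 <= e]. *)
pose B := 1 + 3 * c.
pose K := k%:R * B ^+ k * c.
have B1 : 1 <= B by rewrite lerDl mulr_ge0// ltW.
have K0 : 0 <= K by rewrite !mulr_ge0 ?exprn_ge0 ?(le_trans ler01 B1)// ltW.
pose j := Num.truncn (2 * K / e).
pose p : {poly R} := (c *: (sqrt_poly j.+1 \Po (c ^- 2 *: 'X))) ^+ k.
exists (fun n => mean (fun t => p.[t]) n); split; first exact: cvg_mean_poly.
move=> n; rewrite -mulrBr -sumrB normrM normfV normr_nat.
rewrite ler_pdivrMl ?ltr0n//; apply: le_trans (ler_norm_sum _ _ _) _.
apply: (@le_trans _ _ (\sum_(i < n.+1) e)); last by rewrite sumr_const card_ord mulr_natl.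
apply: ler_sum => i _; have /andP[xi0 xic] := xc n i.
pose y := Num.sqrt (x i) / c.
have sx : Num.sqrt (x i) = c * y by rewrite /y mulrC divfK ?gt_eqF.
have y01 : 0 <= y <= 1.
  apply/andP; split; first by rewrite /y divr_ge0 ?sqrtr_ge0// ltW.
  rewrite /y ler_pdivrMr// mul1r -(ger0_norm (ltW c0)) -sqrtr_sqr.
  exact: ler_wsqrtr.
have xy : c ^- 2 * x i = y ^+ 2.
  by rewrite /y expr_div_n sqr_sqrtr// mulrC.
have -> : p.[x i] = (c * (sqrt_poly j.+1).[y ^+ 2]) ^+ k.
  by rewrite /p horner_exp hornerZ horner_comp hornerZ hornerX xy.
have [/andP[p0 py] _] := sqrt_poly_bound j.+1 y01.
have /andP[y0 y1] := y01.
have cB z : 0 <= z -> z <= 1 -> `|c * z| <= B.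
  move=> z0 z1; rewrite ger0_norm; last by rewrite mulr_ge0// ltW.
  apply: (@le_trans _ _ c); first by rewrite ler_piMr// ltW.
  by rewrite /B; lra.
have cy := cB y y0 y1.
have cp := cB _ p0 (le_trans py y1).
rewrite sx; apply: le_trans (expr_lipschitz k B1 cy cp) _.
rewrite -mulrBr normrM (gtr0_norm c0) mulrA -/K.
apply: le_trans (ler_wpM2l K0 (sqrt_poly_cvg j y01)) _.
rewrite mulrA ler_pdivrMr ?ltr0n// -ler_pdivrMl// mulrC [K * 2]mulrC.
exact/ltW/truncnS_gt.
Qed.
End SquareRootMoments.

(** * The random matrix model and its limit *)
Section RandomMatrixEvaluation.
Variables (d : measure_display) (T : measurableType d) (R : realType).
Variables (P : probability T R) (n : nat).
Implicit Types X Y : rmx P n.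

Lemma rmx_evalM X Y t : (X * Y) t = X t * Y t. Proof. by []. Qed.
Lemma rmx_eval1 t : (1 : rmx P n) t = 1. Proof. by []. Qed.
Lemma rmx_evalL (c : R[i]) X Y t : (c *: X + Y) t = c *: X t + Y t. Proof. by []. Qed.
Lemma rmx_evalD X Y t : (X + Y) t = X t + Y t. Proof. by []. Qed.

Lemma rmx_evalX X k t : (X ^+ k) t = X t ^+ k.
Proof. by elim: k => [|k IH]; rewrite ?expr0 ?rmx_eval1// !exprS rmx_evalM IH. Qed.

Lemma rmx_eval_horner X p t : (horner_alg X p) t = horner_alg (X t) p.
Proof.
rewrite !horner_alg_sum; elim/big_ind2: _ => //.
  by move=> x1 x2 y1 y2 <- <-.
by move=> k _; rewrite -rmx_evalX -[_ *: _]addr0 rmx_evalL addr0.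
Qed.

Lemma rmx_eval_prod (J : Type) (r : seq J) (F : J -> rmx P n) t :
  (\prod_(j <- r) F j) t = \prod_(j <- r) F j t.
Proof. by elim: r => [|j r IH]; rewrite ?big_nil// !big_cons rmx_evalM IH. Qed.

Lemma rmx_state_ge0 X : (forall t, 0 <= \tr (X t)) -> 0 <= rmx_state X.
Proof.
move=> X0; rewrite /rmx_state mulr_ge0// ?invr_ge0//.
rewrite /cexpect lecE /= (@eq_Rintegral _ _ _ P _ (fun=> 0)); last first.
  by move=> t _; move: (X0 t); rewrite lecE /= => /andP[/eqP ->].
rewrite Rintegral_cst// mul0r eqxx /=; apply: Rintegral_ge0 => t _.
by move: (X0 t); rewrite lecE /= => /andP[].
Qed.
End RandomMatrixEvaluation.

Section HadamardModel.
Variables (R : realType) (d : nat -> measure_display) (T : forall n, measurableType (d n)).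
Variables (P : forall n, probability (T n) R).
Variables (W : forall n, rmx (P n) n) (H : forall n, 'M[R[i]]_n.+1).
Variables (U : forall n, rmx (P n) n) (A B : forall n, 'M[R[i]]_n.+1).
Local Notation C := R[i].
Hypothesis W_unif : forall n, uniform_signed_perm (W n).
Hypothesis H_had : forall n, complex_hadamard (H n).
Hypothesis UE : forall n, U n = (sqrtC n.+1%:R)^-1 *:
                     (rmx_adj (W n) * rmx_cst (P n) (H n) * W n).

Definition had_h n : 'M[C]_n.+1 := (sqrtC n.+1%:R)^-1 *: H n.

Lemma had_h_unitary n : had_h n \is unitarymx.
Proof. by have [] := H_had n. Qed.

Lemma sqrtC_natE n : sqrtC (n.+1%:R : C) = (Num.sqrt n.+1%:R)%:C.
Proof.
rewrite -[LHS]/(sqrtC _) (_ : n.+1%:R = (Num.sqrt n.+1%:R)%:C ^+ 2 :> C).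
  by rewrite sqrCK// ler0c sqrtr_ge0.
by rewrite -rmorphXn /= sqr_sqrtr// rmorph_nat.
Qed.

Lemma had_h_entry n i j : `|had_h n i j| = ((Num.sqrt n.+1%:R)^-1)%:C.
Proof.
have [_ H1] := H_had n; rewrite mxE normrM H1 mulr1 sqrtC_natE -fmorphV.
by rewrite ger0_norm// ler0c invr_ge0 sqrtr_ge0.
Qed.

Definition model n (i : bool) : rmx_ncps (P n) n :=
  if i then U n * rmx_cst (P n) (B n) * rmx_adj (U n) else rmx_cst (P n) (A n).

Definition model_mx n (i : bool) : 'M[C]_n.+1 := if i then B n else A n.

(** The model as a function of the value [w] taken by the random matrix, the form in which
    expectations become finite averages. *)
Definition model_at n (w : 'M[C]_n.+1) (i : bool) : 'M[C]_n.+1 :=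
  let u := (sqrtC n.+1%:R)^-1 *: (w^t* *m H n *m w) in
  if i then u *m B n *m u^t* else A n.

Lemma modelE n i t : (model n i : rmx (P n) n) t = model_at (W n t) i.
Proof.
rewrite /model /model_at; case: i => //.
have -> : (sqrtC n.+1%:R)^-1 *: ((W n t)^t* *m H n *m W n t) = U n t.
  by rewrite UE.
by [].
Qed.

Lemma model_at_spm n (e : {ffun 'I_n.+1 -> bool}) (t : 'S_n.+1) i :
  model_at (spm C e t) i = letter_mx (had_h n) (spm C e t) (i, model_mx n i).
Proof.
rewrite /model_at /letter_mx /model_mx /=; case: i => //.
have -> : (sqrtC n.+1%:R)^-1 *: ((spm C e t)^t* *m H n *m spm C e t) =
    had_conj (had_h n) (spm C e t).
  by rewrite /had_conj /had_h spm_adj -scalemxAr -scalemxAl.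
by [].
Qed.

Lemma horner_letter n (e : {ffun 'I_n.+1 -> bool}) (t : 'S_n.+1) i X p :
  horner_alg (letter_mx (had_h n) (spm C e t) (i, X)) p =
  letter_mx (had_h n) (spm C e t) (i, horner_alg X p).
Proof.
rewrite /letter_mx /=; case: i => //.
have := had_conj_unitary (had_h_unitary n) e t; move: (had_conj _ _) => u /unitarymxP uu'.
have uu : u^t* *m u = 1%:M by exact: mulmx1C.
elim/poly_ind: p => [|p c IH]; first by rewrite !rmorph0 mulmx0 mul0mx.
rewrite !rmorphD !rmorphM /= !horner_algX !horner_algC IH -!mulmxE.
rewrite mulmxDr mulmxDl; congr (_ + _).
  by rewrite !mulmxA -[_ *m u^t* *m u]mulmxA uu mulmx1.
by rewrite -scalemxAr -scalemxAl mulmx1 uu'.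
Qed.

Definition word_letters (w : seq (bool * {poly C})) : seq (bool * (forall n, 'M[C]_n.+1)) :=
  map (fun p => (p.1, fun n => horner_alg (model_mx n p.1) p.2)) w.

Lemma word_state_model w n : word_state model n w = avg_seq had_h (word_letters w) n.
Proof.
rewrite /word_state.
rewrite [LHS](@rmx_state_uniform _ _ _ _ _ (W n) (W_unif n) _
  (fun x => \prod_(p <- w) horner_alg (model_at x p.1) p.2)); last first.
  move=> t; rewrite rmx_eval_prod; apply: eq_bigr => p _.
  by rewrite rmx_eval_horner modelE.
congr (_ * _); apply: eq_bigr => t _; apply: eq_bigr => e _.
rewrite /word_mx /letters_at !big_map; congr (_ * \tr _); apply: eq_bigr => p _.
by rewrite model_at_spm horner_letter.
Qed.

(** Conjugation by a unitary keeps the trace of a single letter; this translates centered letters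
    into vanishing normalized traces. *)
Lemma avg_seq1 (X : forall n, 'M[C]_n.+1) i n : avg_seq had_h [:: (i, X)] n = ntrace X n.
Proof.
rewrite /avg_seq /avg_word.
have G0 : (2 ^ n.+1 * n.+1`!)%N%:R != 0 :> C.
  by rewrite pnatr_eq0 muln_eq0 negb_or expn_eq0 /= -lt0n fact_gt0.
under eq_bigr => t _.
  under eq_bigr => e _.
    rewrite /word_mx /= big_seq1 (_ : \tr _ = \tr (X n)); last first.
      rewrite /letter_mx /=; case: i => //.
      rewrite mxtrace_mulC mulmxA.
      rewrite (mulmx1C (_ : had_conj _ _ *m (had_conj _ _)^t* = 1%:M)) ?mul1mx//.
      by apply/unitarymxP; exact: had_conj_unitary (had_h_unitary n) e t.
    over.
  over.
rewrite !sumr_const card_ffun card_bool card_ord -mulrnA.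
rewrite -card_Sn in G0 *.
by rewrite -[X in _ * X]mulr_natl mulrA mulVf// mul1r.
Qed.

Lemma unif_bounded_horner (X : forall n, 'M[C]_n.+1) p : unif_bounded X ->
  unif_bounded (fun n => horner_alg (X n) p).
Proof.
move=> [k [k0 kX]]; elim/poly_ind: p => [|p c [l [l0 IH]]].
  exists 0; split=> // n; rewrite rmorph0 -(raddf0 (@scalar_mx C n.+1)).
  by apply: opbound_scalar; rewrite normr0.
have [m m0 cm] : exists2 m : R, 0 <= m & `|c| <= m%:C.
  exists (complex.Re `|c|); last by rewrite RRe_real ?normr_real.
  by have := normr_ge0 c; rewrite lecE => /andP[].
exists (2 * (l * k + m)); split; first by rewrite mulr_ge0 ?addr_ge0 ?mulr_ge0.
move=> n; rewrite rmorphD rmorphM /= horner_algX horner_algC.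
apply: opboundD; rewrite ?mulr_ge0//; first by apply: opboundM => //; exact: IH.
rewrite -[1]/(1%:M) scalemx1; exact: opbound_scalar.
Qed.

Hypothesis A_bounded : unif_bounded A.
Hypothesis B_bounded : unif_bounded B.
Hypothesis A_moments : forall k, exists l, ccvg (ntrace (fun n => A n ^+ k)) l.
Hypothesis B_moments : forall k, exists l, ccvg (ntrace (fun n => B n ^+ k)) l.

Lemma model_moment n i k :
  nc_state (rmx_ncps (P n) n) (model n i ^+ k) = ntrace (fun n => model_mx n i ^+ k) n.
Proof.
rewrite -(avg_seq1 _ i).
have := word_state_model [:: (i, 'X^k)] n.
rewrite /word_state big_seq1 /= rmorphXn /= horner_algX => ->.
by rewrite /avg_seq /letters_at /= rmorphXn /= horner_algX.
Qed.

Lemma model_asymptotically_free : asymptotically_free model.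
Proof.
apply: asymptotically_free_of_alternating => [i k|w w0 walt wc].
  have [l lP] : exists l, ccvg (ntrace (fun n => model_mx n i ^+ k)) l.
    by rewrite /model_mx; case: i; [exact: B_moments|exact: A_moments].
  by exists l; apply: eq_ccvg lP _ => n; rewrite model_moment.
have := @avg_seq_cvg0 R had_h had_h_unitary had_h_entry (word_letters w).
move=> cv; apply: eq_ccvg (cv _ _ _) _ => {cv}.
- by case: (w) w0.
- rewrite /alternating_seq -map_comp sorted_map.
  exact: walt.
- elim: w wc {w0 walt} => //= p w IH wc; split; last first.
    by apply: IH => r rw; apply: wc; rewrite inE rw orbT.
  split.
    by apply: unif_bounded_horner; rewrite /model_mx; case: (p.1).
  have := wc p (mem_head _ _); rewrite /centered => /eq_ccvg; apply => n.
  have := word_state_model [:: p] n; rewrite /word_state big_seq1 => ->.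
  by rewrite -(avg_seq1 _ p.1).
- by move=> n; rewrite word_state_model.
Qed.
End HadamardModel.

(** * Positivity and laws in the limit *)

Section MoreComplexLimits.
Variable R : realType.

Lemma normc_ge_Im (z : R[i]) : `|complex.Im z|%:C <= `|z|.
Proof.
rewrite normc_def lecR -sqrtr_sqr ler_wsqrtr// lerDr; exact: sqr_ge0.
Qed.

Lemma ccvg_real_lim (x : nat -> R) (l : R[i]) : ccvg (fun n => (x n)%:C) l ->
  l = (complex.Re l)%:C /\ x @ \oo --> complex.Re l.
Proof.
move=> xl.
have lE : l = (complex.Re l)%:C.
  apply/eqP; rewrite eq_complex eqxx /=; apply/eqP/eqP.
  rewrite -normr_le0; apply/ler_addgt0Pr => e e0; rewrite add0r.
  have [N /(_ N (leqnn N))] := (ccvgP _ _).1 xl e e0.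
  move=> /(le_lt_trans (normc_ge_Im _)); rewrite ltcR.
  by case: (l) => a b /=; rewrite sub0r normrN => /ltW.
by split=> //; apply/ccvg_real; rewrite -lE.
Qed.

Lemma ccvg_ge0 (u : nat -> R[i]) l : ccvg u l -> (forall n, 0 <= u n) -> 0 <= l.
Proof.
move=> ul u0.
have uE n : u n = (complex.Re (u n))%:C by rewrite RRe_real// ger0_real.
have [->] := ccvg_real_lim (eq_ccvg ul uE).
rewrite ler0c => /cvgr_to_ge; apply; apply: nearW => n.
by rewrite -ler0c -uE.
Qed.
End MoreComplexLimits.

Section Hermitian.
Variables (R : realType) (n : nat).
Implicit Types X Y : 'M[R[i]]_n.+1.

Lemma hermsymmxE X : (X \is hermsymmx) = (X^t* == X).
Proof.
apply/idP/eqP => [/herm_adj//|e]; apply/is_hermitianmxP.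
by rewrite expr0 scale1r e.
Qed.

Lemma adjM X Y : (X *m Y)^t* = Y^t* *m X^t*.
Proof. by rewrite trmx_mul map_mxM. Qed.

Lemma adj_semilinear (c : R[i]) X Y : (c *: X + Y)^t* = c^* *: X^t* + Y^t*.
Proof. by rewrite linearP map_mxD map_mxZ. Qed.

Lemma hermsymmxD X Y : X \is hermsymmx -> Y \is hermsymmx -> X + Y \is hermsymmx.
Proof.
rewrite !hermsymmxE => /eqP hX /eqP hY.
by rewrite -[X]scale1r adj_semilinear rmorph1 hX hY.
Qed.

Lemma hermsymmx_conj X Y : X \is hermsymmx -> Y *m X *m Y^t* \is hermsymmx.
Proof. by rewrite !hermsymmxE => /eqP hX; rewrite !adjM trmxCK hX mulmxA. Qed.

Lemma tr_adj_mul_ge0 X : 0 <= \tr (X^t* *m X).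
Proof.
apply: sumr_ge0 => i _; rewrite mxE; apply: sumr_ge0 => j _.
by rewrite !mxE mulrC mul_conjC_ge0.
Qed.
End Hermitian.

Section HadamardLimit.
Variables (R : realType) (d : nat -> measure_display) (T : forall n, measurableType (d n)).
Variables (P : forall n, probability (T n) R).
Variables (W : forall n, rmx (P n) n) (H : forall n, 'M[R[i]]_n.+1).
Variables (U : forall n, rmx (P n) n) (A B : forall n, 'M[R[i]]_n.+1).
Local Notation C := R[i].
Hypothesis W_unif : forall n, uniform_signed_perm (W n).

(** The state of [Z n ^+ k] is the mean of the [k]-th powers over one finite sample, the eigenvalues
    of all the values of [Z n], so that [limit_law] applies. *)
Lemma law_of_limit (Z : forall n, rmx (P n) n) (F : forall n, 'M[C]_n.+1 -> 'M[C]_n.+1)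
    (lo hi : R) (m : nat -> C) :
  (forall n t, Z n t = F n (W n t)) ->
  (forall n e t, F n (spm C e t) \is hermsymmx) ->
  (forall n e t i, lo <= complex.Re (spectral_diag (F n (spm C e t)) 0 i) <= hi) ->
  (forall k, ccvg (fun n => rmx_state (Z n ^+ k)) (m k)) ->
  exists rho : probability R R, rho [set` `[lo, hi]] = 1%E /\
    forall k, m k = (moment rho k)%:C.
Proof.
move=> ZF Fh Fb Zm.
pose J n := (('S_n.+1 * {ffun 'I_n.+1 -> bool}) * 'I_n.+1)%type.
pose ev n (j : J n) := complex.Re (spectral_diag (F n (spm C j.1.2 j.1.1)) 0 j.2).
pose s n := [seq ev n j | j <- enum {: J n}].
have ss n : size (s n) = (2 ^ n.+1 * n.+1`! * n.+1)%N.
  rewrite size_map -cardE !card_prod card_ffun card_bool !card_ord.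
  by rewrite -card_Sn [(_ * 2 ^ _)%N]mulnC.
have evE n (j : J n) : (ev n j)%:C = spectral_diag (F n (spm C j.1.2 j.1.1)) 0 j.2.
  apply: RRe_real; have /mxOverP := hermitian_spectral_diag_real (Fh n j.1.2 j.1.1).
  exact.
have stE n k : rmx_state (Z n ^+ k) = ((\sum_(x <- s n) x ^+ k) / (size (s n))%:R)%:C.
  rewrite (rmx_state_uniform (W_unif n) (F := fun w => F n w ^+ k)); last first.
    by move=> t; rewrite rmx_evalX ZF.
  have sumE : (\sum_(x <- s n) x ^+ k)%:C =
      \sum_(t : 'S_n.+1) \sum_(e : {ffun 'I_n.+1 -> bool}) \tr (F n (spm C e t) ^+ k).
    rewrite big_map big_enum /= rmorph_sum pair_big /=.
    transitivity (\sum_(p : 'S_n.+1 * {ffun 'I_n.+1 -> bool}) \sum_(i < n.+1)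
        spectral_diag (F n (spm C p.2 p.1)) 0 i ^+ k); last first.
      by apply: eq_bigr => p _; rewrite tr_herm_pow.
    rewrite pair_big /=; apply: eq_bigr => j _.
    by rewrite -evE rmorphXn.
  have divE (a b : R) : (a / b)%:C = a%:C / b%:C :> C by exact: (fmorph_div (real_complex R)).
  rewrite ss divE sumE rmorph_nat [in RHS]natrM [in RHS]invfM.
  under eq_bigr do rewrite -mulr_sumr.
  by rewrite -mulr_sumr mulrA mulrC.
have sm k : (fun n => (\sum_(x <- s n) x ^+ k) / (size (s n))%:R) @ \oo --> complex.Re (m k).
  have mk : ccvg (fun n => ((\sum_(x <- s n) x ^+ k) / (size (s n))%:R)%:C) (m k).
    by apply: eq_ccvg (Zm k) _ => n; rewrite stE.
  by have [] := ccvg_real_lim mk.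
have [||rho [rho1 rhom]] := limit_law (lo := lo) (hi := hi) _ _ sm.
- by move=> n; rewrite ss !muln_gt0 expn_gt0 fact_gt0.
- by move=> n x /mapP[j _ ->]; exact: Fb.
exists rho; split=> // k; rewrite rhom.
have mk : ccvg (fun n => ((\sum_(x <- s n) x ^+ k) / (size (s n))%:R)%:C) (m k).
  by apply: eq_ccvg (Zm k) _ => n; rewrite stE.
by have [] := ccvg_real_lim mk.
Qed.

Hypothesis H_had : forall n, complex_hadamard (H n).
Hypothesis UE : forall n, U n = (sqrtC n.+1%:R)^-1 *:
                     (rmx_adj (W n) * rmx_cst (P n) (H n) * W n).
Hypothesis A_herm : forall n, A n \is hermsymmx.
Hypothesis B_herm : forall n, B n \is hermsymmx.

Lemma model_at_herm n w i : model_at H A B (n := n) w i \is hermsymmx.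
Proof. by rewrite /model_at; case: i => //; exact: hermsymmx_conj. Qed.

(** Evaluation at the point [t] is a homomorphism into matrices that sends the variables to
    hermitian ones. *)
Lemma nceval_model_adj n t f :
  (nceval (model U A B n) (ncstar f) : rmx (P n) n) t =
  ((nceval (model U A B n) f : rmx (P n) n) t)^t*.
Proof.
pose ev (Z : rmx (P n) n) := Z t.
have evE g : ev (nceval (model U A B n) g) =
    nceval (fun i => model_at H A B (W n t) i) g.
  rewrite (nceval_morph (h := ev)) //; congr (nceval _ g).
  by apply/funext => i /=; rewrite /ev (modelE A B UE).
rewrite -[LHS]/(ev _) -[_ _ t]/(ev (nceval (model U A B n) f)) !evE.
apply: (nceval_ncstar (st := fun M : 'M[C]_n.+1 => M^t*)).
- exact: adj_semilinear.
- exact: adjM.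
- by rewrite -[1]/(1%:M) trmx1 map_mx1.
- by move=> i; apply/eqP; rewrite -hermsymmxE model_at_herm.
Qed.

Section Limit.
Variables (tau : {scalar ncpoly R bool}) (tau1 : tau 1 = 1).
Hypothesis tauP : forall f, ccvg (fun n => joint_law (model U A B n) f) (tau f).

Lemma tau_ge0 f : 0 <= tau (ncstar f * f).
Proof.
have c := @tauP (ncstar f * f).
apply: (ccvg_ge0 c) => n; rewrite /joint_law ncevalM; apply: rmx_state_ge0 => t.
by rewrite rmx_evalM nceval_model_adj; exact: tr_adj_mul_ge0.
Qed.

Definition limit_space : star_ncps R :=
  @StarNCPS R (NCPS tau1) (@ncstar R bool) (@ncstarK R bool)
    (@ncstar_semilinear R bool) (@ncstarM R bool) tau_ge0.

Lemma tau_pow f (Z : forall n, rmx (P n) n) k :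
  (forall n, nceval (model U A B n) f = Z n) ->
  ccvg (fun n => rmx_state (Z n ^+ k)) (tau (f ^+ k)).
Proof.
move=> fZ; apply: eq_ccvg (@tauP (f ^+ k)) _ => n; rewrite /joint_law.
have -> : nceval (model U A B n) (f ^+ k) = nceval (model U A B n) f ^+ k.
  by elim: k => [|k IH]; rewrite ?expr0 ?nceval1// !exprS ncevalM IH.
by rewrite fZ.
Qed.
End Limit.
End HadamardLimit.
Arguments tau_pow {R d T P U A B tau} tauP {f Z} k fZ _ _.

Section LawHelpers.
Variable R : realType.

Lemma distribution_compact d (T : measurableType d) (P : probability T R)
    (X : {RV P >-> R}) : (exists M : R, {ae P, forall t, `|X t| <= M}) ->
  compactly_supported (distribution P X).
Proof.
move=> [M XM]; exists M.
pose E := X @^-1` `[- M, M]%classic; rewrite -[LHS]/(P E).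
have mE : measurable E by rewrite -[E]setTI; exact: measurable_funP.
have nE : P.-negligible (~` E).
  apply: negligibleS XM => t /= nEt XMt; apply: nEt.
  by rewrite /E /= in_itv /= -ler_norml.
have : P (~` E) = 0%E by apply: measure_negligible => //; exact: measurableC.
rewrite probability_setC// => h.
have := fin_num_measure P E mE; case: (P E) h => // r /eqP.
by rewrite -EFinB eqe subr_eq0 => /eqP <-.
Qed.

Lemma compact_of_itv (rho : probability R R) (lo hi : R) :
  rho [set` `[lo, hi]] = 1%E ->
  compactly_supported rho /\ (0 <= lo -> rho `[0, +oo[%classic = 1%E).
Proof.
have up (E : set R) : measurable E -> [set` `[lo, hi]] `<=` E ->
    rho [set` `[lo, hi]] = 1%E -> rho E = 1%E.
  move=> mE lE r1; apply/eqP; rewrite eq_le probability_le1//= -r1.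
  by apply: le_measure => //; rewrite inE.
move=> r1; split=> [|lo0].
  exists (Num.max `|lo| `|hi|); apply: up r1 => // x /=; rewrite !in_itv /=.
  move=> /andP[lx xh]; rewrite -ler_norml ler_norml.
  rewrite (le_trans _ lx) ?(le_trans xh)// ?le_max ?ler_norm ?orbT//.
  by rewrite lerNl le_max -normrN ler_norm.
by apply: up r1 => // x /=; rewrite !in_itv /= andbT => /andP[/(le_trans lo0)].
Qed.
End LawHelpers.

Section LimitVariables.
Variables (R : realType) (d : nat -> measure_display) (T : forall n, measurableType (d n)).
Variables (P : forall n, probability (T n) R).
Variables (W : forall n, rmx (P n) n) (H : forall n, 'M[R[i]]_n.+1).
Variables (U : forall n, rmx (P n) n) (A B : forall n, 'M[R[i]]_n.+1).
Local Notation C := R[i].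
Hypothesis W_unif : forall n, uniform_signed_perm (W n).
Hypothesis H_had : forall n, complex_hadamard (H n).
Hypothesis UE : forall n, U n = (sqrtC n.+1%:R)^-1 *:
                     (rmx_adj (W n) * rmx_cst (P n) (H n) * W n).
Hypothesis A_herm : forall n, A n \is hermsymmx.
Hypothesis B_herm : forall n, B n \is hermsymmx.
Variables (kA kB : R) (mA mB : nat -> C).
Hypotheses (kA0 : 0 <= kA) (kB0 : 0 <= kB).
Hypothesis A_bounded : forall n, opbound kA (A n).
Hypothesis B_bounded : forall n, opbound kB (B n).
Hypothesis A_moments : forall k, ccvg (ntrace (fun n => A n ^+ k)) (mA k).
Hypothesis B_moments : forall k, ccvg (ntrace (fun n => B n ^+ k)) (mB k).

Local Notation X i := (ncX R (i : bool)).

(** One measure answers two demands: its moments are those of [z] under [tau], as the free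
    convolution requires, and they are the limits for the matrices. *)
Lemma limit_law_exists (z : ncpoly R bool) (Z : forall n, rmx (P n) n)
    (F : forall n, 'M[C]_n.+1 -> 'M[C]_n.+1) (tau : {scalar ncpoly R bool}) (k : R) :
  (forall f, ccvg (fun n => joint_law (model U A B n) f) (tau f)) ->
  (forall n, nceval (model U A B n) z = Z n) ->
  (forall n t, Z n t = F n (W n t)) -> 0 <= k ->
  (forall n e t, F n (spm C e t) \is hermsymmx) ->
  (forall n e t, opbound k (F n (spm C e t))) ->
  exists rho : probability R R, compactly_supported rho /\
    (forall j, tau (z ^+ j) = (moment rho j)%:C) /\
    forall j, ccvg (fun n => rmx_state (Z n ^+ j)) (moment rho j)%:C.
Proof.
move=> tauP zZ ZF k0 Fh Fk.
have zc j := tau_pow tauP j zZ.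
have [|rho [r1 rm]] := @law_of_limit _ _ _ _ W W_unif Z F (- k) k _ ZF Fh _ zc.
  move=> n e t i; rewrite -ler_norml -lecR.
  have := spectral_diag_bound i (Fh n e t) k0 (Fk n e t); apply: le_trans.
  exact: normc_ge_Re.
exists rho; split; first by have [] := compact_of_itv r1.
split=> j; first exact: rm.
by rewrite -rm; exact: zc.
Qed.

Lemma model_limit : exists (tau : {scalar ncpoly R bool}) (tau1 : tau 1 = 1),
  [/\ forall f, ccvg (fun n => joint_law (model U A B n) f) (tau f),
      free_family (S := NCPS tau1) (@ncX R bool),
      forall k, tau (X false ^+ k) = mA k & forall k, tau (X true ^+ k) = mB k].
Proof.
have [tau [tau1 [tauP tau_free]]] : asymptotically_free (model U A B).
  apply: (model_asymptotically_free W_unif H_had UE).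
  - by exists kA.
  - by exists kB.
  - by move=> k; exists (mA k).
  - by move=> k; exists (mB k).
exists tau, tau1; split=> // k.
- apply: (ccvg_unique _ (@A_moments k)).
  have := tau_pow tauP k (Z := fun n => model U A B n false) (fun n => ncevalX _ _).
  move=> /eq_ccvg; apply=> n; exact: (model_moment A B W_unif H_had UE n false k).
- apply: (ccvg_unique _ (@B_moments k)).
  have := tau_pow tauP k (Z := fun n => model U A B n true) (fun n => ncevalX _ _).
  move=> /eq_ccvg; apply=> n; exact: (model_moment A B W_unif H_had UE n true k).
Qed.
End LimitVariables.

(** * Moments of the square roots of the matrices *)

Section SquareRoot.
Variables (R : realType) (A : forall n, 'M[R[i]]_n.+1) (k : R) (m : nat -> R[i]).
Hypothesis A_psd : forall n, psdmx (A n).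
Hypothesis k1 : 1 <= k.
Hypothesis A_bounded : forall n, opbound k (A n).
Hypothesis A_moments : forall j, ccvg (ntrace (fun n => A n ^+ j)) (m j).

Let A_herm n : A n \is hermsymmx. Proof. by have [] := A_psd n. Qed.

Let x n (i : 'I_n.+1) : R := complex.Re (spectral_diag (A n) 0 i).

Let xE n i : (x (n := n) i)%:C = spectral_diag (A n) 0 i.
Proof. by apply: RRe_real; rewrite ger0_real// spectral_diag_psd. Qed.

Let x_ge0 n i : 0 <= x (n := n) i.
Proof. by rewrite -ler0c xE spectral_diag_psd. Qed.

(* Moments of the square root are approximated uniformly by polynomials in [A]. *)
Lemma sqrtmx_moments j : exists l, ccvg (ntrace (fun n => sqrtmx (A n) ^+ j)) l.
Proof.
have mean_cvg e : cvgn (fun n => n.+1%:R^-1 * \sum_(i < n.+1) x i ^+ e).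
  apply/cvg_ex; exists (complex.Re (m e)).
  have c : ccvg (fun n => (n.+1%:R^-1 * \sum_(i < n.+1) x i ^+ e)%:C) (m e).
    apply: eq_ccvg (@A_moments e) _ => n.
    rewrite /ntrace tr_herm_pow// (rmorphM (real_complex R)) fmorphV rmorph_nat.
    by rewrite rmorph_sum; congr (_ * _); apply: eq_bigr => i _; rewrite rmorphXn /= xE.
  by have [] := ccvg_real_lim c.
have k0 : 0 < k := lt_le_trans ltr01 k1.
have xk n i : 0 <= x (n := n) i <= k ^+ 2.
  rewrite x_ge0 /= -lecR xE -[leLHS]ger0_norm ?spectral_diag_psd//.
  apply: le_trans (spectral_diag_bound i (A_herm n) (ltW k0) (@A_bounded n)) _.
  by rewrite lecR expr2 ler_peMl// ltW.
have /cvg_ex[l /= lP] := @cvg_mean_sqrt R x k j k0 xk mean_cvg.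
exists l%:C; apply: eq_ccvg ((ccvg_real _ _).2 lP) _ => n.
rewrite (rmorphM (real_complex R)) fmorphV rmorph_nat /ntrace sqrtmxE.
rewrite tr_unitary_diag_pow ?spectral_unitarymx// rmorph_sum; congr (_ * _).
apply: eq_bigr => i _; rewrite mxE rmorphXn /=; congr (_ ^+ _).
rewrite -xE -{2}(sqr_sqrtr (x_ge0 i)) rmorphXn /= sqrCK// ler0c.
exact: sqrtr_ge0.
Qed.
End SquareRoot.

Lemma ntrace_moment (R : realType) (A : forall n, 'M[R[i]]_n.+1) d (T : measurableType d)
    (P : probability T R) (a : {RV P >-> R}) :
  (exists M : R, {ae P, forall t, `|a t| <= M}) ->
  (forall k, (0 < k)%N ->
    ccvg (fun n => n.+1%:R^-1 * \tr (A n ^+ k)) (\int[P]_t (a t ^+ k))%:C) ->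
  forall k, ccvg (ntrace (fun n => A n ^+ k)) (moment (distribution P a) k)%:C.
Proof.
move=> [M aM] Am k; rewrite (moment_distribution k aM).
case: k => [|k]; last exact: Am.
have -> : \int[P]_t (a t ^+ 0) = 1.
  under eq_Rintegral do rewrite expr0.
  by rewrite Rintegral_cst// mul1r; exact: (congr1 fine (probability_setT P)).
apply: eq_ccvg (ccvg_cst 1) _ => n.
by rewrite /ntrace expr0 mxtrace1 mulVf ?pnatr_eq0.
Qed.

(* The index n stands for the positive integer N = n.+1. *)
Theorem corollary3p5 (R : realType)
  (d : nat -> measure_display) (T : forall n, measurableType (d n))
  (P : forall n, probability (T n) R)
  (W : forall n, rmx (P n) n) (H : forall n, 'M[R[i]]_n.+1)
  (U : forall n, rmx (P n) n) (A B : forall n, 'M[R[i]]_n.+1)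
  (dA dB : measure_display) (TA : measurableType dA) (TB : measurableType dB)
  (PA : probability TA R) (PB : probability TB R)
  (a : {RV PA >-> R}) (b : {RV PB >-> R}) :
  (forall n, uniform_signed_perm (W n)) ->
  (forall n, complex_hadamard (H n)) ->
  (forall n, U n = (sqrtC n.+1%:R)^-1 *:
                     (rmx_adj (W n) * rmx_cst (P n) (H n) * W n)) ->
  (forall n, A n \is hermsymmx) ->
  (forall n, B n \is hermsymmx) ->
  (exists M : R, forall n, max_singular_value (A n) <= M) ->
  (exists M : R, forall n, max_singular_value (B n) <= M) ->
  (exists M : R, {ae PA, forall t, `|a t| <= M}) ->
  (exists M : R, {ae PB, forall t, `|b t| <= M}) ->
  (forall k, (0 < k)%N ->
    ccvg (fun n => n.+1%:R^-1 * \tr (A n ^+ k)) (\int[PA]_t (a t ^+ k))%:C) ->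
  (forall k, (0 < k)%N ->
    ccvg (fun n => n.+1%:R^-1 * \tr (B n ^+ k)) (\int[PB]_t (b t ^+ k))%:C) ->
  let A' n : rmx_ncps (P n) n := rmx_cst (P n) (A n) in
  let B' n : rmx_ncps (P n) n := U n * rmx_cst (P n) (B n) * rmx_adj (U n) in
  let rA n : rmx_ncps (P n) n := rmx_cst (P n) (sqrtmx (A n)) in
  [/\ asymptotically_free (fun n (i : bool) => if i then B' n else A' n),
      exists rho : probability R R,
        is_free_addconv (distribution PA a) (distribution PB b) rho /\
        cvg_in_moments (fun n => A' n + B' n) rho
    & (forall n, psdmx (A n)) ->
      exists rho : probability R R,
        is_free_mulconv (distribution PA a) (distribution PB b) rho /\
        cvg_in_moments (fun n => rA n * B' n * rA n) rho].
Proof.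
move=> W_unif H_had UE hA hB [MA AM] [MB BM] abnd bbnd Amom Bmom A' B' rA.
have A_op n := (opbound_max_singular_value (hA n) (AM n)).1.
have B_op n := (opbound_max_singular_value (hB n) (BM n)).1.
have MA0 := (opbound_max_singular_value (hA 0%N) (AM 0%N)).2.
have MB0 := (opbound_max_singular_value (hB 0%N) (BM 0%N)).2.
have A_mom := ntrace_moment abnd Amom.
have B_mom := ntrace_moment bbnd Bmom.
have muA := distribution_compact abnd.
have muB := distribution_compact bbnd.
have free_pairE (tau : {scalar ncpoly R bool}) (tau1 : tau 1 = 1) :
    free_family (S := NCPS tau1) (@ncX R bool) ->
    free_pair (S := NCPS tau1) (ncX R false) (ncX R true).
  rewrite /free_pair.
  have -> // : (fun i : bool => if i then ncX R true else ncX R false) = @ncX R bool.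
  by apply/funext; case.
(* The first matrix [C] is arbitrary, so that the bound serves both models, with [A] and with its
   square root. *)
have B'_op n (e : {ffun 'I_n.+1 -> bool}) t C : opbound MB (model_at H C B (spm R[i] e t) true).
  by rewrite model_at_spm; apply: letter_mx_bound; [exact: had_h_unitary|exact: B_op].
split.
- apply: (model_asymptotically_free W_unif H_had UE) => [||k|k].
  + by exists MA.
  + by exists MB.
  + by eexists; exact: A_mom.
  + by eexists; exact: B_mom.
- have [tau [tau1 [tauP tau_free tauA tauB]]] :=
    model_limit W_unif H_had UE MA0 MB0 A_op B_op A_mom B_mom.
  have [|||||rho [rhoc [rhom rhol]]] := @limit_law_exists _ _ _ _ W U A B W_unif
    (ncX R false + ncX R true) (fun n => model U A B n false + model U A B n true)
    (fun n w => model_at H A B w false + model_at H A B w true) tau (2 * (MA + MB)) tauP.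
  + by move=> n; rewrite linearD /= !ncevalX.
  + by move=> n t; rewrite rmx_evalD !(modelE A B UE).
  + by rewrite mulr_ge0// addr_ge0.
  + by move=> n e t; apply: hermsymmxD; exact: model_at_herm.
  + by move=> n e t; apply: opboundD => //; exact: A_op.
  exists rho; split=> //.
  exists (limit_space UE hA hB tau1 tauP), (ncX R false), (ncX R true); split.
  + by split=> //; exact: ncstarX.
  + by split=> //; exact: ncstarX.
  + exact: free_pairE.
  + split=> //=; rewrite ncstar_additive; congr (_ + _); exact: ncstarX.
move=> A_psd.
(* The free pair behind the multiplicative convolution consists of the root and [B], so the model is
   rebuilt with the root in place of [A]. *)
pose A2 n := sqrtmx (A n).
(* Raised to at least 1 so as to bound both [A] and its root. *)
pose k2 := 1 + MA.
have k21 : 1 <= k2 by rewrite lerDl.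
have k20 : 0 <= k2 := le_trans ler01 k21.
have A_op2 n : opbound k2 (A n) by apply: opbound_le (A_op n); rewrite // lerDr.
have A2_op n : opbound k2 (A2 n) by exact: opbound_sqrtmx.
have hA2 n : A2 n \is hermsymmx by have [] := sqrtmx_psd (A_psd n).
have /choice[m A2_mom] := sqrtmx_moments A_psd k21 A_op2 A_mom.
have [tau [tau1 [tauP tau_free tauA tauB]]] :=
  model_limit W_unif H_had UE k20 MB0 A2_op B_op A2_mom B_mom.
have [|||||rho [rhoc [rhom rhol]]] := @limit_law_exists _ _ _ _ W U A2 B W_unif
    (ncX R false * ncX R true * ncX R false)
    (fun n => model U A2 B n false * model U A2 B n true * model U A2 B n false)
    (fun n w => A2 n *m model_at H A2 B w true *m A2 n) tau (k2 * MB * k2) tauP.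
- by move=> n; rewrite !ncevalM !ncevalX.
- move=> n t; rewrite rmx_evalM rmx_evalM.
  by rewrite (modelE A2 B UE false) (modelE A2 B UE true).
- by rewrite mulr_ge0// mulr_ge0.
- move=> n e t; rewrite -[X in _ *m _ *m X](herm_adj (hA2 n)).
  by apply: hermsymmx_conj; exact: model_at_herm.
- by move=> n e t; do 2?apply: opboundM.
(* A separate limit law for the root alone; the left end 0 of its interval records nonnegativity. *)
have [||||lambda [lambda1 lambdam]] := @law_of_limit _ _ _ _ W W_unif
    (fun n => rmx_cst (P n) (A2 n)) (fun n _ => A2 n) 0 k2 (fun k => tau (ncX R false ^+ k)).
- by [].
- by move=> n e t; exact: hA2.
- move=> n e t i; have s0 := spectral_diag_psd (sqrtmx_psd (A_psd n)) i.
  rewrite -!lecR RRe_real ?ger0_real// s0 -[X in X <= _]ger0_norm//.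
  exact: spectral_diag_bound.
- by move=> j; apply: (tau_pow tauP) => n; rewrite ncevalX.
have [lambdac lambda_ge0] := compact_of_itv lambda1.
exists rho; split; last exact: rhol.
exists (limit_space UE hA2 hB tau1 tauP), (ncX R false), (ncX R true), lambda; split.
- by split; [split=> //; exact: ncstarX|exact: lambda_ge0].
(* The even moments of the root are the moments of [A], which identifies the law of [r * r]. *)
- split=> //=; first by rewrite ncstarM ncstarX.
  move=> j; rewrite -expr2 -exprM tauA.
  apply: ccvg_unique (A2_mom _) (eq_ccvg (A_mom j) _) => n.
  by rewrite /ntrace exprM [sqrtmx _ ^+ 2]sqrtmx_sqr.
- by split=> //; exact: ncstarX.
- exact: free_pairE.
- by split=> //=; rewrite !ncstarM !ncstarX mulrA.
Qed.
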